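(* Let $F$ be a differential field with field of constants $C$, let $E/F$ be a full $G$-primitive Picard-Vessiot extension with matrix $Y\in G(E)$, and let $\boldsymbol x,\boldsymbol z,\boldsymbol y$ be the coefficients of the normal form $Y=\boldsymbol u(\boldsymbol x)n(\bar w)\boldsymbol t(\boldsymbol z)\boldsymbol u(\boldsymbol y)$. Then $L=F(\boldsymbol x)$ is a differential field with constants $C$. Moreover, $E/L$ is a Picard-Vessiot extension with differential Galois group $B^-(C)$ and $E$ is generated as a field by $\boldsymbol z$ and $\boldsymbol y$ over $L$. Further, $E/L$ is a Liouvillian extension with tower of differential fields $$L(\boldsymbol z,y_1,\dots,y_{m-1})(y_m)\supset\dots\supset L(\boldsymbol z)(y_1)\supset L(z_1,\dots,z_{l-1})(z_l)\supset\dots\supset L(z_1)\supset L$$ where the elements $\boldsymbol z$ are exponentials and the elements $\boldsymbol y$ are integrals (each over the preceding field in the tower).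
   Context: $C$ is an algebraically closed field of characteristic zero; $G\subseteq\mathrm{GL}_n$ is one of the (connected) classical groups over $C$, $l$ its Lie rank, $\mathfrak g$ its Lie algebra. Fix a maximal torus $T$ with Lie algebra $\mathfrak h$, root system $\Phi=\Phi^+\cup\Phi^-$ with basis $\{\bar\alpha_1,\dots,\bar\alpha_l\}$, $m=|\Phi^-|$, and a Chevalley basis $\{H_1,\dots,H_l\}\cup\{X_\alpha\mid\alpha\in\Phi\}$ of $\mathfrak g$. $U^-$ and $B^-$ are the maximal unipotent and the Borel subgroup with Lie algebras $\mathfrak u^-=\bigoplus_{\alpha\in\Phi^-}\mathfrak g_\alpha$ and $\mathfrak b^-=\mathfrak h+\mathfrak u^-$. The negative roots are numbered $\beta_1,\dots,\beta_m$ with $\mathrm{ht}(\beta_i)\ge\mathrm{ht}(\beta_{i+1})$, where $\mathrm{ht}(\sum k_i\bar\alpha_i)=\sum k_i$. $u_i(x)=\exp(xX_{\beta_i})$ and $\boldsymbol u(\boldsymbol x)=u_1(x_1)\cdots u_m(x_m)$. $T_i\subseteq T$ is the one-dimensional torus with Lie algebra $\langle H_i\rangle$, $z\mapsto t_i(z)$ is an isomorphism $\mathbb G_m\to T_i$, and $\boldsymbol t(\boldsymbol z)=t_1(z_1)\cdots t_l(z_l)$; the product map $T_1\times\dots\times T_l\to T$ is assumed to be an isomorphism. $\bar w$ is the longest Weyl group element and $n(\bar w)\in N_G(T)(C)$ a fixed representative. $\ell\delta(g)=\partial(g)g^{-1}$. A Picard-Vessiot extension $E/F$ is called full $G$-primitive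 if its differential Galois group is $G(C)$ and there is $Y\in G(E)$ whose entries generate $E$ over $F$ and which satisfies $\ell\delta(Y)\in\mathfrak g(F)$. For such $Y$ there are elements $\boldsymbol x=(x_1,\dots,x_m)$, $\boldsymbol z=(z_1,\dots,z_l)$, $\boldsymbol y=(y_1,\dots,y_m)$ of $E$, algebraically independent over $F$, with $Y=\boldsymbol u(\boldsymbol x)n(\bar w)\boldsymbol t(\boldsymbol z)\boldsymbol u(\boldsymbol y)$; these are called the coefficients of the normal form of $Y$. An element $z\ne0$ is an exponential over a differential field $K$ if $z'/z\in K$, and $y$ is an integral over $K$ if $y'\in K$. *)

(* Defs.v *)
From HB Require Import structures.
From mathcomp Require Import all_boot all_order all_algebra.
From mathcomp Require Import boolp.
From mathcomp Require Import mpoly.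

Set Implicit Arguments.
Unset Strict Implicit.
Unset Printing Implicit Defensive.

Import GRing.Theory.

Local Open Scope ring_scope.

(** * Linear algebraic groups over C, represented by their sets of C-points *)

(* For a ring morphism iota : C -> K, the value at A : 'M[K]_n of a polynomial
   with coefficients in C in the n * n matrix entries. *)
Definition mx_eval (C : closedFieldType) (K : fieldType) (iota : C -> K)
    (n : nat) (A : 'M[K]_n) (p : {mpoly C[n * n]}) : K :=
  mmap iota (mxvec A 0) p.

Definition vanishes_on (C : closedFieldType) (n : nat) (Z : 'M[C]_n -> Prop)
    (p : {mpoly C[n * n]}) : Prop :=
  forall A, Z A -> mx_eval idfun A p = 0.

(* Z(K): the K-points of the Zariski closure of Z in GL_n. *)
Definition points (C : closedFieldType) (K : fieldType) (iota : C -> K)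
    (n : nat) (Z : 'M[C]_n -> Prop) (A : 'M[K]_n) : Prop :=
  A \in unitmx /\ forall p, vanishes_on Z p -> mx_eval iota A p = 0.

Definition zariski_closed (C : closedFieldType) (n : nat)
    (Z : 'M[C]_n -> Prop) : Prop :=
  forall A, Z A <-> points idfun Z A.

Definition subgroup (C : closedFieldType) (n : nat)
    (H : 'M[C]_n -> Prop) : Prop :=
  [/\ forall A, H A -> A \in unitmx,
      H 1%:M,
      forall A B, H A -> H B -> H (A *m B)
    & forall A, H A -> H (invmx A)].

Definition alg_subgroup (C : closedFieldType) (n : nat)
    (H : 'M[C]_n -> Prop) : Prop :=
  subgroup H /\ zariski_closed H.

Definition connected (C : closedFieldType) (n : nat)
    (H : 'M[C]_n -> Prop) : Prop :=
  forall Z1 Z2 : 'M[C]_n -> Prop, zariski_closed Z1 -> zariski_closed Z2 ->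
    (forall A, H A -> Z1 A \/ Z2 A) ->
    (forall A, ~ [/\ H A, Z1 A & Z2 A]) ->
    (forall A, H A -> Z1 A) \/ (forall A, H A -> Z2 A).

(* The tangent space at the identity, with coefficients in K. *)
Definition lie (C : closedFieldType) (K : fieldType) (iota : C -> K)
    (n : nat) (H : 'M[C]_n -> Prop) (X : 'M[K]_n) : Prop :=
  forall p, vanishes_on H p ->
    \sum_(k < n * n) mx_eval iota 1%:M p^`M(k) * mxvec X 0 k = 0.

Definition bracket (R : pzRingType) (n : nat) (A B : 'M[R]_n) : 'M[R]_n :=
  A *m B - B *m A.

(* The regular functions on a closed subset of GL_n are the restrictions of
   elements of C[x_ij, 1/det]. *)
Definition regular_on (C : closedFieldType) (n : nat) (H : 'M[C]_n -> Prop)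
    (f : 'M[C]_n -> C) : Prop :=
  exists (p : {mpoly C[n * n]}) (k : nat),
    forall A, H A -> f A = mx_eval idfun A p / \det A ^+ k.

Definition alg_hom (C : closedFieldType) (n1 n2 : nat)
    (H1 : 'M[C]_n1 -> Prop) (H2 : 'M[C]_n2 -> Prop)
    (f : 'M[C]_n1 -> 'M[C]_n2) : Prop :=
  [/\ forall A, H1 A -> H2 (f A),
      forall A B, H1 A -> H1 B -> f (A *m B) = f A *m f B
    & forall i j, regular_on H1 (fun A => f A i j)].

Definition alg_isom (C : closedFieldType) (n1 n2 : nat)
    (H1 : 'M[C]_n1 -> Prop) (H2 : 'M[C]_n2 -> Prop)
    (f : 'M[C]_n1 -> 'M[C]_n2) : Prop :=
  alg_hom H1 H2 f /\
  exists g, [/\ alg_hom H2 H1 g,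
                forall A, H1 A -> g (f A) = A
              & forall B, H2 B -> f (g B) = B].

(* G_m ^ r; in particular G_m is diag_group at r = 1. *)
Definition diag_group (C : closedFieldType) (r : nat) (A : 'M[C]_r) : Prop :=
  is_diag_mx A /\ A \in unitmx.

Definition torus (C : closedFieldType) (n : nat)
    (H : 'M[C]_n -> Prop) : Prop :=
  alg_subgroup H /\ exists r f, alg_isom (@diag_group C r) H f.

Definition maximal_torus (C : closedFieldType) (n : nat)
    (G T : 'M[C]_n -> Prop) : Prop :=
  [/\ torus T, forall A, T A -> G A
    & forall T', torus T' -> (forall A, T' A -> G A) ->
        (forall A, T A -> T' A) -> forall A, T' A -> T A].

Definition derived (C : closedFieldType) (n : nat) (H : 'M[C]_n -> Prop)
    (A : 'M[C]_n) : Prop :=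
  forall K : 'M[C]_n -> Prop, subgroup K ->
    (forall A1 A2, H A1 -> H A2 ->
       K (A1 *m A2 *m invmx A1 *m invmx A2)) ->
    K A.

Definition solvable (C : closedFieldType) (n : nat)
    (H : 'M[C]_n -> Prop) : Prop :=
  exists k, forall A, iter k (@derived C n) H A -> A = 1%:M.

Definition borel (C : closedFieldType) (n : nat)
    (G B : 'M[C]_n -> Prop) : Prop :=
  [/\ [/\ alg_subgroup B, connected B & solvable B],
      forall A, B A -> G A
    & forall B', [/\ alg_subgroup B', connected B' & solvable B'] ->
        (forall A, B' A -> G A) ->
        (forall A, B A -> B' A) -> forall A, B' A -> B A].

(* SL_n, Sp_n and SO_n, the last two for an arbitrary nondegenerate
   alternating or symmetric form J. *)
Definition classical_group (C : closedFieldType) (n : nat)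
    (G : 'M[C]_n -> Prop) : Prop :=
  [\/ forall A, G A <-> \det A = 1,
      exists J : 'M[C]_n, [/\ J^T = - J, J \in unitmx
        & forall A, G A <-> A^T *m J *m A = J]
    | exists J : 'M[C]_n, [/\ J^T = J, J \in unitmx
        & forall A, G A <-> A^T *m J *m A = J /\ \det A = 1]].

(** * Roots and Chevalley bases *)

(* Linear forms on h are functions on 'M[C]_n of which only the restriction to
   h matters. *)
Definition root_space (C : closedFieldType) (n : nat)
    (g h : 'M[C]_n -> Prop) (a : 'M[C]_n -> C) (X : 'M[C]_n) : Prop :=
  g X /\ forall A, h A -> bracket A X = a A *: X.

Definition is_root (C : closedFieldType) (n : nat)
    (g h : 'M[C]_n -> Prop) (a : 'M[C]_n -> C) : Prop :=
  (exists2 A, h A & a A != 0) /\ exists2 X, root_space g h a X & X != 0.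

(* The form with integral coordinates k with respect to the basis alpha. *)
Definition root_of (C : closedFieldType) (n l : nat)
    (alpha : 'I_l -> 'M[C]_n -> C) (k : 'rV[int]_l) (A : 'M[C]_n) : C :=
  \sum_i (k 0 i)%:~R * alpha i A.

Definition nonneg_coords (l : nat) (k : 'rV[int]_l) : bool :=
  [forall i, 0 <= k 0 i].

Definition ht (l : nat) (k : 'rV[int]_l) : int := \sum_i k 0 i.

(* alpha is a basis of the root system of g with respect to h, and Phi lists
   the coordinates of all the roots in this basis. *)
Definition root_basis (C : closedFieldType) (n l : nat)
    (g h : 'M[C]_n -> Prop) (alpha : 'I_l -> 'M[C]_n -> C)
    (Phi : seq 'rV[int]_l) : Prop :=
  [/\ forall c : 'I_l -> C,
        (forall A, h A -> \sum_i c i * alpha i A = 0) -> forall i, c i = 0,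
      forall i, is_root g h (alpha i),
      forall a, is_root g h a ->
        exists2 k : 'rV[int]_l, nonneg_coords k || nonneg_coords (- k)
          & forall A, h A -> a A = root_of alpha k A,
      uniq Phi
    & forall k, k \in Phi <-> is_root g h (root_of alpha k)].

(* [X_a, X_(-a)] is the coroot of a since it lies in h and a takes the value 2
   on it. *)
Definition chevalley_basis (C : closedFieldType) (n l : nat)
    (g h : 'M[C]_n -> Prop) (alpha : 'I_l -> 'M[C]_n -> C)
    (Phi : seq 'rV[int]_l) (Hs : 'I_l -> 'M[C]_n)
    (X : 'rV[int]_l -> 'M[C]_n) : Prop :=
  let s := [seq Hs i | i <- enum 'I_l] ++ [seq X k | k <- Phi] in
  [/\ free s /\ forall A, g A <-> A \in <<s>>%VS,
      forall k, k \in Phi -> root_space g h (root_of alpha k) (X k),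
      forall k, k \in Phi -> h (bracket (X k) (X (- k))) /\
        root_of alpha k (bracket (X k) (X (- k))) = 2,
      forall i, Hs i =
        bracket (X (delta_mx 0 i)) (X (- delta_mx 0 i))
    & forall k1 k2, k1 \in Phi -> k2 \in Phi -> k1 + k2 \in Phi ->
        exists2 c : C, bracket (X k1) (X k2) = c *: X (k1 + k2)
          & bracket (X (- k1)) (X (- k2)) = - c *: X (- (k1 + k2))].

(** * The longest element of the Weyl group *)

(* A word in the simple reflections acts on h; s_i maps A to
   A - alpha_i(A) H_i. *)
Definition word_act (C : closedFieldType) (n l : nat)
    (alpha : 'I_l -> 'M[C]_n -> C) (Hs : 'I_l -> 'M[C]_n)
    (w : seq 'I_l) (A : 'M[C]_n) : 'M[C]_n :=
  foldr (fun i A' => A' - alpha i A' *: Hs i) A w.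

Definition reduced_word (C : closedFieldType) (n l : nat)
    (h : 'M[C]_n -> Prop) (alpha : 'I_l -> 'M[C]_n -> C)
    (Hs : 'I_l -> 'M[C]_n) (w : seq 'I_l) : Prop :=
  forall w', (forall A, h A ->
                word_act alpha Hs w' A = word_act alpha Hs w A) ->
    (size w <= size w')%N.

Definition longest_word (C : closedFieldType) (n l : nat)
    (h : 'M[C]_n -> Prop) (alpha : 'I_l -> 'M[C]_n -> C)
    (Hs : 'I_l -> 'M[C]_n) (w : seq 'I_l) : Prop :=
  reduced_word h alpha Hs w /\
  forall w', reduced_word h alpha Hs w' -> (size w' <= size w)%N.

Definition longest_repr (C : closedFieldType) (n l : nat)
    (G T h : 'M[C]_n -> Prop) (alpha : 'I_l -> 'M[C]_n -> C)
    (Hs : 'I_l -> 'M[C]_n) (nw : 'M[C]_n) : Prop :=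
  [/\ G nw,
      forall A, T A <-> T (nw *m A *m invmx nw)
    & exists2 w, longest_word h alpha Hs w
        & forall A, h A -> nw *m A *m invmx nw = word_act alpha Hs w A].

(** * The group-theoretic data *)

(* The pair (P, k) stands for the matrix z ^- k *: P(z) over C[z, 1/z]. *)
Definition laurent_mx (C : closedFieldType) (n : nat) : Type :=
  ('M[{poly C}]_n * nat)%type.

Definition laurent_eval (C : closedFieldType) (K : fieldType) (iota : C -> K)
    (n : nat) (P : laurent_mx C n) (z : K) : 'M[K]_n :=
  z ^- P.2 *: \matrix_(i, j) (map_poly iota (P.1 i j)).[z].

(* The exponential of a nilpotent matrix N, for which N ^+ n = 0. *)
Definition mxexp (K : fieldType) (n : nat) (N : 'M[K]_n) : 'M[K]_n :=
  \sum_(k < n) (k`!%:R)^-1 *: N ^+ k.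

Record group_data (C : closedFieldType) (n l m : nat) : Type := GroupData {
  grp : 'M[C]_n -> Prop;
  max_torus : 'M[C]_n -> Prop;
  borel_neg : 'M[C]_n -> Prop;
  simple_root : 'I_l -> 'M[C]_n -> C;
  roots : seq 'rV[int]_l;
  neg_root : 'I_m -> 'rV[int]_l;
  chev_H : 'I_l -> 'M[C]_n;
  chev_X : 'rV[int]_l -> 'M[C]_n;
  torus1 : 'I_l -> 'M[C]_n -> Prop;
  torus1_param : 'I_l -> laurent_mx C n;
  weyl_repr : 'M[C]_n;

  grp_classical : classical_group grp;
  max_torusP : maximal_torus grp max_torus;
  rootsP : root_basis (lie idfun grp) (lie idfun max_torus) simple_root roots;
  neg_rootP :
    perm_eq (codom neg_root) [seq k <- roots | nonneg_coords (- k)];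
  neg_root_ht : forall i j : 'I_m, (i <= j)%N ->
    ht (neg_root j) <= ht (neg_root i);
  chevalleyP : chevalley_basis (lie idfun grp) (lie idfun max_torus)
    simple_root roots chev_H chev_X;
  borel_negP : borel grp borel_neg;
  lie_borel_neg : forall A, lie idfun borel_neg A <->
    exists (A0 : 'M[C]_n) (N : 'I_m -> 'M[C]_n),
      [/\ lie idfun max_torus A0,
          forall j, root_space (lie idfun grp) (lie idfun max_torus)
                      (root_of simple_root (neg_root j)) (N j)
        & A = A0 + \sum_j N j];
  torus1P : forall i, [/\ alg_subgroup (torus1 i),
    forall A, torus1 i A -> max_torus A,
    forall A, lie idfun (torus1 i) A <-> exists c, A = c *: chev_H i
    & alg_isom (@diag_group C 1) (torus1 i)
        (fun A => laurent_eval idfun (torus1_param i) (A 0 0))];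
  (* the product map from the product of the T_i to T is an isomorphism;
     r i is the i-th component of its inverse *)
  torus_prodP : exists r : 'I_l -> 'M[C]_n -> 'M[C]_n,
    [/\ forall i, alg_hom max_torus (torus1 i) (r i),
        forall A, max_torus A -> \prod_i r i A = A
      & forall A : 'I_l -> 'M[C]_n, (forall i, torus1 i (A i)) ->
          forall i, r i (\prod_j A j) = A i];
  weyl_reprP : longest_repr grp max_torus (lie idfun max_torus)
    simple_root chev_H weyl_repr
}.

Definition unip_prod (C : closedFieldType) (E : fieldType) (iota : C -> E)
    (n l m : nat) (S : group_data C n l m) (x : m.-tuple E) : 'M[E]_n :=
  \prod_(i < m)
    mxexp (tnth x i *: map_mx iota (chev_X S (neg_root S i))).

Definition torus_prod (C : closedFieldType) (E : fieldType) (iota : C -> E)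
    (n l m : nat) (S : group_data C n l m) (z : l.-tuple E) : 'M[E]_n :=
  \prod_(i < l) laurent_eval iota (torus1_param S i) (tnth z i).

(** * Differential subfields of a field E with derivation D *)

Definition derivation (E : fieldType) (D : {additive E -> E}) : Prop :=
  forall a b, D (a * b) = D a * b + a * D b.

Definition diff_subfield (E : fieldType) (D : E -> E) (K : {pred E}) : Prop :=
  divring_closed K /\ {in K, forall a, D a \in K}.

(* The field of constants of K is the image of C. *)
Definition constants (C E : fieldType) (iota : C -> E) (D : E -> E)
    (K : {pred E}) : Prop :=
  forall a, (a \in K /\ D a = 0) <-> exists c, a = iota c.

(* K(s) as a subfield of E. *)
Definition adjoin (E : fieldType) (K : {pred E}) (s : seq E) : {pred E} :=
  fun a => `[< forall K' : {pred E}, divring_closed K' ->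
                 {subset K <= K'} -> {subset s <= K'} -> a \in K' >].

Definition mx_entries (E : Type) (n : nat) (Y : 'M[E]_n) : seq E :=
  [seq Y ij.1 ij.2 | ij <- enum {: 'I_n * 'I_n}].

Definition log_deriv (E : fieldType) (D : E -> E) (n : nat) (Y : 'M[E]_n) :
    'M[E]_n :=
  map_mx D Y *m invmx Y.

(* E is generated over K by the entries of the fundamental matrix Y of a linear
   differential equation defined over K. *)
Definition fundamental (E : fieldType) (D : E -> E) (K : {pred E})
    (n : nat) (Y : 'M[E]_n) : Prop :=
  [/\ Y \in unitmx, forall i j, log_deriv D Y i j \in K
    & forall a, a \in adjoin K (mx_entries Y)].

(* E is a Picard-Vessiot extension of K. *)
Definition picard_vessiot (E : fieldType) (D : E -> E) (K : {pred E}) : Prop :=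
  [/\ diff_subfield D K,
      forall a, D a = 0 -> a \in K
    & exists n (Y : 'M[E]_n), fundamental D K Y].

Definition diff_gal (E : fieldType) (D : E -> E) (K : {pred E})
    (s : {rmorphism E -> E}) : Prop :=
  [/\ bijective s, forall a, s (D a) = D (s a) & {in K, forall a, s a = a}].

(* For a fundamental matrix Y of E over K, the map sending s to Y^-1 s(Y) is an
   injective group morphism from the differential Galois group to GL_n(C); its
   image is H(C). *)
Definition diff_gal_is (C E : fieldType) (iota : C -> E) (D : E -> E)
    (K : {pred E}) (n : nat) (Y : 'M[E]_n) (H : 'M[C]_n -> Prop) : Prop :=
  (forall s, diff_gal D K s ->
     exists2 A, H A & map_mx s Y = Y *m map_mx iota A) /\
  (forall A, H A ->
     exists2 s, diff_gal D K s & map_mx s Y = Y *m map_mx iota A).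

Definition full_primitive (C : closedFieldType) (E : fieldType) (iota : C -> E)
    (D : E -> E) (F : {pred E}) (n : nat) (G : 'M[C]_n -> Prop)
    (Y : 'M[E]_n) : Prop :=
  [/\ picard_vessiot D F,
      points iota G Y,
      forall a, a \in adjoin F (mx_entries Y),
      lie iota G (log_deriv D Y) /\ (forall i j, log_deriv D Y i j \in F)
    & diff_gal_is iota D F Y G].

Definition alg_independent (E : fieldType) (K : {pred E}) (n : nat)
    (s : n.-tuple E) : Prop :=
  forall p : {mpoly E[n]}, p \is a mpolyOver n K -> p.@[tnth s] = 0 -> p = 0.

Definition normal_form_coeffs (C : closedFieldType) (E : fieldType)
    (iota : C -> E) (F : {pred E}) (n l m : nat) (S : group_data C n l m)
    (Y : 'M[E]_n) (x : m.-tuple E) (z : l.-tuple E) (y : m.-tuple E) : Prop :=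
  alg_independent F [tuple of x ++ z ++ y] /\
  Y = unip_prod iota S x *m map_mx iota (weyl_repr S)
        *m torus_prod iota S z *m unip_prod iota S y.

Definition exponential (E : fieldType) (D : E -> E) (K : {pred E})
    (t : E) : Prop :=
  t != 0 /\ D t / t \in K.

Definition integral (E : fieldType) (D : E -> E) (K : {pred E})
    (t : E) : Prop :=
  D t \in K.

Definition algebraic_elt (E : fieldType) (K : {pred E}) (t : E) : Prop :=
  exists p : {poly E}, [/\ p != 0, p \is a polyOver K & root p t].

(* E is a Liouvillian extension of L. *)
Definition liouvillian (E : fieldType) (D : E -> E) (L : {pred E}) : Prop :=
  exists N (K : nat -> {pred E}) (t : nat -> E),
    [/\ K 0%N =i L, K N =i predT,
        forall i, (i <= N)%N -> diff_subfield D (K i)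
      & forall i, (i < N)%N -> K i.+1 =i adjoin (K i) [:: t i] /\
          [\/ algebraic_elt (K i) (t i), exponential D (K i) (t i)
            | integral D (K i) (t i)]].

(* Main.v *)
Require Import Defs.
From HB Require Import structures.
From mathcomp Require Import all_boot all_order all_algebra.
From mathcomp Require Import boolp.
From mathcomp Require Import mpoly ring.
Set Implicit Arguments.
Unset Strict Implicit.
Unset Printing Implicit Defensive.

Import Order.TTheory GRing.Theory Num.Theory.
Local Open Scope ring_scope.

(* Write A = Y' Y^-1 and let u = u(x), b = t(z) u(y), so that Y = u n b. Then
   u^-1 A u = u^-1 u' + n (b' b^-1) n^-1, where u^-1 u' lies in the E-span of
   u^- and, as the longest element makes negative roots positive, the second
   term lies in that of b^+. Hence the negative root coordinates of u^-1 A u,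
   which lie in L, are those of u^-1 u'; stripping the factors of u one after
   the other gives x_i' in L. Then b' b^-1 has entries in L, its coordinates in
   h are constant multiples of z_i'/z_i, and the factors of u(y) are stripped
   off in the same way.

   If s is an automorphism over L, then Y^-1 s(Y) = b^-1 s(b) is a C-point of
   the Zariski closure of B^-, hence in B^-(C). Conversely, if Y^-1 s(Y) is in
   B^-(C), then n^-1 u(x)^-1 u(s x) n normalizes the E-span of b^-; therefore
   u(x)^-1 u(s x) centralizes h, which forces s x = x.

   That n makes negative roots positive is the exchange argument for words in
   the simple reflections. The relation between the groups and their Lie
   algebras is reduced to rational curves: a rational function all of whose
   iterated derivatives vanish at a point is zero. *)

(** * Evaluation of polynomials at matrices and Lie algebras *)

(** Three facts that are not part of the data shape the proof. The negative of a simple root must be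
    a root, or there is no SL_2-triple to represent a simple reflection; this comes from the trace
    form, and it is where the group has to be classical. $B^-$ is known only as a Borel subgroup
    with a prescribed Lie algebra, not as a product $TU^-$; that the curves $t_i$ and $u_i$ run
    inside it is obtained by integrating tangent vectors. Finally the groups are sets of $C$-points,
    whereas $t(z)u(y)$ has entries in $E$. Such a matrix is controlled by the polynomial equations
    with coefficients in $E$ that hold on the $C$-points; coefficients in $E$, not just in $C$, make
    this notion stable under products.

    The Galois group over $L$ is found inside the known group $G(C)$ over $F$, by deciding which
    automorphisms fix $x$, so no Galois correspondence enters. All stripping of factors rests on the
    numbering of the negative roots by height: a bracket with a negative root vector leads to
    strictly larger indices. *)

Lemma mpoly_alg_ind (R : comNzRingType) (k : nat) (P : {mpoly R[k]} -> Prop) :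
  (forall c, P c%:MP) -> (forall i, P 'X_i) ->
  (forall p q, P p -> P q -> P (p + q)) ->
  (forall p q, P p -> P q -> P (p * q)) -> forall p, P p.
Proof.
move=> hC hX hD hM; elim/mpolyind=> [|c m p _ _ IH]; first by rewrite -mpolyC0.
apply: (hD) => //; rewrite -mul_mpolyC; apply: (hM) => //.
rewrite mpolyXE_id; elim/big_rec: _ => [|i q _ IHq]; first by rewrite -mpolyC1.
apply: (hM) => //; elim: (m i) => [|e IHe]; first by rewrite expr0 -mpolyC1.
by rewrite exprS; apply: hM.
Qed.

(** The differential of [p] at [A] in the direction [Y]; at [A = 1%:M] it is the sum in the
    definition of [lie]. *)
Definition dmx_eval (C : closedFieldType) (K : fieldType) (iota : C -> K)
    (n : nat) (A : 'M[K]_n) (p : {mpoly C[n * n]}) (Y : 'M[K]_n) : K :=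
  \sum_(k < n * n) mx_eval iota A p^`M(k) * mxvec Y 0 k.

Section Evaluation.
Variables (C : closedFieldType) (K : fieldType) (iota : {rmorphism C -> K}).
Variable n : nat.
Implicit Types (p q : {mpoly C[n * n]}) (A B Y : 'M[K]_n).

Lemma mx_evalC A c : mx_eval iota A c%:MP = iota c.
Proof. exact: mmapC. Qed.

Lemma mx_evalX A i : mx_eval iota A 'X_i = mxvec A 0 i.
Proof. by rewrite /mx_eval mmapX mmap1U. Qed.

Lemma mx_evalD A p q : mx_eval iota A (p + q) = mx_eval iota A p + mx_eval iota A q.
Proof. exact: mmapD. Qed.

Lemma mx_evalM A p q : mx_eval iota A (p * q) = mx_eval iota A p * mx_eval iota A q.
Proof. exact: rmorphM. Qed.

Lemma dmx_evalC A c Y : dmx_eval iota A c%:MP Y = 0.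
Proof.
by rewrite /dmx_eval big1 // => k _; rewrite mderivC -mpolyC0 mx_evalC rmorph0 mul0r.
Qed.

Lemma dmx_evalX A i Y : dmx_eval iota A 'X_i Y = mxvec Y 0 i.
Proof.
rewrite /dmx_eval (bigD1 i) //= big1 => [|k neq_ki].
  have -> : 'X_i^`M(i) = 1 :> {mpoly C[n * n]}.
    rewrite mderivX mnm1E eqxx scale1r -mpolyX0; congr 'X_[_].
    by apply/mnmP => j; rewrite mnmBE subnn mnm0E.
  by rewrite -mpolyC1 mx_evalC rmorph1 mul1r addr0.
by rewrite mderivX mnm1E eq_sym (negPf neq_ki) scale0r -mpolyC0 mx_evalC rmorph0 mul0r.
Qed.

Lemma dmx_evalD A p q Y :
  dmx_eval iota A (p + q) Y = dmx_eval iota A p Y + dmx_eval iota A q Y.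
Proof.
by rewrite /dmx_eval -big_split; apply: eq_bigr => k _; rewrite mderivD mx_evalD mulrDl.
Qed.

Lemma dmx_evalM A p q Y :
  dmx_eval iota A (p * q) Y =
    dmx_eval iota A p Y * mx_eval iota A q + mx_eval iota A p * dmx_eval iota A q Y.
Proof.
rewrite /dmx_eval mulr_suml mulr_sumr -big_split; apply: eq_bigr => k _ /=.
by rewrite mderivM mx_evalD !mx_evalM; ring.
Qed.

End Evaluation.

Section LinearPullback.
Variables (C : closedFieldType) (n1 n2 : nat).

Lemma mx_eval_linear (f : {linear 'M[C]_n1 -> C^o}) :
  exists q : {mpoly C[n1 * n1]},
    (forall A, mx_eval idfun A q = f A) /\ forall A Y, dmx_eval idfun A q Y = f Y.
Proof.
have fE A : f A = \sum_k mxvec A 0 k * f (vec_mx (delta_mx 0 k)).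
  rewrite -{1}[A]mxvecK {1}(row_sum_delta (mxvec A)) !linear_sum /=.
  by apply: eq_bigr => k _; rewrite !linearZ.
exists (\sum_k 'X_k * (f (vec_mx (delta_mx 0 k)))%:MP).
split=> [A | A Y]; rewrite fE.
  rewrite /mx_eval rmorph_sum /=; apply: eq_bigr => k _.
  by rewrite -/(mx_eval idfun A _) mx_evalM mx_evalX mx_evalC.
elim/big_rec2: _ => [|k a p _ IH]; first by rewrite -mpolyC0 dmx_evalC.
by rewrite dmx_evalD dmx_evalM IH mx_evalX mx_evalC dmx_evalX dmx_evalC mulr0 addr0.
Qed.

(** The chain rule for a linear substitution. Conjugation and translation by a group element are
    linear in the matrix entries, so no general polynomial maps have to be composed. *)
Lemma mx_eval_pullback (f : {linear 'M[C]_n1 -> 'M[C]_n2}) (p : {mpoly C[n2 * n2]}) :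
  exists q : {mpoly C[n1 * n1]},
    (forall A, mx_eval idfun A q = mx_eval idfun (f A) p) /\
    forall A Y, dmx_eval idfun A q Y = dmx_eval idfun (f A) p (f Y).
Proof.
elim/mpoly_alg_ind: p => [c|i|p1 p2 [q1 [e1 d1]] [q2 [e2 d2]]|p1 p2 [q1 [e1 d1]] [q2 [e2 d2]]].
- by exists c%:MP; split=> *; rewrite ?mx_evalC ?dmx_evalC.
- pose f' A : C^o := mxvec (f A) 0 i.
  have f'L : linear f' by move=> a A B; rewrite /f' !linearP /= !mxE.
  pose F := GRing.isLinear.Build C _ _ _ f' f'L.
  pose F' : {linear 'M[C]_n1 -> C^o} := HB.pack f' F.
  have [q [e d]] := mx_eval_linear F'.
  by exists q; split=> *; rewrite ?e ?d ?mx_evalX ?dmx_evalX.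
- by exists (q1 + q2); split=> *; rewrite ?mx_evalD ?dmx_evalD ?e1 ?e2 ?d1 ?d2.
- by exists (q1 * q2); split=> *; rewrite ?mx_evalM ?dmx_evalM ?e1 ?e2 ?d1 ?d2.
Qed.

End LinearPullback.

Section LieAlgebra.
Variable C : closedFieldType.

Lemma lie_linear n1 n2 (H1 : 'M[C]_n1 -> Prop) (H2 : 'M[C]_n2 -> Prop)
    (f : {linear 'M[C]_n1 -> 'M[C]_n2}) :
  f 1%:M = 1%:M -> (forall A, H1 A -> H2 (f A)) ->
  forall X, lie idfun H1 X -> lie idfun H2 (f X).
Proof.
move=> f1 Hf X lieX p vp; have [q [eq dq]] := mx_eval_pullback f p.
have := lieX q; rewrite -/(dmx_eval _ _ _ _) dq f1; apply=> A HA.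
by rewrite eq; apply/vp/Hf.
Qed.

Lemma lie_sub n (H1 H2 : 'M[C]_n -> Prop) :
  (forall A, H1 A -> H2 A) -> forall X, lie idfun H1 X -> lie idfun H2 X.
Proof. by move=> sub X lieX p vp; apply: lieX => A /sub /vp. Qed.

(** A linear equation is its own differential, so it passes from the group to its Lie algebra.
    Commutation with the torus is inherited by its Lie algebra in this way. *)
Lemma lie_linear_eq0 n1 n2 (H : 'M[C]_n1 -> Prop) (f : {linear 'M[C]_n1 -> 'M[C]_n2}) :
  (forall A, H A -> f A = 0) -> forall X, lie idfun H X -> f X = 0.
Proof.
move=> Hf X lieX; apply/matrixP => i j; rewrite [RHS]mxE.
pose f' A : C^o := f A i j.
have f'L : linear f' by move=> a A B; rewrite /f' !linearP /= !mxE.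
pose F := GRing.isLinear.Build C _ _ _ f' f'L.
pose F' : {linear 'M[C]_n1 -> C^o} := HB.pack f' F.
have [q [e d]] := mx_eval_linear F'.
have := lieX q; rewrite -/(dmx_eval _ _ _ _) d; apply => A HA.
by rewrite e /= /f' Hf ?mxE.
Qed.

Variables (n : nat) (H : 'M[C]_n -> Prop).

Lemma lieD X Y : lie idfun H X -> lie idfun H Y -> lie idfun H (X + Y).
Proof.
move=> lX lY p vp; transitivity (dmx_eval idfun 1%:M p X + dmx_eval idfun 1%:M p Y).
  by rewrite -big_split; apply: eq_bigr => k _; rewrite linearD mxE mulrDr.
by rewrite /dmx_eval lX ?lY ?addr0.
Qed.

Lemma lieZ a X : lie idfun H X -> lie idfun H (a *: X).
Proof.
move=> lX p vp; transitivity (a * dmx_eval idfun 1%:M p X).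
  by rewrite mulr_sumr; apply: eq_bigr => k _; rewrite linearZ mxE mulrCA.
by rewrite /dmx_eval lX ?mulr0.
Qed.

Lemma lie_conj A X : subgroup H -> H A -> lie idfun H X ->
  lie idfun H (A *m X *m invmx A).
Proof.
move=> [HU _ HM HV] HA; pose f (B : 'M[C]_n) := A *m B *m invmx A.
have fL : linear f by move=> a B1 B2; rewrite /f mulmxDr mulmxDl -scalemxAr -scalemxAl.
pose F := GRing.isLinear.Build C _ _ _ f fL.
pose F' : {linear 'M[C]_n -> 'M[C]_n} := HB.pack f F.
have F'E B : F' B = A *m B *m invmx A by [].
rewrite -F'E; apply: lie_linear => [|B HB]; rewrite F'E ?mulmx1 ?mulmxV ?HU //.
by apply: (HM); [apply: HM | apply: HV].
Qed.

(* Right translations by H preserve the ideal of H, so differentiating along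
   X in Lie H does as well. *)
Lemma vanishes_dmx_eval X p : subgroup H -> lie idfun H X -> vanishes_on H p ->
  forall A, H A -> dmx_eval idfun A p (A *m X) = 0.
Proof.
move=> [_ _ HM _] lX vp A HA.
have [q [e d]] := mx_eval_pullback (mulmx A) p.
have := lX q; rewrite -/(dmx_eval _ _ _ _) d /= mulmx1; apply=> B HB.
by rewrite e; apply/vp/HM.
Qed.

End LieAlgebra.

(** * Left-invariant vector fields and the Lie bracket *)

Section InvariantVectorField.
Variables (C : closedFieldType) (n : nat).
Implicit Types (p q : {mpoly C[n * n]}) (X Y : 'M[C]_n).

(** The left-invariant vector field of [X] acting on polynomials, that is, the derivative along
    [A *m X]. The inner sum is the [k]-th entry of [A *m X], a linear form in the entries of [A]. *)
Definition lie_deriv X p : {mpoly C[n * n]} :=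
  \sum_k p^`M(k) * \sum_j (lin_mx (mulmxr X) j k)%:MP * 'X_j.

Lemma mx_eval_lie_deriv X p A :
  mx_eval idfun A (lie_deriv X p) = dmx_eval idfun A p (A *m X).
Proof.
rewrite /mx_eval rmorph_sum /=; apply: eq_bigr => k _.
rewrite -/(mx_eval idfun A _) mx_evalM; congr (_ * _).
have -> : mxvec (A *m X) = mxvec A *m lin_mx (mulmxr X) by rewrite mul_vec_lin.
rewrite mxE /mx_eval rmorph_sum /=; apply: eq_bigr => j _.
by rewrite -/(mx_eval idfun A _) mx_evalM mx_evalC mx_evalX mulrC.
Qed.

Lemma lie_derivC X c : lie_deriv X c%:MP = 0.
Proof. by rewrite /lie_deriv big1 // => k _; rewrite mderivC mul0r. Qed.

Lemma lie_derivD X p q : lie_deriv X (p + q) = lie_deriv X p + lie_deriv X q.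
Proof.
by rewrite /lie_deriv -big_split; apply: eq_bigr => k _; rewrite mderivD mulrDl.
Qed.

Lemma lie_derivM X p q : lie_deriv X (p * q) = lie_deriv X p * q + p * lie_deriv X q.
Proof.
rewrite /lie_deriv mulr_suml mulr_sumr -big_split; apply: eq_bigr => k _ /=.
by rewrite mderivM; ring.
Qed.

Lemma mx_eval_lie_deriv2 X Y i A :
  mx_eval idfun A (lie_deriv X (lie_deriv Y 'X_i)) = mxvec (A *m X *m Y) 0 i.
Proof.
have -> : lie_deriv Y 'X_i = \sum_j (lin_mx (mulmxr Y) j i)%:MP * 'X_j.
  rewrite /lie_deriv (bigD1 i) //= [X in _ + X]big1 => [|k neq_ki].
    have -> : 'X_i^`M(i) = 1 :> {mpoly C[n * n]}.
      rewrite mderivX mnm1E eqxx scale1r -mpolyX0; congr 'X_[_].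
      by apply/mnmP => j; rewrite mnmBE subnn mnm0E.
    by rewrite mul1r addr0.
  by rewrite mderivX mnm1E eq_sym (negPf neq_ki) scale0r mul0r.
have -> : mxvec (A *m X *m Y) = mxvec (A *m X) *m lin_mx (mulmxr Y).
  by rewrite mul_vec_lin.
rewrite mx_eval_lie_deriv mxE.
elim/big_rec2: _ => [|j a p _ IH]; first by rewrite -mpolyC0 dmx_evalC.
by rewrite dmx_evalD dmx_evalM IH mx_evalC dmx_evalX dmx_evalC mul0r add0r mulrC.
Qed.

(** The commutator of two derivations is again a derivation, so induction over the generators
    reduces the claim to the coordinates, where it reads [A *m X *m Y - A *m Y *m X]. *)
Lemma lie_deriv_bracket X Y p A :
  mx_eval idfun A (lie_deriv X (lie_deriv Y p)) -
  mx_eval idfun A (lie_deriv Y (lie_deriv X p)) =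
  mx_eval idfun A (lie_deriv (bracket X Y) p).
Proof.
elim/mpoly_alg_ind: p => [c|i|p q IHp IHq|p q IHp IHq].
- by rewrite !lie_derivC -mpolyC0 mx_evalC subrr.
- rewrite !mx_eval_lie_deriv2 mx_eval_lie_deriv dmx_evalX /bracket mulmxBr !mulmxA.
  by rewrite linearB !mxE.
- by rewrite !lie_derivD !mx_evalD -IHp -IHq; ring.
- rewrite !lie_derivM !lie_derivD !lie_derivM !mx_evalD !mx_evalM -IHp -IHq; ring.
Qed.

(** The ideal of [H] is stable under the vector fields of [X] and [Y], hence under their commutator,
    which is then evaluated at the identity. *)
Lemma lie_bracket (H : 'M[C]_n -> Prop) X Y : subgroup H ->
  lie idfun H X -> lie idfun H Y -> lie idfun H (bracket X Y).
Proof.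
move=> sH lX lY p vp; have [_ H1 _ _] := sH.
have stable Z q : lie idfun H Z -> vanishes_on H q -> vanishes_on H (lie_deriv Z q).
  by move=> lZ vq A HA; rewrite mx_eval_lie_deriv; apply: vanishes_dmx_eval HA.
rewrite -/(dmx_eval _ _ _ _) -{1}[bracket X Y]mul1mx -mx_eval_lie_deriv.
by rewrite -lie_deriv_bracket !(stable _ _ _ (stable _ _ _ _)) ?subrr.
Qed.

End InvariantVectorField.

(** * Rational curves in algebraic groups *)

Section RationalCurves.
Variables (K : fieldType) (charK : [pchar K] =i pred0).

Lemma natf_eq0 k : (k%:R == 0 :> K) = (k == 0)%N.
Proof. by move/pcharf0P: charK. Qed.

Lemma natf_inj : injective (fun k => k%:R : K).
Proof.
move=> i j /eqP.
wlog lij : i j / (i <= j)%N.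
  move=> H; case: (leqP i j) => [|/ltnW] lij e; first exact: H.
  by apply/esym/H => //; rewrite eq_sym.
by rewrite eq_sym -subr_eq0 -natrB // natf_eq0 subn_eq0 => lji; apply/eqP; rewrite eqn_leq lij.
Qed.

Lemma poly_nat_eq0 (p : {poly K}) : (forall k, p.[k%:R] = 0) -> p = 0.
Proof.
move=> p0; pose rs := [seq k%:R : K | k <- iota 0 (size p)].
apply: (@roots_geq_poly_eq0 _ _ rs); last by rewrite size_map size_iota.
  by apply/allP => _ /mapP[k _ ->]; apply/rootP/p0.
by rewrite map_inj_uniq ?iota_uniq //; apply: natf_inj.
Qed.

Definition zariski_dense (U : K -> Prop) : Prop :=
  forall p : {poly K}, (forall c, U c -> p.[c] = 0) -> p = 0.

Lemma zariski_dense_neq0 (q : {poly K}) :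
  q != 0 -> zariski_dense (fun c => q.[c] != 0).
Proof.
move=> q0 p p0; have : p * q = 0.
  apply: poly_nat_eq0 => k; rewrite hornerM; case: (eqVneq q.[k%:R] 0) => [->|/p0->].
    by rewrite mulr0.
  by rewrite mul0r.
by move/eqP; rewrite mulf_eq0 (negPf q0) orbF => /eqP.
Qed.

Variables (a : {poly K}) (U : K -> Prop) (denseU : zariski_dense U).

(* On U, f is the rational function R / Q and f1 is its image under the
   derivation a d/dX. *)
Definition rat_deriv (f f1 : K -> K) : Prop :=
  exists Q R : {poly K}, (forall c, U c -> Q.[c] != 0) /\
    forall c, U c -> f c * Q.[c] = R.[c] /\
      f1 c * Q.[c] + f c * (a * Q^`()).[c] = (a * R^`()).[c].

Lemma rat_deriv_poly (p : {poly K}) : rat_deriv (horner p) (horner (a * p^`())).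
Proof.
exists 1, p; split=> [c _|c _]; first by rewrite hornerE oner_eq0.
by rewrite -[1]polyC1 derivC !hornerE /= !mulr0 addr0.
Qed.

Lemma rat_deriv_const c : rat_deriv (fun=> c) (fun=> 0).
Proof.
exists 1, c%:P; split=> [b _|b _]; first by rewrite hornerE oner_eq0.
by rewrite -[1]polyC1 !derivC !hornerE /= !(mulr0, mul0r, addr0).
Qed.

Lemma rat_derivD f f1 g g1 : rat_deriv f f1 -> rat_deriv g g1 ->
  rat_deriv (fun c => f c + g c) (fun c => f1 c + g1 c).
Proof.
move=> [Q1 [R1 [n1 e1]]] [Q2 [R2 [n2 e2]]].
exists (Q1 * Q2), (R1 * Q2 + R2 * Q1); split=> c Uc.
  by rewrite hornerM mulf_neq0 ?n1 ?n2.
have [h1 h1'] := e1 c Uc; have [h2 h2'] := e2 c Uc.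
rewrite ?derivM ?derivD ?derivM !(hornerM, hornerD) in h1' h2' *; split; first by rewrite -h1 -h2; ring.
transitivity ((f1 c * Q1.[c] + f c * (a.[c] * Q1^`().[c])) * Q2.[c]
  + (f c * Q1.[c]) * (a.[c] * Q2^`().[c])
  + ((g1 c * Q2.[c] + g c * (a.[c] * Q2^`().[c])) * Q1.[c]
  + (g c * Q2.[c]) * (a.[c] * Q1^`().[c]))); first by ring.
by rewrite h1' h2' h1 h2; ring.
Qed.

Lemma rat_derivM f f1 g g1 : rat_deriv f f1 -> rat_deriv g g1 ->
  rat_deriv (fun c => f c * g c) (fun c => f1 c * g c + f c * g1 c).
Proof.
move=> [Q1 [R1 [n1 e1]]] [Q2 [R2 [n2 e2]]].
exists (Q1 * Q2), (R1 * R2); split=> c Uc.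
  by rewrite hornerM mulf_neq0 ?n1 ?n2.
have [h1 h1'] := e1 c Uc; have [h2 h2'] := e2 c Uc.
rewrite ?derivM ?derivD ?derivM !(hornerM, hornerD) in h1' h2' *; split; first by rewrite -h1 -h2; ring.
transitivity ((f1 c * Q1.[c] + f c * (a.[c] * Q1^`().[c])) * (g c * Q2.[c])
  + (f c * Q1.[c]) * (g1 c * Q2.[c] + g c * (a.[c] * Q2^`().[c]))); first by ring.
by rewrite h1' h2' h1 h2; ring.
Qed.

Lemma rat_deriv_sum I (r : seq I) (f f1 : I -> K -> K) :
  (forall i, rat_deriv (f i) (f1 i)) ->
  rat_deriv (fun c => \sum_(i <- r) f i c) (fun c => \sum_(i <- r) f1 i c).
Proof.
move=> H; elim: r => [|i r IH].
  by have := rat_deriv_const 0; congr rat_deriv; apply: funext => c; rewrite big_nil.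
have := rat_derivD (H i) IH.
by congr rat_deriv; apply: funext => c; rewrite big_cons.
Qed.

Lemma rat_deriv_eq0 f f1 : rat_deriv f f1 -> (forall c, U c -> f c = 0) ->
  forall c, U c -> f1 c = 0.
Proof.
move=> [Q [R [nQ e]]] f0 c Uc.
have R0 : R = 0 by apply: denseU => b Ub; have [<- _] := e b Ub; rewrite f0 ?mul0r.
have [_] := e c Uc; rewrite R0 f0 // deriv0 mulr0 mul0r addr0 horner0 => /eqP.
by rewrite mulf_eq0 (negPf (nQ _ Uc)) orbF => /eqP.
Qed.

Lemma rat_deriv_uniq f f1 g g1 : rat_deriv f f1 -> rat_deriv g g1 ->
  (forall c, U c -> f c = g c) -> forall c, U c -> f1 c = g1 c.
Proof.
move=> df dg fg c Uc; apply/eqP; rewrite -subr_eq0; apply/eqP.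
have := rat_derivD df (rat_derivM (rat_deriv_const (- 1)) dg).
move=> /rat_deriv_eq0 /(_ _ c Uc); rewrite mul0r add0r mulN1r; apply=> b Ub.
by rewrite fg // mulN1r subrr.
Qed.

(** Each application of [a d/dX] lowers the order of vanishing at [c0] by exactly one. After [e]
    steps the value is [e! a(c0)^e S(c0)], which is nonzero in characteristic zero. *)
Lemma iter_deriv_neq0 e c0 (S : {poly K}) : a.[c0] != 0 -> S.[c0] != 0 ->
  (iter e (fun p => a * p^`()) (('X - c0%:P) ^+ e * S)).[c0] != 0.
Proof.
move=> a0; elim: e S => [|e IH] S S0; first by rewrite expr0 mul1r.
rewrite iterSr; set p := a * _.
have -> : p = ('X - c0%:P) ^+ e * (a * (e.+1%:R *: S + ('X - c0%:P) * S^`())).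
  by rewrite /p derivM deriv_exp derivXsubC exprS mul1r -mulr_natl scaler_nat -(mulr_natl S) /=; ring.
apply: IH; rewrite !hornerE subrr mul0r addr0.
by rewrite !mulf_neq0 ?natf_eq0.
Qed.

(** Write [f 0 = R / Q]. If [R] were nonzero and of order [d] at [c0], its [d]-th iterated
    derivative would not vanish there; but by the Leibniz rule that derivative is a combination of
    [f 0, ..., f d], which all vanish at [c0]. *)
Lemma rat_deriv_tower (f : nat -> K -> K) c0 : U c0 -> a.[c0] != 0 ->
  (forall k, rat_deriv (f k) (f k.+1)) -> (forall k, f k c0 = 0) ->
  forall c, U c -> f 0%N c = 0.
Proof.
move=> Uc0 a0 df f0; have [Q [R [nQ e]]] := df 0%N.
pose Rj j := iter j (fun p => a * p^`()) R.
have RjE j : exists q : nat -> {poly K}, forall c, U c ->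
    (Rj j).[c] = \sum_(i < j.+1) f i c * (q i).[c].
  elim: j => [|j [q Eq]].
    by exists (fun=> Q) => c Uc; rewrite big_ord1; have [-> _] := e c Uc.
  (* Leibniz rule: differentiating [f i] moves its coefficient to [f i.+1], while the derivatives of
     the coefficients stay at their index. *)
  exists (fun i => (if i == 0%N then 0 else q i.-1) + (if (i <= j)%N then a * (q i)^`() else 0)) => c Uc.
  have dS := rat_deriv_sum (index_enum 'I_j.+1)
    (fun i : 'I_j.+1 => rat_derivM (df i) (rat_deriv_poly (q i))).
  rewrite (rat_deriv_uniq (rat_deriv_poly (Rj j)) dS Eq Uc) big_split /=.
  transitivity (\sum_(i < j.+2) f i c * (if i == 0%N :> nat then 0 else q i.-1).[c]
    + \sum_(i < j.+2) f i c * (if (i <= j)%N then a * (q i)^`() else 0).[c]).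
    congr (_ + _).
      by rewrite [RHS]big_ord_recl /= horner0 mulr0 add0r.
    rewrite [RHS]big_ord_recr /= ltnn horner0 mulr0 addr0; apply: eq_bigr => i _.
    by rewrite -ltnS ltn_ord.
  by rewrite -big_split; apply: eq_bigr => i _; rewrite hornerD mulrDr.
have Rj0 j : (Rj j).[c0] = 0.
  by have [q ->] := RjE j; rewrite // big1 // => i _; rewrite f0 mul0r.
case: (eqVneq R 0) => [R0 c Uc|nR0].
  have [h _] := e c Uc; move/eqP: h.
  by rewrite R0 horner0 mulf_eq0 (negPf (nQ _ Uc)) orbF => /eqP.
have [d [S S0 ER]] := multiplicity_XsubC R c0.
have nS0 : S.[c0] != 0 by move: S0; rewrite nR0.
by have := iter_deriv_neq0 d a0 nS0; rewrite mulrC -ER -/(Rj d) Rj0 eqxx.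
Qed.

End RationalCurves.

(** * Tangent vectors and integral curves in a subgroup *)

Section CurvesInGroups.
Variables (C : closedFieldType) (charC : [pchar C] =i pred0) (n : nat).
Variables (a : {poly C}) (U : C -> Prop) (denseU : zariski_dense U).
Variables (g g1 : C -> 'M[C]_n) (H : 'M[C]_n -> Prop).
Hypothesis dg : forall i j, rat_deriv a U (fun c => g c i j) (fun c => g1 c i j).

Lemma rat_deriv_mx_eval p :
  rat_deriv a U (fun c => mx_eval idfun (g c) p)
                (fun c => dmx_eval idfun (g c) p (g1 c)).
Proof.
elim/mpoly_alg_ind: p => [c|i|p q IHp IHq|p q IHp IHq].
- have := rat_deriv_const a U c.
  by congr rat_deriv; apply: funext => b; rewrite ?mx_evalC ?dmx_evalC.
- case/mxvec_indexP: i => i j; have := dg i j.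
  by congr rat_deriv; apply: funext => b; rewrite ?mx_evalX ?dmx_evalX mxvecE.
- have := rat_derivD IHp IHq.
  by congr rat_deriv; apply: funext => b; rewrite ?mx_evalD ?dmx_evalD.
- have := rat_derivM IHp IHq.
  by congr rat_deriv; apply: funext => b; rewrite ?mx_evalM ?dmx_evalM.
Qed.

Lemma curve_tangent c0 : U c0 -> g c0 = 1%:M -> (forall c, U c -> H (g c)) ->
  lie idfun H (g1 c0).
Proof.
move=> Uc0 g0 Hg p vp; rewrite -/(dmx_eval _ _ _ _) -g0.
apply: (rat_deriv_eq0 denseU (rat_deriv_mx_eval p)) => // c Uc.
exact/vp/Hg.
Qed.

(** Since [g1 = g X] along the curve, applying [lie_deriv X] to [p] amounts to differentiating [p]
    along the curve. The ideal of [H] is stable under [lie_deriv X], so all these derivatives vanish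
    at [c0]. The factor [a] in the derivation is 1 for exponentials and ['X] for tori, where the
    equation is [z t'(z) = t(z) X]. *)
Lemma curve_in_subgroup c0 X : alg_subgroup H -> U c0 -> a.[c0] != 0 ->
  H (g c0) -> lie idfun H X -> (forall c, U c -> g c \in unitmx) ->
  (forall c, U c -> g1 c = g c *m X) -> forall c, U c -> H (g c).
Proof.
move=> [sH zH] Uc0 a0 Hg0 lX gU Eg1 c Uc; apply/zH; split; first exact: gU.
move=> p vp.
pose f k (b : C) := mx_eval idfun (g b) (iter k (lie_deriv X) p).
have vk k : vanishes_on H (iter k (lie_deriv X) p).
  elim: k => //= k IH A HA; rewrite mx_eval_lie_deriv.
  exact: (vanishes_dmx_eval sH lX IH).
apply: (rat_deriv_tower charC denseU (f := f) Uc0 a0 _ _ Uc) => [k|k]; last exact: vk.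
have [Q [R [nQ e]]] := rat_deriv_mx_eval (iter k (lie_deriv X) p).
exists Q, R; split=> // b Ub; have [e1 e2] := e b Ub; split=> //.
by rewrite -e2 /f /= mx_eval_lie_deriv Eg1.
Qed.

End CurvesInGroups.

(** * Nilpotent matrices and their exponentials *)

Lemma bracketDr (R : pzRingType) n (A B B' : 'M[R]_n) :
  bracket A (B + B') = bracket A B + bracket A B'.
Proof. by rewrite /bracket mulmxDr mulmxDl opprD addrACA. Qed.

Lemma bracketDl (R : pzRingType) n (A B B' : 'M[R]_n) :
  bracket (B + B') A = bracket B A + bracket B' A.
Proof. by rewrite /bracket mulmxDr mulmxDl opprD addrACA. Qed.

Lemma bracketNr (R : pzRingType) n (A B : 'M[R]_n) : bracket A (- B) = - bracket A B.
Proof. by rewrite /bracket mulmxN mulNmx opprD. Qed.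

Lemma bracketNl (R : pzRingType) n (A B : 'M[R]_n) : bracket (- A) B = - bracket A B.
Proof. by rewrite /bracket mulmxN mulNmx opprD. Qed.

Lemma bracketZr (R : comNzRingType) n (A B : 'M[R]_n) c :
  bracket A (c *: B) = c *: bracket A B.
Proof. by rewrite /bracket -scalemxAr -scalemxAl scalerBr. Qed.

Lemma bracketZl (R : comNzRingType) n (A B : 'M[R]_n) c :
  bracket (c *: A) B = c *: bracket A B.
Proof. by rewrite /bracket -scalemxAr -scalemxAl scalerBr. Qed.

Lemma bracket_anti (R : pzRingType) n (A B : 'M[R]_n) : bracket A B = - bracket B A.
Proof. by rewrite /bracket opprB. Qed.

Lemma bracketxx (R : pzRingType) n (A : 'M[R]_n) : bracket A A = 0.
Proof. exact: subrr. Qed.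

Lemma bracket_sumr (R : pzRingType) n (A : 'M[R]_n) I (r : seq I) (P : pred I) F :
  bracket A (\sum_(i <- r | P i) F i) = \sum_(i <- r | P i) bracket A (F i).
Proof.
elim/big_rec2: _ => [|i B1 B2 _ <-]; last by rewrite bracketDr.
by rewrite /bracket mulmx0 mul0mx subrr.
Qed.

Lemma bracketMr (R : pzRingType) n (A B D : 'M[R]_n) :
  bracket A (B *m D) = bracket A B *m D + B *m bracket A D.
Proof. by rewrite /bracket mulmxBr mulmxBl !mulmxA addrA subrK. Qed.

Lemma bracket_jacobi (R : comNzRingType) n (A B D : 'M[R]_n) :
  bracket A (bracket B D) = bracket (bracket A B) D + bracket B (bracket A D).
Proof.
rewrite /bracket !(mulmxBr, mulmxBl) !mulmxA.
move: (A *m B *m D) (A *m D *m B) (B *m A *m D) (B *m D *m A) (D *m A *m B) (D *m B *m A).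
by move=> *; apply/matrixP => i j; rewrite !mxE; ring.
Qed.

Lemma bracket_conj (K : fieldType) n (g A B : 'M[K]_n) : g \in unitmx ->
  bracket (g *m A *m invmx g) (g *m B *m invmx g) = g *m bracket A B *m invmx g.
Proof.
by move=> gU; rewrite /bracket mulmxBr mulmxBl !mulmxA !mulmxKV.
Qed.

Section Nilpotent.
Variables (K : fieldType) (charK : [pchar K] =i pred0).

(** On polynomials in [X], the bracket with [A] acts as [c X d/dX]. Hence the minimal polynomial
    [p], of degree [d], divides [X p']; comparing degrees gives [X p' = d p], and in characteristic
    zero [p = X^d] with [d <= n]. *)
Lemma bracket_eigen_nilpotent n (A X : 'M[K]_n) c :
  c != 0 -> bracket A X = c *: X -> X ^+ n = 0.
Proof.
case: n A X => [|n] A X c0 AX; first by apply/matrixP => -[].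
have brp q : bracket A (horner_mx X q) = c *: (X *m horner_mx X q^`()).
  elim/poly_ind: q => [|q b IH].
    by rewrite deriv0 !rmorph0 mulmx0 scaler0 /bracket mulmx0 mul0mx subrr.
  have comX r : horner_mx X r *m X = X *m horner_mx X r.
    by apply: comm_horner_mx; apply: comm_mx_refl.
  have hM r s : horner_mx X (r * s) = horner_mx X r *m horner_mx X s by rewrite rmorphM.
  rewrite derivMXaddC !rmorphD /= !hM horner_mx_X horner_mx_C bracketDr bracketMr.
  have -> : bracket A b%:M = 0 by rewrite /bracket scalar_mxC subrr.
  rewrite addr0 IH AX -scalemxAl -scalemxAr -scalerDr -mulmxA !comX -mulmxDr.
  by rewrite addrC.
set p := mxminpoly X; pose d := (size p).-1.
have p_gt0 : (0 < size p)%N by rewrite size_poly_gt0 monic_neq0 ?mxminpoly_monic.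
have pXp : p %| 'X * p^`().
  apply: mxminpoly_min; apply/eqP; have := brp p; rewrite mx_root_minpoly.
  rewrite /bracket mulmx0 mul0mx subrr => /esym/eqP; rewrite scaler_eq0 (negPf c0) /=.
  by rewrite rmorphM /= horner_mx_X.
have pE : 'X * p^`() - d%:R *: p = 0.
  apply: contraTeq (p_gt0) => nz.
  have /(dvdp_leq nz) : p %| 'X * p^`() - d%:R *: p by rewrite dvdp_sub // -mul_polyC dvdp_mull.
  suff : (size ('X * p^`() - d%:R *: p)%R <= d)%N.
    by move=> h1 h2; have := leq_trans h2 h1; rewrite /d leqNgt ltn_predL p_gt0.
  apply/leq_sizeP => i di; rewrite coefB coefZ mulrC coefMX coef_deriv.
  case: i di => [|i] di /=.
    by move: di; rewrite leqn0 => /eqP ->; rewrite mul0r subr0.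
  case: (ltngtP d i.+1) di => // [lt|->] _; last by rewrite mulr_natl subrr.
  by rewrite nth_default ?mul0rn ?mulr0 ?subr0 // -(prednK p_gt0).
have pXd : p = 'X^d.
  apply/polyP => i; rewrite coefXn; case: (eqVneq i d) => [->|nid].
    by have /monicP := mxminpoly_monic X; rewrite lead_coefE -/p -/d => ->.
  have /(congr1 (fun q : {poly K} => q`_i)) := pE.
  rewrite coef0 coefB coefZ mulrC coefMX coef_deriv => /eqP.
  suff -> : (if i == 0%N then 0 else p`_i.-1.+1 *+ i.-1.+1) = i%:R * p`_i.
    rewrite -mulrBl mulf_eq0 subr_eq0 => /orP[|/eqP //].
    by move/eqP/(natf_inj charK) => e; case/eqP: nid.
  by case: i {nid} => [|i] /=; rewrite ?mul0r // mulr_natl.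
have Xd : X ^+ d = 0.
  by have := mx_root_minpoly X; rewrite -/p pXd rmorphXn /= horner_mx_X.
have dn : (d <= n.+1)%N.
  have := dvdp_leq (monic_neq0 (char_poly_monic X)) (mxminpoly_dvd_char X).
  by rewrite size_char_poly -/p -[size p]prednK.
by have := exprD X (n.+1 - d) d; rewrite subnK // Xd mulr0.
Qed.

End Nilpotent.

Lemma expmxZ (R : comPzRingType) n (N : 'M[R]_n) a k : (a *: N) ^+ k = a ^+ k *: N ^+ k.
Proof.
elim: k => [|k IH]; first by rewrite scale1r.
by rewrite !exprS IH -[LHS]scalemxAl -[X in _ *: X]scalemxAr scalerA.
Qed.

Section MatrixExponential.
Variables (K : fieldType) (charK : [pchar K] =i pred0) (n : nat).
Implicit Types N Z : 'M[K]_n.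

Definition exp_term N k : 'M[K]_n := (k`!%:R)^-1 *: N ^+ k.

(** The term [(ad N)^k (Z) / k!] of the series [exp(ad N)(Z)]. *)
Fixpoint ad_term N Z k : 'M[K]_n :=
  if k is k'.+1 then k%:R^-1 *: bracket N (ad_term N Z k') else Z.

Lemma exp_termS N k : N *m exp_term N k = k.+1%:R *: exp_term N k.+1.
Proof.
rewrite /exp_term -scalemxAr scalerA factS natrM invfM mulrA divff ?natf_eq0 //.
by rewrite mul1r exprS.
Qed.

Lemma ad_termS N Z k : bracket N (ad_term N Z k) = k.+1%:R *: ad_term N Z k.+1.
Proof. by rewrite /= scalerA divff ?natf_eq0 // scale1r. Qed.

(** The part of degree [a] in [N] of [exp(N) Z = exp(ad N)(Z) exp(N)]; no nilpotency is involved.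
    The induction uses [N W = [N, W] + W N] and splits the factor [a + 1] as [k + (a + 1 - k)]. *)
Lemma exp_term_mul N Z a :
  exp_term N a *m Z = \sum_(k < a.+1) ad_term N Z k *m exp_term N (a - k).
Proof.
elim: a => [|a IH].
  by rewrite big_ord1 /exp_term /= expr0 fact0 invr1 scale1r mul1mx mulmx1.
have a0 : a.+1%:R != 0 :> K by rewrite natf_eq0.
apply: (scalerI a0); rewrite scalemxAl -exp_termS -mulmxA IH mulmx_sumr.
transitivity (\sum_(k < a.+1) (k.+1%:R *: (ad_term N Z k.+1 *m exp_term N (a - k))
     + (a - k).+1%:R *: (ad_term N Z k *m exp_term N (a - k).+1))).
  apply: eq_bigr => k _; rewrite scalemxAl -ad_termS scalemxAr -exp_termS.
  by rewrite /bracket mulmxBl !mulmxA subrK.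
rewrite big_split /= scaler_sumr.
rewrite (eq_bigr (fun i : 'I_a.+2 => i%:R *: (ad_term N Z i *m exp_term N (a.+1 - i))
  + (a.+1 - i)%:R *: (ad_term N Z i *m exp_term N (a.+1 - i)))); last first.
  by move=> i _; rewrite -scalerDl -natrD subnKC // -ltnS.
rewrite big_split /=; congr (_ + _).
  by rewrite [RHS]big_ord_recl scale0r add0r; apply: eq_bigr => i _; rewrite subSS.
rewrite [RHS]big_ord_recr /= subnn scale0r addr0; apply: eq_bigr => i _.
by rewrite subSn // -ltnS.
Qed.

Lemma exp_term_eq0 N k : N ^+ n = 0 -> (n <= k)%N -> exp_term N k = 0.
Proof.
by move=> N0 nk; rewrite /exp_term -(subnK nk) exprD N0 mulr0 scaler0.
Qed.

Lemma mxexpE N : mxexp N = \sum_(k < n) exp_term N k.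
Proof. by []. Qed.

Lemma mxexp_trunc N M : N ^+ n = 0 -> (n <= M)%N -> mxexp N = \sum_(k < M) exp_term N k.
Proof.
move=> N0 nM; rewrite mxexpE (big_ord_widen M (fun k => exp_term N k) nM) big_mkcond /=.
apply: eq_bigr => k _; case: ltnP => // nk; by rewrite exp_term_eq0.
Qed.

(* exp(N) Z exp(-N) = exp(ad N) Z, with exp(-N) moved to the other side. *)
Lemma mxexp_mul N Z d : N ^+ n = 0 -> ad_term N Z d = 0 ->
  mxexp N *m Z = (\sum_(k < d) ad_term N Z k) *m mxexp N.
Proof.
move=> N0 Z0.
have Zk k : (d <= k)%N -> ad_term N Z k = 0.
  move=> /subnK <-; elim: (k - d)%N => //= e ->.
  by rewrite /bracket mulmx0 mul0mx subrr scaler0.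
(* With [d + n] terms, every index [k < d] still leaves at least [n] terms for the inner
   exponential, so none of its nonzero terms is cut off. *)
rewrite (mxexp_trunc N0 (leq_addl d n)) mulmx_suml.
under eq_bigr do rewrite exp_term_mul.
transitivity (\sum_(a < d + n) \sum_(k < d + n | (k <= a)%N) ad_term N Z k *m exp_term N (a - k)).
  apply: eq_bigr => a _.
  rewrite (big_ord_widen (d + n) (fun k => ad_term N Z k *m exp_term N (a - k))) //.
rewrite (exchange_big_dep predT) //= mulmx_suml.
rewrite (big_ord_widen (d + n) (fun k => ad_term N Z k *m _)) ?leq_addr //.
rewrite [RHS]big_mkcond /=; apply: eq_bigr => k _; case: ltnP => [kd|/Zk ->]; last first.
  by rewrite big1 // => a _; rewrite mul0mx.
rewrite -mulmx_sumr; congr (_ *m _).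
rewrite -(big_mkord (fun a => (k <= a)%N) (fun a => exp_term N (a - k))).
rewrite (big_cat_nat (n := k)) ?(ltnW (ltn_ord k)) //=.
rewrite big_nat_cond big1 ?add0r; last by move=> i /andP[/andP[_ ik]]; rewrite leqNgt ik.
rewrite -{1}[nat_of_ord k]add0n big_addn.
rewrite (eq_bigl xpredT) => [|i]; last by rewrite leq_addl.
rewrite (eq_bigr (exp_term N)) => [|i _]; last by rewrite addnK.
rewrite big_mkord -(mxexp_trunc N0 (leq_addl d n)); apply/esym/(mxexp_trunc N0).
by rewrite -addnBAC ?leq_addl // ltnW.
Qed.

Lemma mxexp0 : mxexp (0 : 'M[K]_n) = 1%:M.
Proof.
case: n => [|n']; first by apply/matrixP => -[].
rewrite /mxexp big_ord_recl big1 => [|k _]; last by rewrite expr0n scaler0.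
by rewrite expr0 fact0 invr1 scale1r addr0.
Qed.

(** The exponential is [1 - W], where [W] is [N] times a matrix commuting with [N], hence nilpotent;
    the geometric series inverts it. *)
Lemma mxexp_unit N : N ^+ n = 0 -> mxexp N \in unitmx.
Proof.
move=> N0; pose W := - (N *m \sum_(k < n) ((k.+1)`!%:R)^-1 *: N ^+ k).
have expW : mxexp N = 1%:M - W.
  rewrite (mxexp_trunc N0 (leqnSn n)) big_ord_recl /exp_term expr0 fact0 invr1 scale1r.
  rewrite /W opprK mulmx_sumr; congr (_ + _); apply: eq_bigr => k _.
  by rewrite -scalemxAr exprS.
have W0 : W ^+ n = 0.
  have cNW : GRing.comm N (\sum_(k < n) ((k.+1)`!%:R)^-1 *: N ^+ k).
    apply: commr_sum => k _; rewrite /GRing.comm -[LHS]scalemxAr -[RHS]scalemxAl.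
    by congr (_ *: _); apply: commrX.
  by rewrite /W exprNn -[_ *m _]/(_ * _) exprMn_comm // N0 mul0r mulr0.
have := subrX1 W n; rewrite W0 sub0r => e.
have: (1%:M - W) *m (\sum_(i < n) W ^+ i) = 1%:M.
  by apply: oppr_inj; rewrite -mulNmx opprB.
by rewrite -expW => /mulmx1_unit [].
Qed.

End MatrixExponential.

(** * Points over an extension field *)

Section ZariskiDensity.
Variables (C : closedFieldType) (charC : [pchar C] =i pred0).
Variables (E : fieldType) (iota : {rmorphism C -> E}) (n : nat).

Lemma poly_iota_eq0 (p : {poly E}) :
  (forall c, c != 0 -> p.[iota c] = 0) -> p = 0.
Proof.
move=> p0; have charE : [pchar E] =i pred0 by move=> i; rewrite (fmorph_pchar iota).
have: p * 'X = 0.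
  apply: (poly_nat_eq0 charE) => -[|k]; rewrite hornerM hornerX ?mulr0 //.
  have := p0 k.+1%:R; rewrite rmorph_nat => -> //; first by rewrite mul0r.
  by rewrite natf_eq0.
by move/eqP; rewrite mulf_eq0 polyX_eq0 orbF => /eqP.
Qed.

(** Polynomial functions with coefficients in [E], given by closure rules: only induction and
    composition are needed, never the coefficients themselves. *)
Inductive polyfun : ('M[E]_n -> E) -> Prop :=
| polyfun_const c : polyfun (fun=> c)
| polyfun_entry i j : polyfun (fun A => A i j)
| polyfun_add f g : polyfun f -> polyfun g -> polyfun (fun A => f A + g A)
| polyfun_mul f g : polyfun f -> polyfun g -> polyfun (fun A => f A * g A).

Lemma polyfun_sum I (r : seq I) (f : I -> 'M[E]_n -> E) :
  (forall i, polyfun (f i)) -> polyfun (fun A => \sum_(i <- r) f i A).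
Proof.
move=> Hf; elim: r => [|i r IH].
  rewrite (_ : (fun _ => _) = fun=> 0); first exact: polyfun_const.
  by apply: funext => A; rewrite big_nil.
rewrite (_ : (fun _ => _) = fun A => f i A + \sum_(j <- r) f j A).
  exact: polyfun_add.
by apply: funext => A; rewrite big_cons.
Qed.

Lemma polyfun_prod I (r : seq I) (f : I -> 'M[E]_n -> E) :
  (forall i, polyfun (f i)) -> polyfun (fun A => \prod_(i <- r) f i A).
Proof.
move=> Hf; elim: r => [|i r IH].
  rewrite (_ : (fun _ => _) = fun=> 1); first exact: polyfun_const.
  by apply: funext => A; rewrite big_nil.
rewrite (_ : (fun _ => _) = fun A => f i A * \prod_(j <- r) f j A).
  exact: polyfun_mul.
by apply: funext => A; rewrite big_cons.
Qed.

Lemma polyfun_comp f (phi : 'M[E]_n -> 'M[E]_n) : polyfun f ->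
  (forall i j, polyfun (fun A => phi A i j)) -> polyfun (fun A => f (phi A)).
Proof.
move=> Hf Hphi; elim: Hf => //.
- by move=> c; apply: polyfun_const.
- by move=> f1 f2 _ H1 _ H2; apply: polyfun_add.
- by move=> f1 f2 _ H1 _ H2; apply: polyfun_mul.
Qed.

Definition polymx r s (phi : 'M[E]_n -> 'M[E]_(r, s)) : Prop :=
  forall i j, polyfun (fun A => phi A i j).

Lemma polymx_id : polymx id.
Proof. by move=> i j; apply: polyfun_entry. Qed.

Lemma polymx_const r s B : polymx (fun=> B : 'M[E]_(r, s)).
Proof. by move=> i j; apply: polyfun_const. Qed.

Lemma polymxD r s (phi psi : 'M[E]_n -> 'M[E]_(r, s)) :
  polymx phi -> polymx psi -> polymx (fun A => phi A + psi A).
Proof.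
move=> H1 H2 i j; rewrite (_ : (fun _ => _) = fun A => phi A i j + psi A i j).
  exact: polyfun_add.
by apply: funext => A; rewrite mxE.
Qed.

Lemma polymxM r s t (phi : 'M[E]_n -> 'M[E]_(r, s)) (psi : 'M[E]_n -> 'M[E]_(s, t)) :
  polymx phi -> polymx psi -> polymx (fun A => phi A *m psi A).
Proof.
move=> H1 H2 i j.
rewrite (_ : (fun _ => _) = fun A => \sum_k phi A i k * psi A k j).
  by apply: polyfun_sum => k; apply: polyfun_mul.
by apply: funext => A; rewrite mxE.
Qed.

Lemma polyfun_det r (phi : 'M[E]_n -> 'M[E]_r) : polymx phi -> polyfun (fun A => \det (phi A)).
Proof.
move=> H; rewrite /determinant; apply: polyfun_sum => s.
by apply: polyfun_mul; [apply: polyfun_const|apply: polyfun_prod].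
Qed.

Lemma polymx_adj : polymx (fun A => \adj A).
Proof.
move=> i j; rewrite (_ : (fun _ => _) = fun A : 'M_n => (-1) ^+ (j + i) * \det (row' j (col' i A))).
  apply: polyfun_mul; first exact: polyfun_const.
  apply: polyfun_det => a b; rewrite (_ : (fun _ => _) = fun A : 'M_n => A (lift j a) (lift i b)).
    exact: polyfun_entry.
  by apply: funext => A; rewrite !mxE.
by apply: funext => A; rewrite mxE.
Qed.

(* b is an E-point of the Zariski closure, over E, of H. *)
Definition dense_point (H : 'M[C]_n -> Prop) (b : 'M[E]_n) : Prop :=
  forall f, polyfun f -> (forall A, H A -> f (map_mx iota A) = 0) -> f b = 0.

Lemma dense_point_mx H b r s (phi : 'M[E]_n -> 'M[E]_(r, s)) : dense_point H b ->
  polymx phi -> (forall A, H A -> phi (map_mx iota A) = 0) -> phi b = 0.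
Proof.
move=> Hb Hphi phi0; apply/matrixP => i j; rewrite [RHS]mxE.
by apply: (Hb _ (Hphi i j)) => A /phi0 ->; rewrite mxE.
Qed.

Lemma dense_point_iota (H : 'M[C]_n -> Prop) A : H A -> dense_point H (map_mx iota A).
Proof. by move=> HA f _; apply. Qed.

(** Density is used one factor at a time: first [b2] is frozen, then a constant left factor. The
    function [A |-> f (A *m b2)] has coefficients in [E] even if those of [f] are constants. *)
Lemma dense_point_mul (H : 'M[C]_n -> Prop) b1 b2 :
  (forall A B, H A -> H B -> H (A *m B)) ->
  dense_point H b1 -> dense_point H b2 -> dense_point H (b1 *m b2).
Proof.
move=> HM H1 H2 f Hf f0.
apply: (H1 (fun A => f (A *m b2))) => [|A HA].
  by apply: polyfun_comp => //; apply: polymxM; [apply: polymx_id|apply: polymx_const].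
apply: (H2 (fun B => f (map_mx iota A *m B))) => [|B HB].
  by apply: polyfun_comp => //; apply: polymxM; [apply: polymx_const|apply: polymx_id].
by rewrite -map_mxM; apply/f0/HM.
Qed.

Lemma polyfun_mx_eval (p : {mpoly C[n * n]}) : polyfun (fun A : 'M_n => mx_eval iota A p).
Proof.
elim/mpoly_alg_ind: p => [c|i|p q IHp IHq|p q IHp IHq].
- rewrite (_ : (fun _ => _) = fun=> iota c); first exact: polyfun_const.
  by apply: funext => A; rewrite mx_evalC.
- case/mxvec_indexP: i => i j.
  rewrite (_ : (fun _ => _) = fun A : 'M_n => A i j); first exact: polyfun_entry.
  by apply: funext => A; rewrite mx_evalX mxvecE.
- rewrite (_ : (fun _ => _) = fun A : 'M_n => mx_eval iota A p + mx_eval iota A q).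
    exact: polyfun_add.
  by apply: funext => A; rewrite mx_evalD.
- rewrite (_ : (fun _ => _) = fun A : 'M_n => mx_eval iota A p * mx_eval iota A q).
    exact: polyfun_mul.
  by apply: funext => A; rewrite mx_evalM.
Qed.

Lemma mx_eval_iota (A : 'M[C]_n) p : mx_eval iota (map_mx iota A) p = iota (mx_eval idfun A p).
Proof.
elim/mpoly_alg_ind: p => [c|i|p q IHp IHq|p q IHp IHq].
- by rewrite !mx_evalC.
- by rewrite !mx_evalX -map_mxvec mxE.
- by rewrite !mx_evalD IHp IHq rmorphD.
- by rewrite !mx_evalM IHp IHq rmorphM.
Qed.

Lemma dense_point_closed (H : 'M[C]_n -> Prop) A : zariski_closed H -> A \in unitmx ->
  dense_point H (map_mx iota A) -> H A.
Proof.
move=> zH AU HA; apply/zH; split=> // p vp; apply: (fmorph_inj iota).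
rewrite rmorph0 -mx_eval_iota; apply: (HA _ (polyfun_mx_eval p)) => B HB.
by rewrite mx_eval_iota vp ?rmorph0.
Qed.

Lemma laurent_eval_iota (P : laurent_mx C n) c :
  laurent_eval iota P (iota c) = map_mx iota (laurent_eval idfun P c).
Proof.
apply/matrixP => i j; rewrite !mxE rmorphM fmorphV rmorphXn; congr (_ * _).
by rewrite horner_map map_poly_id.
Qed.

Lemma polyfun_laurent (P : laurent_mx C n) f : polyfun f ->
  exists d (R : {poly E}), forall z, z != 0 -> f (laurent_eval iota P z) * z ^+ d = R.[z].
Proof.
elim=> [c|i j|f1 f2 _ [d1 [R1 e1]] _ [d2 [R2 e2]]|f1 f2 _ [d1 [R1 e1]] _ [d2 [R2 e2]]].
- by exists 0%N, c%:P => z _; rewrite hornerC mulr1.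
- exists P.2, (map_poly iota (P.1 i j)) => z z0.
  by rewrite !mxE mulrC mulrA divff ?mul1r // expf_neq0.
- exists (d1 + d2)%N, (R1 * 'X^d2 + R2 * 'X^d1) => z z0.
  by rewrite hornerD !hornerM !hornerXn -e1 // -e2 // exprD; ring.
- exists (d1 + d2)%N, (R1 * R2) => z z0.
  by rewrite hornerM -e1 // -e2 // exprD; ring.
Qed.

Lemma dense_point_laurent (H : 'M[C]_n -> Prop) (P : laurent_mx C n) z : z != 0 ->
  (forall c, c != 0 -> H (laurent_eval idfun P c)) -> dense_point H (laurent_eval iota P z).
Proof.
move=> z0 HP f Hf f0; have [d [R e]] := polyfun_laurent P Hf.
have R0 : R = 0.
  apply: poly_iota_eq0 => c c0; rewrite -e ?fmorph_eq0 // laurent_eval_iota.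
  by rewrite f0 ?mul0r //; apply: HP.
by have /eqP := e z z0; rewrite R0 horner0 mulf_eq0 expf_eq0 (negPf z0) andbF orbF => /eqP.
Qed.

End ZariskiDensity.

(** * One-parameter subgroups *)

Section ExponentialCurves.
Variables (C : closedFieldType) (charC : [pchar C] =i pred0) (n : nat).

(** The curve [z |-> exp(z X)] in Laurent form with denominator exponent 0, so that root subgroups
    and tori share the results on Laurent curves. *)
Definition exp_laurent (X : 'M[C]_n) : laurent_mx C n :=
  (\matrix_(i, j) \sum_(k < n) exp_term X k i j *: 'X^k, 0%N).

Lemma map_exp_term (K : fieldType) (iota : {rmorphism C -> K}) (X : 'M[C]_n) k :
  map_mx iota (exp_term X k) = exp_term (map_mx iota X) k.
Proof.
by rewrite /exp_term map_mxZ fmorphV rmorph_nat rmorphXn.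
Qed.

Lemma exp_laurentE (K : fieldType) (iota : {rmorphism C -> K}) X z :
  laurent_eval iota (exp_laurent X) z = mxexp (z *: map_mx iota X).
Proof.
apply/matrixP => i j; rewrite !mxE expr0 invr1 mul1r rmorph_sum /= horner_sum.
rewrite mxexpE summxE; apply: eq_bigr => k _; rewrite map_polyZ map_polyXn !hornerE /=.
rewrite mulrC; transitivity ((z ^+ k *: map_mx iota (exp_term X k)) i j); first by rewrite !mxE.
by rewrite map_exp_term /exp_term expmxZ !scalerA mulrC.
Qed.

Lemma exp_laurent_deriv (X : 'M[C]_n) i j : X ^+ n = 0 ->
  ((exp_laurent X).1 i j)^`() = \sum_b X b j *: (exp_laurent X).1 i b.
Proof.
move=> X0.
(* The added term of index [n] is zero; with it, the derivative of the sum has exactly the [n] terms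
   of the right-hand side. *)
have PE b : (exp_laurent X).1 i b = \sum_(k < n.+1) exp_term X k i b *: 'X^k.
  rewrite mxE big_ord_recr /= (_ : exp_term X n = 0) ?mxE ?scale0r ?addr0 //.
  by rewrite (exp_term_eq0 X0).
rewrite PE linear_sum big_ord_recl /= derivZ derivXn mulr0n scaler0 add0r.
rewrite (eq_bigr (fun k : 'I_n => (\sum_b exp_term X k i b * X b j) *: 'X^k)) => [|k _].
  rewrite (eq_bigr (fun k : 'I_n => \sum_b (exp_term X k i b * X b j) *: 'X^k)) => [|k _].
    rewrite exchange_big; apply: eq_bigr => b _; rewrite mxE scaler_sumr.
    by apply: eq_bigr => k _; rewrite scalerA mulrC.
  by rewrite scaler_suml.
rewrite derivZ derivXn -scaler_nat scalerA /=; congr (_ *: _).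
transitivity ((exp_term X k *m X) i j); last by rewrite mxE.
suff -> : exp_term X k *m X = k.+1%:R *: exp_term X k.+1 by rewrite [RHS]mxE mulrC.
rewrite -exp_termS // /exp_term -[LHS]scalemxAl -[RHS]scalemxAr; congr (_ *: _).
by rewrite -[LHS]/(X ^+ k * X) -exprSr exprS.
Qed.

Lemma exp_in_group (H : 'M[C]_n -> Prop) (X : 'M[C]_n) c : alg_subgroup H -> lie idfun H X ->
  X ^+ n = 0 -> H (mxexp (c *: X)).
Proof.
move=> aH lX X0.
have E1 b : mxexp (b *: X) = \matrix_(i, j) ((exp_laurent X).1 i j).[b].
  have := exp_laurentE (idfun : {rmorphism C -> C}) X b.
  rewrite map_mx_id // => <-; rewrite /laurent_eval expr0 invr1 scale1r.
  by apply/matrixP => i j; rewrite !mxE map_poly_id.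
have dense : zariski_dense (fun _ : C => True).
  by move=> p p0; apply: (poly_nat_eq0 charC) => k; apply: p0.
apply: (@curve_in_subgroup C charC n 1 _ dense (fun b => mxexp (b *: X))
  (fun b => mxexp (b *: X) *m X) H _ 0 X aH) => //.
- move=> i j; have := rat_deriv_poly 1 (fun _ => True) ((exp_laurent X).1 i j).
  congr rat_deriv; apply: funext => b; first by rewrite E1 [RHS]mxE.
  rewrite mul1r exp_laurent_deriv // horner_sum [RHS]mxE; apply: eq_bigr => k _.
  by rewrite hornerZ E1 [in RHS]mxE mulrC.
- by rewrite hornerE oner_neq0.
- by rewrite scale0r mxexp0; have [[]] := aH.
- by move=> b _; apply: mxexp_unit; rewrite // expmxZ X0 scaler0.
Qed.

End ExponentialCurves.

Section LaurentCurves.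
Variables (C : closedFieldType) (charC : [pchar C] =i pred0) (n : nat).

(* The curve t(z) = P(z) / z^k satisfies z t'(z) = t(z) X. *)
Definition laurent_ode (P : laurent_mx C n) (X : 'M[C]_n) : Prop :=
  forall i j, 'X * (P.1 i j)^`() - P.2%:R *: P.1 i j = \sum_b X b j *: P.1 i b.

Lemma zariski_dense_nz : zariski_dense (fun c : C => c != 0).
Proof.
have X0 : 'X != 0 :> {poly C} by rewrite polyX_eq0.
by move=> p p0; apply: (zariski_dense_neq0 charC X0) => c; rewrite hornerX; apply: p0.
Qed.

Lemma rat_deriv_laurent (P : laurent_mx C n) i j :
  rat_deriv 'X (fun c => c != 0) (fun c => laurent_eval idfun P c i j)
    (fun c => c ^- P.2 * ('X * (P.1 i j)^`() - P.2%:R *: P.1 i j).[c]).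
Proof.
exists 'X^(P.2), (P.1 i j); split=> [c c0|c c0]; first by rewrite hornerXn expf_neq0.
rewrite !mxE map_poly_id // hornerXn mulrAC mulVf ?expf_neq0 // mul1r; split=> //.
have -> : ('X * ('X^(P.2))^`()).[c] = P.2%:R * c ^+ P.2.
  rewrite derivXn hornerM hornerX hornerMn hornerXn; case: P.2 => [|k] /=.
    by rewrite mulr0n mul0r mulr0.
  by rewrite exprS -[c ^+ k *+ _]mulr_natl; ring.
by rewrite hornerD hornerN hornerZ; field; rewrite expf_neq0.
Qed.

Lemma laurent_in_group (H : 'M[C]_n -> Prop) (P : laurent_mx C n) X : alg_subgroup H ->
  lie idfun H X -> laurent_ode P X -> H (laurent_eval idfun P 1) ->
  (forall c, c != 0 -> laurent_eval idfun P c \in unitmx) ->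
  forall c, c != 0 -> H (laurent_eval idfun P c).
Proof.
move=> aH lX ode H1 PU c c0.
apply: (@curve_in_subgroup C charC n 'X _ zariski_dense_nz (laurent_eval idfun P)
  (fun c => laurent_eval idfun P c *m X) H _ 1 X aH) => //.
- move=> i j; have := rat_deriv_laurent P i j.
  congr rat_deriv; apply: funext => b; rewrite ode horner_sum mxE mulr_sumr.
  by apply: eq_bigr => k _; rewrite hornerZ !mxE map_poly_id //; ring.
- exact: oner_neq0.
- by rewrite hornerX oner_neq0.
Qed.

Variables (T1 : 'M[C]_n -> Prop) (P : laurent_mx C n).
Hypothesis aT1 : alg_subgroup T1.
Hypothesis isoP : alg_isom (@diag_group C 1) T1 (fun A => laurent_eval idfun P (A 0 0)).
Let t := laurent_eval idfun P.

Lemma diag_group1 c : c != 0 -> diag_group (c%:M : 'M[C]_1).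
Proof.
by move=> c0; split; rewrite ?scalar_mx_is_diag // unitmxE det_scalar unitfE expf_neq0.
Qed.

Lemma torus1_mem c : c != 0 -> T1 (t c).
Proof.
move=> c0; have [[H1 _ _] _] := isoP.
by have := H1 _ (diag_group1 c0); rewrite mxE mulr1n.
Qed.

Lemma torus1_mul c d : c != 0 -> d != 0 -> t (c * d) = t c *m t d.
Proof.
move=> c0 d0; have [[_ HM _] _] := isoP.
have := HM _ _ (diag_group1 c0) (diag_group1 d0).
by rewrite -scalar_mxM !mxE !mulr1n.
Qed.

Lemma torus1_unit c : c != 0 -> t c \in unitmx.
Proof. by move=> c0; have [[HU _ _ _] _] := aT1; apply/HU/torus1_mem. Qed.

Lemma torus1_1 : t 1 = 1%:M.
Proof.
have := torus1_mul (oner_neq0 C) (oner_neq0 C); rewrite mulr1 => /(congr1 (mulmx (invmx (t 1)))).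
by rewrite mulmxA mulVmx ?torus1_unit ?oner_neq0 // mul1mx.
Qed.

Lemma torus1_inj c d : c != 0 -> d != 0 -> t c = t d -> c = d.
Proof.
move=> c0 d0 e; have [_ [g [_ gK _]]] := isoP.
have := gK _ (diag_group1 c0); have := gK _ (diag_group1 d0).
rewrite !mxE !mulr1n -/t -e => -> /matrixP /(_ 0 0).
by rewrite !mxE !mulr1n.
Qed.

(** [X] is the tangent vector at 1; differentiating [t(c d) = t(c) t(d)] with respect to [d] at 1
    gives the differential equation. *)
Lemma torus1_gen : exists X, [/\ laurent_ode P X, lie idfun T1 X & X != 0].
Proof.
pose X := \matrix_(i, j) ('X * (P.1 i j)^`() - P.2%:R *: P.1 i j).[1].
have P1 i j : (P.1 i j).[1] = (i == j)%:R.
  have /matrixP /(_ i j) := torus1_1.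
  by rewrite !mxE expr1n invr1 mul1r map_poly_id.
have odeP : laurent_ode P X.
  move=> i j; apply/eqP; rewrite -subr_eq0; apply/eqP.
  apply: zariski_dense_nz => c c0; rewrite hornerD hornerN; apply/eqP; rewrite subr_eq0; apply/eqP.
  have Pmul : P.1 i j \Po (c *: 'X) = \sum_b (P.1 i b).[c] *: P.1 b j.
    apply/eqP; rewrite -subr_eq0; apply/eqP; apply: zariski_dense_nz => d d0.
    apply/eqP; rewrite hornerD hornerN subr_eq0; apply/eqP.
    have /matrixP /(_ i j) := torus1_mul c0 d0.
    rewrite !mxE map_poly_id // horner_comp hornerZ hornerX horner_sum.
    move/(congr1 (fun u => (c * d) ^+ P.2 * u)); rewrite mulrA divff ?expf_neq0 ?mulf_neq0 //.
    rewrite mul1r => ->; rewrite mulr_sumr; apply: eq_bigr => b _.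
    rewrite !mxE !map_poly_id // hornerZ exprMn.
    by field; rewrite !expf_neq0.
  have e : (P.1 i j)^`().[c] * c = \sum_b (P.1 i b).[c] * (P.1 b j)^`().[1].
    have := congr1 (fun q => q^`().[1]) Pmul.
    rewrite /= deriv_comp derivZ derivX hornerM horner_comp !hornerE => h.
    rewrite -[LHS]mulr1 [LHS]h.
    by rewrite linear_sum horner_sum; apply: eq_bigr => b _; rewrite /= derivZ hornerZ.
  rewrite hornerD hornerN hornerM hornerX hornerZ mulrC e horner_sum.
  have -> : P.2%:R * (P.1 i j).[c] = \sum_b (P.1 i b).[c] * (P.2%:R * (P.1 b j).[1]).
    rewrite (bigD1 j) //= big1 => [|b /negPf nb]; last by rewrite P1 nb !mulr0.
    by rewrite P1 eqxx addr0 mulr1 mulrC.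
  rewrite -sumrB; apply: eq_bigr => b _; rewrite hornerZ mxE.
  by rewrite hornerD hornerN hornerM hornerX hornerZ; ring.
exists X; split=> //.
  have lX := @curve_tangent C n 'X _ zariski_dense_nz t
    (fun c => \matrix_(i, j) (c ^- P.2 * ('X * (P.1 i j)^`() - P.2%:R *: P.1 i j).[c])) T1.
  have -> : X = \matrix_(i, j) (1 ^- P.2 * ('X * (P.1 i j)^`() - P.2%:R *: P.1 i j).[1]).
    by apply/matrixP => i j; rewrite !mxE expr1n invr1 mul1r.
  apply: lX; rewrite ?oner_neq0 ?torus1_1 //; last exact: torus1_mem.
  move=> i j; have := rat_deriv_laurent P i j.
  by congr rat_deriv; apply: funext => b; rewrite mxE.
(* For [X = 0] the equation reads [z P' = k P], so every entry of [P] is a monomial of degree [k]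
   and [t] is constant. Injectivity, tested at 2 and 1, excludes this in characteristic zero. *)
apply/eqP => X0.
have tE c : c != 0 -> t c = \matrix_(i, j) (P.1 i j)`_P.2.
  move=> c0; apply/matrixP => i j; rewrite !mxE map_poly_id //.
  have PE : P.1 i j = (P.1 i j)`_P.2 *: 'X^(P.2).
    apply/polyP => k; rewrite coefZ coefXn.
    have := congr1 (fun q : {poly C} => q`_k) (odeP i j).
    rewrite X0 big1 => [|b _]; last by rewrite mxE scale0r.
    rewrite coef0 coefB coefZ mulrC coefMX coef_deriv => /eqP.
    have -> : (if k == 0%N then 0 else (P.1 i j)`_k.-1.+1 *+ k.-1.+1) = k%:R * (P.1 i j)`_k.
      by case: k => [|k] /=; rewrite ?mul0r // mulr_natl.
    rewrite -mulrBl mulf_eq0 subr_eq0 => /orP[/eqP/(natf_inj charC) ->|/eqP e0].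
      by rewrite eqxx mulr1.
    by rewrite e0; case: eqP => [<-|_]; rewrite ?e0 ?mul0r ?mulr0.
  by rewrite PE hornerZ hornerXn coefZ coefXn eqxx mulr1 mulrC mulfK ?expf_neq0.
have two0 : 2%:R != 0 :> C by rewrite natf_eq0.
have := torus1_inj two0 (oner_neq0 C); rewrite (tE _ two0) (tE _ (oner_neq0 C)) => /(_ erefl).
by move/(@natf_inj C charC 2 1).
Qed.

End LaurentCurves.

(** * Classical groups *)

Section ClassicalGroups.
Variables (C : closedFieldType) (charC : [pchar C] =i pred0) (n : nat).
Implicit Types (J A Y e : 'M[C]_n) (G : 'M[C]_n -> Prop).

Let generic : 'M[{mpoly C[n * n]}]_n := \matrix_(i, j) 'X_(mxvec_index i j).

Lemma map_generic A : map_mx (mmap idfun (mxvec A 0)) generic = A.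
Proof. by apply/matrixP => i j; rewrite !mxE -/(mx_eval idfun A _) mx_evalX mxvecE. Qed.

Lemma mx_eval_det A : mx_eval idfun A (\det generic) = \det A.
Proof. by rewrite -[in RHS](map_generic A) det_map_mx. Qed.

Definition form_poly J i j : {mpoly C[n * n]} :=
  \sum_a \sum_b 'X_(mxvec_index a i) * (J a b)%:MP * 'X_(mxvec_index b j) - (J i j)%:MP.

Lemma mx_eval_form J A i j :
  mx_eval idfun A (form_poly J i j) = (A^T *m J *m A - J) i j.
Proof.
rewrite [RHS]mxE [X in _ = _ + X]mxE /form_poly /mx_eval rmorphB rmorph_sum /=.
rewrite -/(mx_eval idfun A _%:MP) mx_evalC; congr (_ - _).
rewrite mxE [RHS](eq_bigr (fun b => \sum_a A a i * J a b * A b j)) => [|b _]; last first.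
  by rewrite mxE mulr_suml; apply: eq_bigr => a _; rewrite mxE.
rewrite [RHS]exchange_big; apply: eq_bigr => a _; rewrite rmorph_sum; apply: eq_bigr => b _.
by rewrite /= -/(mx_eval idfun A _) !mx_evalM !mx_evalX mx_evalC !mxvecE.
Qed.

Lemma dmx_eval_sum I (r : seq I) (p : I -> {mpoly C[n * n]}) A Y :
  dmx_eval idfun A (\sum_(i <- r) p i) Y = \sum_(i <- r) dmx_eval idfun A (p i) Y.
Proof.
elim/big_rec2: _ => [|i q s _ <-]; last by rewrite dmx_evalD.
by rewrite -mpolyC0 dmx_evalC.
Qed.

Lemma dmx_eval_form J Y i j :
  dmx_eval idfun 1%:M (form_poly J i j) Y = (Y^T *m J + J *m Y) i j.
Proof.
rewrite /form_poly dmx_evalD -mpolyCN dmx_evalC addr0 dmx_eval_sum.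
rewrite (eq_bigr (fun a => \sum_b (Y a i * J a b * (b == j)%:R + (a == i)%:R * J a b * Y b j))); last first.
  move=> a _; rewrite dmx_eval_sum; apply: eq_bigr => b _.
  by rewrite !dmx_evalM !mx_evalM !mx_evalX mx_evalC dmx_evalC !dmx_evalX !mxvecE !mxE /=; ring.
under eq_bigr do rewrite big_split /=.
rewrite big_split /= !mxE; congr (_ + _).
  apply: eq_bigr => a _; rewrite (bigD1 j) //= eqxx big1 => [|b /negPf ->].
    by rewrite mulr1 addr0 mxE.
  by rewrite mulr0.
rewrite (bigD1 i) //= [X in _ + X]big1 => [|a /negPf ->].
  by rewrite addr0; apply: eq_bigr => b _; rewrite eqxx mul1r.
by rewrite big1 // => b _; rewrite !mul0r.
Qed.

Lemma form_unit J A : J \in unitmx -> A^T *m J *m A = J -> A \in unitmx.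
Proof.
move=> JU e; move: (JU); rewrite -{1}e unitmx_mul => /andP[_].
by [].
Qed.

Lemma form_inv J A : J \in unitmx -> A^T *m J *m A = J ->
  (invmx A)^T *m J *m invmx A = J.
Proof.
move=> JU e; have AU := form_unit JU e.
by rewrite -{1}e trmx_inv !mulmxA mulVmx ?unitmx_tr // mul1mx -mulmxA mulmxV // mulmx1.
Qed.

Lemma form_mul J A B : A^T *m J *m A = J -> B^T *m J *m B = J ->
  (A *m B)^T *m J *m (A *m B) = J.
Proof.
by move=> eA eB; rewrite trmx_mul -!mulmxA (mulmxA J) (mulmxA A^T) (mulmxA A^T) eA mulmxA eB.
Qed.

Lemma classical_alg_subgroup G : classical_group G -> alg_subgroup G.
Proof.
have closedP (Z : 'M[C]_n -> Prop) (ps : seq {mpoly C[n * n]}) :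
    (forall A, Z A -> A \in unitmx) ->
    (forall A, Z A <-> forall p, p \in ps -> mx_eval idfun A p = 0) -> zariski_closed Z.
  move=> ZU Zp A; split=> [ZA|[_ vA]]; first by split; [exact: ZU|move=> p; apply].
  by apply/Zp => p pps; apply: vA => B /Zp; apply.
pose forms J := [seq form_poly J ij.1 ij.2 | ij <- enum {: 'I_n * 'I_n}].
have formsP J A : (forall p, p \in forms J -> mx_eval idfun A p = 0) <-> A^T *m J *m A = J.
  split=> [v|e p /mapP[[i j] _ ->]].
    apply/eqP; rewrite -subr_eq0; apply/eqP/matrixP => i j.
    rewrite -mx_eval_form [RHS]mxE; apply: v; apply/mapP.
    by exists (i, j); rewrite ?mem_enum.
  by rewrite mx_eval_form e subrr mxE.
have detP A : mx_eval idfun A (\det generic - 1) = \det A - 1.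
  by rewrite /mx_eval rmorphB rmorph1 /=; congr (_ - _); apply: mx_eval_det.
move=> [GE|[J [_ JU GE]]|[J [_ JU GE]]].
- have GU A : G A -> A \in unitmx by move/GE => e; rewrite unitmxE e unitr1.
  split; last first.
    apply: (closedP _ [:: \det generic - 1]) => // A; rewrite GE.
    split=> [e p|]; first by rewrite inE => /eqP ->; rewrite detP e subrr.
    by move/(_ _ (mem_head _ _)); rewrite detP => /eqP; rewrite subr_eq0 => /eqP.
  split=> // [|A B /GE eA /GE eB|A /GE eA]; apply/GE; rewrite ?det1 //.
    by rewrite det_mulmx eA eB mulr1.
  by rewrite det_inv eA invr1.
- have GU A : G A -> A \in unitmx by move/GE => e; apply: form_unit e.
  split; last by apply: (closedP _ (forms J)) => // A; rewrite formsP.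
  split=> // [|A B /GE eA /GE eB|A /GE eA]; apply/GE.
  + by rewrite trmx1 mul1mx mulmx1.
  + exact: form_mul.
  + exact: form_inv.
- have GU A : G A -> A \in unitmx by move/GE => [e _]; apply: form_unit e.
  split; last first.
    apply: (closedP _ ((\det generic - 1) :: forms J)) => // A; rewrite GE -formsP.
    split=> [[v d] p|v].
      by rewrite inE => /orP[/eqP ->|]; [rewrite detP d subrr|apply: v].
    split=> [p pJ|]; first by apply: v; rewrite inE pJ orbT.
    by have := v _ (mem_head _ _); rewrite detP => /eqP; rewrite subr_eq0 => /eqP.
  split=> // [|A B /GE [eA dA] /GE [eB dB]|A /GE [eA dA]]; apply/GE; split.
  + by rewrite trmx1 mul1mx mulmx1.
  + exact: det1.
  + exact: form_mul.
  + by rewrite det_mulmx dA dB mulr1.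
  + exact: form_inv.
  + by rewrite det_inv dA invr1.
Qed.

Lemma lie_form J G Y : (forall A, G A -> A^T *m J *m A = J) -> lie idfun G Y ->
  Y^T *m J + J *m Y = 0.
Proof.
move=> GJ lY; apply/matrixP => i j; rewrite -dmx_eval_form [RHS]mxE; apply: lY => A /GJ e.
by rewrite mx_eval_form e subrr mxE.
Qed.

(** For SL_n the trace form is tested against elementary matrices, which lie in the Lie algebra only
    off the diagonal. *)
Lemma nilpotent_offdiag e : e ^+ n = 0 -> e != 0 -> exists a b, a != b /\ e a b != 0.
Proof.
move=> en e0; apply: contrapT => nex.
have off a b : a != b -> e a b = 0.
  by move=> ab; apply: contrapT => /eqP nz; apply: nex; exists a, b.
have pow k i j : (e ^+ k) i j = (i == j)%:R * e i i ^+ k.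
  elim: k i j => [|k IH] i j; first by rewrite !expr0 mulr1 mxE.
  rewrite exprS -[_ * _]/(_ *m _) mxE (bigD1 i) //= big1 => [|b bi].
    by rewrite IH exprS addr0 mulrCA.
  by rewrite off ?mul0r // eq_sym.
case/eqP: e0; apply/matrixP => i j; rewrite [RHS]mxE.
case: (eqVneq i j) => [<-|/off //].
have /matrixP /(_ i i) := en; rewrite pow eqxx mul1r mxE => /eqP.
by rewrite expf_eq0 => /andP[_ /eqP].
Qed.

Lemma det_elementary (c : C) (a b : 'I_n) : a != b -> \det (1%:M + c *: delta_mx a b) = 1.
Proof.
move=> ab; wlog lba : a b ab / (b < a)%N.
  move=> H; case: (ltngtP b a) => [|lt|e]; first exact: H.
    by rewrite -det_tr linearD linearZ /= trmx1 trmx_delta H // eq_sym.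
  by case/eqP: ab; apply: val_inj.
rewrite det_trig.
  rewrite big1 // => i _; rewrite !mxE eqxx; case: (eqVneq i a) => [->|_]; last by rewrite mulr0 addr0.
  by rewrite (negPf ab) mulr0 addr0.
apply/is_trig_mxP => i j lij; rewrite !mxE.
have -> : (i == j) = false by apply/eqP => e; rewrite e ltnn in lij.
case: eqP => [ia|_]; last by rewrite mulr0 addr0.
case: eqP => [jb|_]; last by rewrite mulr0 addr0.
by move: lij; rewrite ia jb ltnNge ltnW.
Qed.

Lemma zariski_dense_all : zariski_dense (fun _ : C => True).
Proof. by move=> p p0; apply: (poly_nat_eq0 charC) => k; apply: p0. Qed.

Lemma lie_elementary G (a b : 'I_n) : (forall A, \det A = 1 -> G A) -> a != b ->
  lie idfun G (delta_mx a b).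
Proof.
move=> detG ab.
apply: (@curve_tangent C n 1 _ zariski_dense_all (fun c => 1%:M + c *: delta_mx a b)
  (fun=> delta_mx a b) G _ 0) => //; last by move=> c _; apply/detG/det_elementary.
  move=> i j; have := rat_deriv_poly 1 (fun=> True) ((i == j)%:R%:P + (delta_mx a b i j : C) *: 'X).
  congr rat_deriv; apply: funext => c; first by rewrite hornerD hornerC hornerZ hornerX !mxE mulrC.
  by rewrite mul1r derivD derivC derivZ derivX add0r hornerZ hornerC mulr1 !mxE.
by rewrite scale0r addr0.
Qed.

Lemma rat_deriv_div (a : {poly C}) (U : C -> Prop) (Q R : {poly C}) :
  (forall c, U c -> Q.[c] != 0) ->
  rat_deriv a U (fun c => R.[c] / Q.[c])
    (fun c => ((a * R^`()).[c] - R.[c] / Q.[c] * (a * Q^`()).[c]) / Q.[c]).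
Proof.
by move=> nQ; exists Q, R; split=> // c Uc; rewrite !divfK ?nQ // subrK.
Qed.

(* The Cayley transform (1 + c Y) (1 - c Y)^-1 is a rational curve in G with
   tangent vector 2 Y at c = 0. *)
Lemma lie_cayley J G Y : J \in unitmx ->
  (forall A, A^T *m J *m A = J -> \det A = 1 -> G A) ->
  Y^T *m J + J *m Y = 0 -> lie idfun G Y.
Proof.
move=> JU GJ eY.
have YJ : Y^T *m J = - (J *m Y) by apply/eqP; rewrite -addr_eq0 eY.
pose M (s : {poly C}) : 'M[{poly C}]_n := 1%:M + s *: map_mx polyC Y.
have ME s c : map_mx (horner_eval c) (M s) = 1%:M + s.[c] *: Y.
  by apply/matrixP => i j; rewrite !mxE /horner_eval hornerD hornerM hornerC -(rmorph_nat polyC) hornerC.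
pose q := \det (M (- 'X)).
have qE c : q.[c] = \det (1%:M - c *: Y).
  by rewrite -[q.[c]]/(horner_eval c q) -det_map_mx ME hornerN hornerX scaleNr.
have q0 : q.[0] = 1 by rewrite qE scale0r subr0 det1.
have nq : q != 0 by apply/eqP => e; move/eqP: q0; rewrite e horner0 eq_sym oner_eq0.
have dU := zariski_dense_neq0 charC nq.
pose P := M 'X *m \adj (M (- 'X)).
pose g c : 'M[C]_n := (1%:M + c *: Y) *m invmx (1%:M - c *: Y).
have gU c : q.[c] != 0 -> (1%:M - c *: Y) \in unitmx by rewrite unitmxE unitfE qE.
have gE c i j : q.[c] != 0 -> g c i j = (P i j).[c] / q.[c].
  move=> qc; rewrite /g /invmx gU // -scalemxAr mxE mulrC -qE; congr (_ * _).
  transitivity (map_mx (horner_eval c) P i j); last by rewrite mxE.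
  by rewrite /P map_mxM /= map_mx_adj !ME hornerN hornerX scaleNr.
pose g1 c : 'M[C]_n := \matrix_(i, j)
  (((1 * (P i j)^`()).[c] - (P i j).[c] / q.[c] * (1 * q^`()).[c]) / q.[c]).
pose U c := q.[c] != 0.
have dg i j : rat_deriv 1 U (fun c => g c i j) (fun c => g1 c i j).
  have [Q [R [nQ e]]] := @rat_deriv_div 1 U q (P i j) (fun c => id).
  by exists Q, R; split=> // c Uc; have := e c Uc; rewrite gE // [g1 c i j]mxE.
have U0 : U 0 by rewrite /U q0 oner_neq0.
have g0 : g 0 = 1%:M by rewrite /g scale0r subr0 addr0 invmx1 mulmx1.
(* Differentiating [g(c) (1 - c Y) = 1 + c Y] at 0 gives [g1 0 - Y = Y]. *)
have g10 : g1 0 = 2%:R *: Y.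
  apply/matrixP => i j.
  have dL := rat_deriv_sum (index_enum 'I_n) (fun k => rat_derivM (dg i k)
    (rat_deriv_poly 1 U ((k == j)%:R%:P - (Y k j) *: 'X))).
  have dR := rat_deriv_poly 1 U ((i == j)%:R%:P + (Y i j) *: 'X).
  have deC (s : bool) (b : C) : ((1 * (s%:R%:P + b *: 'X)^`()) : {poly C}).[0] = b.
    by rewrite mul1r derivD derivC derivZ derivX add0r hornerZ hornerC mulr1.
  have H : \sum_k (g1 0 i k * (k == j)%:R + (i == k)%:R * - Y k j) = Y i j.
    rewrite -[RHS](deC (i == j)) -(rat_deriv_uniq dU dL dR _ U0) => [|c Uc].
      apply: eq_bigr => k _.
      by rewrite -scaleNr deC hornerD hornerC hornerZ hornerX mulr0 addr0 g0 [1%:M i k]mxE.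
    have gm : g c *m (1%:M - c *: Y) = 1%:M + c *: Y by rewrite /g mulmxKV // gU.
    have /matrixP /(_ i j) := gm; rewrite mxE => e; transitivity ((1%:M + c *: Y) i j).
      by rewrite -e; apply: eq_bigr => k _; rewrite hornerD hornerN hornerC hornerZ hornerX !mxE [c * _]mulrC.
    by rewrite hornerD hornerC hornerZ hornerX !mxE [c * _]mulrC.
  move: H; rewrite big_split /= (bigD1 j) //= eqxx mulr1 big1 => [|k /negPf ->]; last by rewrite mulr0.
  rewrite addr0 (bigD1 i) //= eqxx mul1r big1 => [|k /negPf nk]; last first.
    by rewrite eq_sym nk mul0r.
  rewrite addr0 => /eqP H; apply/eqP.
  by move: H; rewrite subr_eq [(2%:R *: Y) i j]mxE mulr_natl mulr2n.
have lgt : lie idfun G (g1 0).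
  apply: (curve_tangent dU dg U0 g0) => c Uc; have cU := gU c Uc.
  have JV : J *m (1%:M + c *: Y) = (1%:M - c *: Y)^T *m J.
    rewrite linearB /= trmx1 linearZ /= mulmxDr mulmxBl mulmx1 mul1mx -scalemxAr -scalemxAl.
    by rewrite YJ scalerN opprK.
  have JV' : (1%:M + c *: Y)^T *m J = J *m (1%:M - c *: Y).
    rewrite linearD /= trmx1 linearZ /= mulmxDl mulmxBr mulmx1 mul1mx -scalemxAr -scalemxAl.
    by rewrite YJ scalerN.
  have cU' : (1%:M - c *: Y)^T \in unitmx by rewrite unitmx_tr.
  apply: GJ.
    have PQ : (1%:M - c *: Y) *m (1%:M + c *: Y) = (1%:M + c *: Y) *m (1%:M - c *: Y).
      move: (c *: Y) => W; rewrite mulmxBl mulmxDl !mul1mx mulmxDr mulmxBr !mulmx1.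
      by move: (W *m W) => V; apply/matrixP => a b; rewrite !mxE; ring.
    rewrite /g trmx_mul trmx_inv -[_ *m (1%:M + c *: Y)^T *m J]mulmxA JV' !mulmxA.
    by rewrite -(mulmxA _ _ (1%:M + c *: Y)) PQ !mulmxA mulmxK // -(mulmxA _ J) JV mulmxA mulVmx // mul1mx.
  (* By [JV] the numerator and the denominator of the Cayley transform have the same determinant, so
     its values have determinant 1, as SO_n requires. *)
  have dJ : \det J != 0 by rewrite -unitfE -unitmxE.
  have := congr1 determinant JV; rewrite !det_mulmx det_tr mulrC => /(mulIf dJ) e.
  by rewrite det_inv e divff // -qE.
have two0 : 2%:R != 0 :> C by rewrite natf_eq0.
by rewrite -[Y]scale1r -(mulVf two0) -scalerA -g10; apply: lieZ.
Qed.

(** Applied to a root vector, this forces a basis vector of the opposite weight to exist; root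
    vectors are nilpotent, whence the restriction on [e]. *)
Lemma classical_trace_nondeg G e : classical_group G -> lie idfun G e ->
  e ^+ n = 0 -> e != 0 -> exists2 Y, lie idfun G Y & \tr (e *m Y) != 0.
Proof.
have two0 : 2%:R != 0 :> C by rewrite natf_eq0.
have form J : J \in unitmx -> (J^T = J \/ J^T = - J) ->
    (forall A, A^T *m J *m A = J -> \det A = 1 -> G A) ->
    (forall A, G A -> A^T *m J *m A = J) -> lie idfun G e -> e != 0 ->
    exists2 Y, lie idfun G Y & \tr (e *m Y) != 0.
  move=> JU JT GJ JG le e0.
  have [a [b eab]] : exists a b, e a b != 0.
    apply: contrapT => nex; case/eqP: e0; apply/matrixP => i j; rewrite [RHS]mxE.
    by apply: contrapT => /eqP nz; apply: nex; exists i, j.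
  pose M : 'M[C]_n := delta_mx b a.
  (* Twice the projection of the elementary matrix [M] to the matrices skew for [J]. As [e] is skew
     too, both summands contribute equally and the trace is [2 e_ab]. *)
  exists (M - invmx J *m M^T *m J).
    apply: (lie_cayley JU GJ); rewrite linearB /= !trmx_mul trmxK trmx_inv.
    rewrite mulmxBl mulmxBr !mulmxA mulmxV // mul1mx.
    have -> : J^T *m M *m invmx J^T *m J = J *m M.
      case: JT => ->; first by rewrite -mulmxA mulVmx // mulmx1.
      have -> : invmx (- J) = - invmx J by rewrite -[- J]scaleN1r invmxZ ?unitmxZ ?unitrN1 // invrN1 scaleN1r.
      by rewrite !mulNmx !mulmxN !mulNmx opprK -mulmxA mulVmx // mulmx1.
    by rewrite addrA subrK subrr.
  have eJ := lie_form JG le.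
  have teM : \tr (e *m M) = e a b.
    rewrite /mxtrace (bigD1 a) //= mxE (bigD1 b) //= big1 => [|k /negPf nk].
      rewrite mxE !eqxx mulr1 addr0 big1 ?addr0 // => i /negPf ni.
      by rewrite mxE big1 // => k _; rewrite mxE ni andbF mulr0.
    by rewrite mxE nk mulr0.
  have -> : \tr (e *m (M - invmx J *m M^T *m J)) = 2%:R * \tr (e *m M).
    rewrite mulmxBr linearB /= !mulmxA.
    have -> : \tr (e *m invmx J *m M^T *m J) = - \tr (e *m M).
      rewrite mxtrace_mulC !mulmxA.
      have -> : J *m e = - (e^T *m J) by apply/eqP; rewrite -addr_eq0 addrC eJ.
      by rewrite !mulNmx mulmxK // linearN /= -trmx_mul mxtrace_tr mxtrace_mulC.
    by rewrite opprK mulr_natl mulr2n.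
  by rewrite teM mulf_neq0.
move=> [GE|[J [JT JU GE]]|[J [JT JU GE]]] le en e0.
- have [a [b [ab eab]]] := nilpotent_offdiag en e0.
  exists (delta_mx b a); first by apply: lie_elementary; [move=> A /GE|rewrite eq_sym].
  rewrite /mxtrace (bigD1 a) //= mxE (bigD1 b) //= big1 => [|k /negPf nk].
    rewrite mxE !eqxx mulr1 addr0 big1 ?addr0 // => i /negPf ni.
    by rewrite mxE big1 // => k _; rewrite mxE ni andbF mulr0.
  by rewrite mxE nk mulr0.
- by apply: (form J) => //; [right|move=> A eA _; apply/GE|move=> A /GE].
- by apply: (form J) => //; [left|move=> A eA dA; apply/GE|move=> A /GE []].
Qed.

End ClassicalGroups.

(** * Roots *)

Section DualBasis.
Variables (C : fieldType) (V : vectType C) (s : seq V).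
Hypothesis free_s : free s.

(** The coordinate functional is indexed by the basis vector instead of its position, so that root
    vectors can be addressed by their root. In a free family at most one index contributes; the
    value is 0 if [v] does not occur. *)
Definition dual_coord (v w : V) : C :=
  \sum_(i < size s | s`_i == v) coord (in_tuple s) i w.

Lemma dual_coord_is_linear v : linear (dual_coord v : V -> C^o).
Proof.
move=> a w1 w2; rewrite /dual_coord scaler_sumr -big_split /=.
by apply: eq_bigr => i _; rewrite linearP.
Qed.

HB.instance Definition _ v :=
  GRing.isLinear.Build C V C^o _ (dual_coord v) (dual_coord_is_linear v).

Lemma dual_coordE v w : v \in s -> w \in s -> dual_coord v w = (v == w)%:R.
Proof.
move=> vs ws; have us : uniq s by apply: free_uniq.
have iv : (index v s < size s)%N by rewrite index_mem.
have iw : (index w s < size s)%N by rewrite index_mem.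
rewrite /dual_coord (bigD1 (Ordinal iv)) /= ?nth_index // big1 => [|i /andP[/eqP e /eqP ne]]; last first.
  by case: ne; apply: val_inj; rewrite /= -e index_uniq.
rewrite addr0 -{1}(nth_index 0 ws) -[index w s]/(nat_of_ord (Ordinal iw)).
rewrite (@coord_free _ _ _ (in_tuple s)) //; congr (nat_of_bool _)%:R.
apply/eqP/eqP => [/(congr1 val) /= e|e]; last by apply: val_inj; rewrite /= e.
by rewrite -(nth_index 0 vs) -e nth_index.
Qed.

Lemma dual_coord_span w : w \in <<s>>%VS -> w = \sum_(v <- s) dual_coord v w *: v.
Proof.
move=> ws; have us : uniq s by apply: free_uniq.
rewrite {1}(coord_span (X := in_tuple s) ws) (big_nth 0) big_mkord; apply: eq_bigr => i _.
congr (_ *: _); rewrite /dual_coord (bigD1 i) //= big1 ?addr0 // => j /andP[e ne].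
by case/eqP: ne; apply: val_inj; move: e; rewrite /= nth_uniq // => /eqP.
Qed.

End DualBasis.

Section Roots.
Variables (C : closedFieldType) (charC : [pchar C] =i pred0).
Variables (n l m : nat) (S : group_data C n l m).

Local Notation G := (grp S).
Local Notation T := (max_torus S).
Local Notation g := (lie idfun G).
Local Notation h := (lie idfun T).
Local Notation alpha := (simple_root S).
Local Notation Phi := (Defs.roots S).
Local Notation H_ := (chev_H S).
Local Notation X_ := (chev_X S).
Local Notation wt := (root_of alpha).

Lemma grp_alg : alg_subgroup G.
Proof. exact: (classical_alg_subgroup (grp_classical S)). Qed.

Lemma grp_subgroup : subgroup G.
Proof. by have [] := grp_alg. Qed.

Lemma torus_alg : alg_subgroup T.
Proof. by have [[]] := max_torusP S. Qed.

Lemma torus_sub A : T A -> G A.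
Proof. by have [_ sub _] := max_torusP S; apply: sub. Qed.

Lemma torus_comm A B : T A -> T B -> A *m B = B *m A.
Proof.
move=> TA TB; have [[_ [r [f [[_ fM _] [f' [[f'D f'M _] _ f'K]]]]]] _ _] := max_torusP S.
have [dA _] := f'D _ TA; have [dB _] := f'D _ TB.
rewrite -(f'K _ TA) -(f'K _ TB) -!fM; try by apply: f'D.
have /diag_mxP[a ->] := dA; have /diag_mxP[b ->] := dB; congr (f _).
by rewrite !mulmx_diag; congr diag_mx; apply/rowP => i; rewrite !mxE mulrC.
Qed.

Lemma torus_unit A : T A -> A \in unitmx.
Proof. by have [[TU _ _ _] _] := torus_alg; apply: TU. Qed.

Lemma torus_lie_comm A Z : T A -> h Z -> A *m Z = Z *m A.
Proof.
move=> TA hZ; apply/eqP; rewrite -subr_eq0; apply/eqP.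
pose f (B : 'M[C]_n) := A *m B - B *m A.
have fL : linear f.
  move=> a B1 B2; rewrite /f mulmxDr mulmxDl -scalemxAr -scalemxAl scalerBr.
  by rewrite opprD addrACA.
pose F := GRing.isLinear.Build C _ _ _ f fL.
pose F' : {linear 'M[C]_n -> 'M[C]_n} := HB.pack f F.
apply: (@lie_linear_eq0 C n n T F' _ Z hZ) => B TB.
by rewrite /= /f (torus_comm TA TB) subrr.
Qed.

Lemma h_comm A Z : h A -> h Z -> bracket A Z = 0.
Proof.
move=> hA hZ; pose f (B : 'M[C]_n) := B *m Z - Z *m B.
have fL : linear f.
  move=> a B1 B2; rewrite /f mulmxDr mulmxDl -scalemxAr -scalemxAl scalerBr.
  by rewrite opprD addrACA.
pose F := GRing.isLinear.Build C _ _ _ f fL.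
pose F' : {linear 'M[C]_n -> 'M[C]_n} := HB.pack f F.
apply: (@lie_linear_eq0 C n n T F' _ A hA) => B TB.
by rewrite /= /f (torus_lie_comm TB hZ) subrr.
Qed.

Lemma h_sub_g A : h A -> g A.
Proof. exact/lie_sub/torus_sub. Qed.

Lemma intr_eq0_char0 (k : int) : (k%:~R == 0 :> C) = (k == 0).
Proof.
by case: k => k; rewrite ?NegzE ?rmorphN ?oppr_eq0 -?pmulrn natf_eq0.
Qed.

Lemma wtD k j A : wt (k + j) A = wt k A + wt j A.
Proof.
rewrite /root_of -big_split; apply: eq_bigr => i _.
by rewrite !mxE rmorphD mulrDl.
Qed.

Lemma wtN k A : wt (- k) A = - wt k A.
Proof.
rewrite /root_of -sumrN; apply: eq_bigr => i _.
by rewrite !mxE rmorphN mulNr.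
Qed.

Lemma wt_delta i A : wt (delta_mx 0 i) A = alpha i A.
Proof.
rewrite /root_of (bigD1 i) //= big1 => [|j /negPf nj]; first by rewrite mxE !eqxx mul1r addr0.
by rewrite mxE nj mul0r.
Qed.

Lemma wt_inj k j : (forall A, h A -> wt k A = wt j A) -> k = j.
Proof.
move=> e; apply/rowP => i; apply/eqP; rewrite -subr_eq0 -intr_eq0_char0; apply/eqP.
have [indep _ _ _ _] := Defs.rootsP S.
apply: (indep (fun i => (k 0 i - j 0 i)%:~R)) => A hA.
transitivity (wt k A - wt j A); last by rewrite e ?subrr.
rewrite /root_of -sumrB; apply: eq_bigr => i' _.
by rewrite rmorphB mulrBl.
Qed.

Lemma wt_neq0 k : k != 0 -> exists2 A, h A & wt k A != 0.
Proof.
move=> k0; apply: contrapT => nex; case/eqP: k0; apply: wt_inj => A hA.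
have -> : wt 0 A = 0 by rewrite /root_of big1 // => i _; rewrite mxE mul0r.
by apply: contrapT => /eqP nz; apply: nex; exists A.
Qed.

Lemma wt0 A : wt 0 A = 0.
Proof. by rewrite /root_of big1 // => i _; rewrite mxE mul0r. Qed.

Lemma root_eq a k : is_root g h a -> (forall A, h A -> a A = wt k A) -> k \in Phi.
Proof.
move=> [[A hA aA] [X [gX eX] nX]] e; have [_ _ _ _ H] := Defs.rootsP S; apply/H; split.
  by exists A; rewrite -?e.
by exists X => //; split=> // B hB; rewrite eX // e.
Qed.

Lemma is_root_in_roots a : is_root g h a ->
  exists2 k, k \in Phi & forall A, h A -> a A = wt k A.
Proof.
move=> ra; have [_ _ /(_ a ra) [k _ e] _ _] := Defs.rootsP S.
by exists k => //; apply: root_eq e.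
Qed.

Lemma roots_is_root k : k \in Phi -> is_root g h (wt k).
Proof. by have [_ _ _ _ H] := Defs.rootsP S; move/H. Qed.

Lemma root_neq0 k : k \in Phi -> k != 0.
Proof.
by move/roots_is_root => [[A hA nz] _]; apply: contraNneq nz => ->; rewrite wt0.
Qed.

Lemma root_sign k : k \in Phi -> nonneg_coords k || nonneg_coords (- k).
Proof.
move=> /roots_is_root rk; have [_ _ /(_ _ rk) [j sj e] _ _] := Defs.rootsP S.
by rewrite (wt_inj e).
Qed.

Lemma simple_root_in i : delta_mx 0 i \in Phi.
Proof.
have [_ /(_ i) ri _ _ _] := Defs.rootsP S.
by apply: (root_eq ri) => A _; rewrite wt_delta.
Qed.

Definition chev_seq := [seq H_ i | i <- enum 'I_l] ++ [seq X_ k | k <- Phi].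

Lemma chev_free : free chev_seq.
Proof. by have [[]] := chevalleyP S. Qed.

Definition coordX k (A : 'M[C]_n) : C := dual_coord chev_seq (X_ k) A.
Definition coordH i (A : 'M[C]_n) : C := dual_coord chev_seq (H_ i) A.

Lemma coordXZ k a A : coordX k (a *: A) = a * coordX k A.
Proof. by rewrite /coordX linearZ. Qed.

Lemma coordHZ i a A : coordH i (a *: A) = a * coordH i A.
Proof. by rewrite /coordH linearZ. Qed.

Lemma coordX0 k : coordX k 0 = 0.
Proof. by rewrite /coordX linear0. Qed.

Lemma coordX_sum k I (r : seq I) (P : pred I) F :
  coordX k (\sum_(i <- r | P i) F i) = \sum_(i <- r | P i) coordX k (F i).
Proof. by rewrite /coordX linear_sum. Qed.

Lemma coordH_sum k I (r : seq I) (P : pred I) F :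
  coordH k (\sum_(i <- r | P i) F i) = \sum_(i <- r | P i) coordH k (F i).
Proof. by rewrite /coordH linear_sum. Qed.

Lemma X_in k : k \in Phi -> X_ k \in chev_seq.
Proof. by move=> kP; rewrite mem_cat map_f ?orbT. Qed.

Lemma H_in i : H_ i \in chev_seq.
Proof. by rewrite mem_cat map_f // mem_enum. Qed.

Lemma uniq_roots_seq : uniq Phi.
Proof. by have [] := Defs.rootsP S. Qed.

Lemma uniq_map_inj (A B : eqType) (f : A -> B) (s : seq A) :
  uniq (map f s) -> {in s &, injective f}.
Proof.
move=> us k j ks js e; have sk : (index k s < size s)%N by rewrite index_mem.
have sj : (index j s < size s)%N by rewrite index_mem.
have /eqP : nth (f k) (map f s) (index k s) = nth (f k) (map f s) (index j s).
  by rewrite !(nth_map k) // !nth_index.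
by rewrite nth_uniq ?size_map // => /eqP e'; rewrite -(nth_index k ks) e' nth_index.
Qed.

Lemma coordXX k j : k \in Phi -> j \in Phi -> coordX k (X_ j) = (k == j)%:R.
Proof.
move=> kP jP; rewrite /coordX dual_coordE ?X_in //; last exact: chev_free.
have := free_uniq chev_free; rewrite cat_uniq => /and3P[_ _ u].
congr (nat_of_bool _)%:R; apply/eqP/eqP => [|-> //].
exact: (uniq_map_inj u).
Qed.

Lemma coordHH i j : coordH i (H_ j) = (i == j)%:R.
Proof.
rewrite /coordH dual_coordE ?H_in //; last exact: chev_free.
have := free_uniq chev_free; rewrite cat_uniq => /and3P[u _ _].
congr (nat_of_bool _)%:R; apply/eqP/eqP => [|-> //].
by move/(uniq_map_inj u); apply; rewrite mem_enum.
Qed.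

Lemma H_neq_X i k : k \in Phi -> H_ i != X_ k.
Proof.
move=> kP; have := free_uniq chev_free; rewrite cat_uniq => /and3P[_ /hasPn nH _].
apply/eqP => e; have := nH (X_ k) (map_f _ kP).
by rewrite /= -e map_f // mem_enum.
Qed.

Lemma coordHX k i : k \in Phi -> coordH i (X_ k) = 0.
Proof.
move=> kP; rewrite /coordH dual_coordE ?X_in ?H_in //; last exact: chev_free.
by rewrite (negPf (H_neq_X i kP)).
Qed.

Lemma g_decomp A : g A ->
  A = \sum_i coordH i A *: H_ i + \sum_(k <- Phi) coordX k A *: X_ k.
Proof.
have [[_ gE] _ _ _ _] := chevalleyP S; move/gE => /(dual_coord_span chev_free).
by rewrite big_cat /= !big_map -enumT big_enum.
Qed.

Lemma g_H i : g (H_ i).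
Proof. by have [[_ gE] _ _ _ _] := chevalleyP S; apply/gE/memv_span/H_in. Qed.

Lemma g_X k : k \in Phi -> g (X_ k).
Proof. by move=> kP; have [[_ gE] _ _ _ _] := chevalleyP S; apply/gE/memv_span/X_in. Qed.

Lemma root_space_X k : k \in Phi -> root_space g h (wt k) (X_ k).
Proof. by have [_ H _ _ _] := chevalleyP S; apply: H. Qed.

Lemma bracket_hX A k : h A -> k \in Phi -> bracket A (X_ k) = wt k A *: X_ k.
Proof. by move=> hA /root_space_X [_]; apply. Qed.

Lemma h_H i : h (H_ i).
Proof.
have [_ _ coroot HE _] := chevalleyP S; rewrite HE.
by have [] := coroot _ (simple_root_in i).
Qed.

Lemma alpha_H i : alpha i (H_ i) = 2%:R.
Proof.
have [_ _ coroot HE _] := chevalleyP S; rewrite HE.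
by have [_] := coroot _ (simple_root_in i); rewrite wt_delta.
Qed.

Lemma coordX_bracket A B k : h A -> g B -> k \in Phi ->
  coordX k (bracket A B) = wt k A * coordX k B.
Proof.
move=> hA gB kP; rewrite {1}(g_decomp gB) bracketDr !bracket_sumr.
rewrite big1 ?add0r => [|i _]; last by rewrite bracketZr h_comm ?scaler0 //; apply: h_H.
rewrite (_ : \sum_(_ <- _) _ = \sum_(j <- Phi) (wt j A * coordX j B) *: X_ j); last first.
  rewrite big_seq [RHS]big_seq; apply: eq_bigr => j jP.
  by rewrite bracketZr bracket_hX // scalerA mulrC.
rewrite coordX_sum (bigD1_seq k) ?uniq_roots_seq //= coordXZ coordXX // eqxx mulr1.
rewrite big_seq_cond big1 ?addr0 // => j /andP[jP /negPf nj].
by rewrite coordXZ coordXX // eq_sym nj mulr0.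
Qed.

Lemma coordH_bracket A B i : h A -> g B -> coordH i (bracket A B) = 0.
Proof.
move=> hA gB; rewrite {1}(g_decomp gB) bracketDr !bracket_sumr.
rewrite big1 ?add0r => [|j _]; last by rewrite bracketZr h_comm ?scaler0 //; apply: h_H.
rewrite coordH_sum big_seq big1 // => j jP.
by rewrite bracketZr bracket_hX // !coordHZ coordHX // !mulr0.
Qed.

Lemma h_coordX A k : h A -> k \in Phi -> coordX k A = 0.
Proof.
move=> hA kP; have [B hB nz] := wt_neq0 (root_neq0 kP).
have := coordX_bracket hB (h_sub_g hA) kP; rewrite h_comm // => /esym/eqP.
by rewrite coordX0 mulf_eq0 (negPf nz) => /eqP.
Qed.

Lemma h_decomp A : h A -> A = \sum_i coordH i A *: H_ i.
Proof.
move=> hA; rewrite {1}(g_decomp (h_sub_g hA)) [X in _ + X]big_seq [X in _ + X]big1 ?addr0 //.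
by move=> k kP; rewrite h_coordX ?scale0r.
Qed.

(** Root spaces are lines: every Chevalley basis vector other than [X_ k] has a different weight for
    some element of h, so its coordinate in [A] vanishes. *)
Lemma root_space_line k A : k \in Phi -> root_space g h (wt k) A -> A = coordX k A *: X_ k.
Proof.
move=> kP [gA eA]; rewrite {1}(g_decomp gA).
have [B hB nz] := wt_neq0 (root_neq0 kP).
rewrite big1 ?add0r => [|i _]; last first.
  have := coordH_bracket i hB gA; rewrite eA // coordHZ => /eqP.
  by rewrite mulf_eq0 (negPf nz) /= => /eqP ->; rewrite scale0r.
rewrite (bigD1_seq k) ?uniq_roots_seq //= big_seq_cond big1 ?addr0 // => j /andP[jP njk].
suff -> : coordX j A = 0 by rewrite scale0r.
have [D hD nzD] : exists2 D, h D & wt j D - wt k D != 0.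
  have [|D hD] := @wt_neq0 (j - k); first by rewrite subr_eq0.
  by rewrite wtD wtN; exists D.
have := coordX_bracket hD gA jP; rewrite eA // coordXZ.
move/eqP; rewrite eq_sym -subr_eq0 -mulrBl mulf_eq0 (negPf nzD) => /eqP //.
Qed.

Lemma root_space_bracket a b A B : subgroup G ->
  root_space g h a A -> root_space g h b B ->
  root_space g h (fun D => a D + b D) (bracket A B).
Proof.
move=> sG [gA eA] [gB eB]; split; first exact: lie_bracket.
by move=> D hD; rewrite bracket_jacobi (eA D hD) (eB D hD) bracketZl bracketZr scalerDl.
Qed.

(** The bracket has weight [j + k]. If it is nonzero it exhibits [j + k] as a root, since a nonzero
    combination of simple roots does not vanish on h. *)
Lemma bracket_roots j k : j \in Phi -> k \in Phi -> j + k != 0 ->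
  bracket (X_ j) (X_ k) =
    if j + k \in Phi then coordX (j + k) (bracket (X_ j) (X_ k)) *: X_ (j + k) else 0.
Proof.
move=> jP kP jk0.
have [gB eB] := root_space_bracket grp_subgroup (root_space_X jP) (root_space_X kP).
have rs : root_space g h (wt (j + k)) (bracket (X_ j) (X_ k)).
  by split=> // A hA; rewrite eB // wtD.
case: ifP => [jkP|/negP njk]; first exact: root_space_line.
apply: contrapT => /eqP nz; apply: njk; apply: (root_eq (a := wt (j + k))) => //.
split; first exact: wt_neq0.
by exists (bracket (X_ j) (X_ k)).
Qed.

Lemma X_nilpotent k : k \in Phi -> X_ k ^+ n = 0.
Proof.
move=> kP; have [A hA nz] := wt_neq0 (root_neq0 kP).
exact: (bracket_eigen_nilpotent charC nz (bracket_hX hA kP)).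
Qed.

Lemma X_neq0 k : k \in Phi -> X_ k != 0.
Proof.
move=> kP; apply/eqP => e; have := coordXX kP kP.
by rewrite e coordX0 eqxx => /eqP; rewrite eq_sym oner_eq0.
Qed.

(* For the trace form, the root space of k is orthogonal to h and to all
   root spaces but that of - k. *)
Lemma opp_simple_root_in i : - delta_mx 0 i \in Phi.
Proof.
set k := delta_mx 0 i; have kP : k \in Phi := simple_root_in i.
have [Y gY nz] := classical_trace_nondeg charC (grp_classical S) (g_X kP)
  (X_nilpotent kP) (X_neq0 kP).
apply: contrapT => nk; case/eqP: nz.
(* The trace of [[A, X_k B]] is zero, while [A] acts on the product with weight [wt k A + a A]. *)
have tr0 a B : root_space g h a B -> (exists2 A, h A & wt k A + a A != 0) -> \tr (X_ k *m B) = 0.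
  move=> [gB eB] [A hA nz]; apply/eqP; rewrite -(mulrI_eq0 _ (mulfI nz)) mulrDl.
  have -> : wt k A * \tr (X_ k *m B) = \tr (bracket A (X_ k) *m B).
    by rewrite bracket_hX // -scalemxAl linearZ.
  have -> : a A * \tr (X_ k *m B) = \tr (X_ k *m bracket A B).
    by rewrite eB // -scalemxAr linearZ.
  rewrite -linearD /= -bracketMr /bracket linearB /= mxtrace_mulC subrr //.
rewrite (g_decomp gY) mulmxDr !mulmx_sumr linearD !linear_sum /=.
rewrite big1 ?add0r => [|j _]; last first.
  rewrite -scalemxAr linearZ /= (tr0 (fun=> 0)) ?mulr0 //.
    by split=> [|A hA]; [apply: g_H|rewrite scale0r h_comm //; apply: h_H].
  by have [A hA nz] := wt_neq0 (root_neq0 kP); exists A; rewrite ?addr0.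
rewrite big_seq big1 // => j jP; rewrite -scalemxAr linearZ /= (tr0 (wt j)) ?mulr0 //.
  exact: root_space_X.
have [|A hA nz] := @wt_neq0 (k + j); last by exists A; rewrite -?wtD.
by apply: contra_not_neq nk => /eqP; rewrite addrC addr_eq0 => /eqP <-.
Qed.

End Roots.

(** * The Weyl group *)

Lemma invmx_eq (K : fieldType) n (A B : 'M[K]_n) : A *m B = 1%:M -> invmx A = B.
Proof.
by move=> AB; have [AU _] := mulmx1_unit AB; rewrite -[LHS]mulmx1 -AB mulmxA mulVmx // mul1mx.
Qed.

Lemma invmx_mul (K : fieldType) n (A B : 'M[K]_n) : A \in unitmx -> B \in unitmx ->
  invmx (A *m B) = invmx B *m invmx A.
Proof. by move=> AU BU; apply: invmx_eq; rewrite mulmxA mulmxK // mulmxV. Qed.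

Lemma conj_invmx (K : fieldType) n (v A B : 'M[K]_n) : v \in unitmx ->
  v *m B *m invmx v = A -> invmx v *m A *m v = B.
Proof. by move=> vU <-; rewrite !mulmxA mulVmx // mul1mx mulmxKV. Qed.

Section WeylGroup.
Variables (C : closedFieldType) (charC : [pchar C] =i pred0).
Variables (n l m : nat) (S : group_data C n l m).

Local Notation G := (grp S).
Local Notation T := (max_torus S).
Local Notation g := (lie idfun G).
Local Notation h := (lie idfun T).
Local Notation alpha := (simple_root S).
Local Notation Phi := (Defs.roots S).
Local Notation H_ := (chev_H S).
Local Notation X_ := (chev_X S).
Local Notation wt := (root_of alpha).
Local Notation wact := (word_act alpha H_).

(** The normalizer of h in G. Both inclusions are required, so that inverses are covered without a
    dimension count. *)
Definition norm_h (v : 'M[C]_n) : Prop :=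
  [/\ G v, forall A, h A -> h (v *m A *m invmx v)
    & forall A, h A -> h (invmx v *m A *m v)].

Lemma norm_h_unit v : norm_h v -> v \in unitmx.
Proof. by move=> [Gv _ _]; have [GU _ _ _] := grp_subgroup S; apply: GU. Qed.

Lemma norm_h_mul v w : norm_h v -> norm_h w -> norm_h (v *m w).
Proof.
move=> nv nw; have vU := norm_h_unit nv; have wU := norm_h_unit nw.
have [_ _ GM _] := grp_subgroup S.
have [Gv v1 v2] := nv; have [Gw w1 w2] := nw.
split; first exact: GM.
  by move=> A /w1/v1; rewrite invmx_mul // !mulmxA.
by move=> A /v2/w2; rewrite invmx_mul // !mulmxA.
Qed.

Lemma norm_h_inv v : norm_h v -> norm_h (invmx v).
Proof.
move=> nv; have [_ _ _ GV] := grp_subgroup S; have [Gv v1 v2] := nv.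
by split; [apply: GV|move=> A; rewrite invmxK; apply: v2|move=> A; rewrite invmxK; apply: v1].
Qed.

Lemma norm_h_1 : norm_h 1%:M.
Proof.
have [_ G1 _ _] := grp_subgroup S.
by split=> // A; rewrite invmx1 mul1mx mulmx1.
Qed.

Lemma norm_h_weyl : norm_h (weyl_repr S).
Proof.
have [Gw Tw _] := weyl_reprP S; have [GU _ _ _] := grp_subgroup S.
have wU := GU _ Gw.
pose f1 (B : 'M[C]_n) := weyl_repr S *m B *m invmx (weyl_repr S).
have f1L : linear f1 by move=> a B1 B2; rewrite /f1 mulmxDr mulmxDl -scalemxAr -scalemxAl.
pose F1 := GRing.isLinear.Build C _ _ _ f1 f1L.
pose F1' : {linear 'M[C]_n -> 'M[C]_n} := HB.pack f1 F1.
pose f2 (B : 'M[C]_n) := invmx (weyl_repr S) *m B *m weyl_repr S.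
have f2L : linear f2 by move=> a B1 B2; rewrite /f2 mulmxDr mulmxDl -scalemxAr -scalemxAl.
pose F2 := GRing.isLinear.Build C _ _ _ f2 f2L.
pose F2' : {linear 'M[C]_n -> 'M[C]_n} := HB.pack f2 F2.
split=> // A hA.
  rewrite -[X in lie _ _ X]/(F1' A); apply: lie_linear hA => [|B TB].
    by rewrite /= /f1 mulmx1 mulmxV.
  by have [H _] := Tw B; apply: H.
rewrite -[X in lie _ _ X]/(F2' A); apply: lie_linear hA => [|B TB].
  by rewrite /= /f2 mulmx1 mulVmx.
by apply/Tw; rewrite /= /f2 !mulmxA mulmxV // mul1mx mulmxK.
Qed.

Lemma conj_root v k : norm_h v -> k \in Phi -> exists2 k', k' \in Phi &
  (forall A, h A -> wt k' (v *m A *m invmx v) = wt k A) /\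
  exists c, v *m X_ k *m invmx v = c *: X_ k'.
Proof.
move=> nv kP; have vU := norm_h_unit nv; have [Gv v1 v2] := nv.
set B := v *m X_ k *m invmx v.
have gB : g B by apply: lie_conj; [exact: grp_subgroup| |exact: g_X].
have eB A : h A -> bracket A B = wt k (invmx v *m A *m v) *: B.
  move=> hA; have {1}-> : A = v *m (invmx v *m A *m v) *m invmx v.
    by rewrite !mulmxA mulmxV // mul1mx mulmxK.
  by rewrite bracket_conj // bracket_hX -?scalemxAr -?scalemxAl //; apply: v2.
have wtv A : wt k (invmx v *m (v *m A *m invmx v) *m v) = wt k A.
  by rewrite !mulmxA mulVmx // mul1mx mulmxKV.
have nB : B != 0.
  apply/eqP => B0; have /eqP := X_neq0 kP; apply.
  have -> : X_ k = invmx v *m B *m v by rewrite /B !mulmxA mulVmx // mul1mx mulmxKV.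
  by rewrite B0 mulmx0 mul0mx.
have rB : is_root g h (fun A => wt k (invmx v *m A *m v)).
  split; last by exists B.
  have [A hA nz] := wt_neq0 charC S (root_neq0 kP).
  by exists (v *m A *m invmx v); [apply: v1|rewrite wtv].
have [k' k'P e] := is_root_in_roots rB.
exists k' => //; split=> [A hA|]; first by rewrite -e ?wtv //; apply: v1.
exists (coordX S k' B); apply: root_space_line => //; split=> // A hA.
by rewrite eB // e.
Qed.

Section SimpleReflection.
Variable i : 'I_l.
Let e := X_ (delta_mx 0 i).
Let f := X_ (- delta_mx 0 i).

Let eP : delta_mx 0 i \in Phi. Proof. exact: simple_root_in. Qed.
Let fP : - delta_mx 0 i \in Phi. Proof. exact: opp_simple_root_in. Qed.

Lemma simple_bracket : bracket e f = H_ i.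
Proof. by have [_ _ _ HE _] := chevalleyP S; rewrite HE. Qed.

Lemma bracket_h_e A : h A -> bracket A e = alpha i A *: e.
Proof. by move=> hA; rewrite bracket_hX // wt_delta. Qed.

Lemma bracket_h_f A : h A -> bracket A f = - alpha i A *: f.
Proof. by move=> hA; rewrite bracket_hX // wtN wt_delta. Qed.

Lemma bracket_e_h A : h A -> bracket e A = - alpha i A *: e.
Proof. by move=> hA; rewrite bracket_anti bracket_h_e // scaleNr. Qed.

Lemma bracket_f_h A : h A -> bracket f A = alpha i A *: f.
Proof. by move=> hA; rewrite bracket_anti bracket_h_f // scaleNr opprK. Qed.

(** [alpha i] is given as a mere function on matrices; its linearity on h is read off from the
    bracket with [e]. *)
Lemma alphaP a A B : h A -> h B -> alpha i (a *: A + B) = a * alpha i A + alpha i B.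
Proof.
move=> hA hB; have hS : h (a *: A + B) by apply: lieD => //; apply: lieZ.
apply/eqP; rewrite -subr_eq0; have := X_neq0 eP; rewrite -/e.
have : (alpha i (a *: A + B) - (a * alpha i A + alpha i B)) *: e = 0.
  rewrite scalerBl scalerDl -scalerA -!bracket_h_e // bracketDl bracketZl subrr //.
by move/eqP; rewrite scaler_eq0 => /orP[//|/eqP ->]; rewrite eqxx.
Qed.

(* The Weyl element exp(e) exp(-f) exp(e) of the SL_2-triple (e, H_i, f). *)
Lemma simple_repr : exists v, norm_h v /\
  forall A, h A -> v *m A *m invmx v = A - alpha i A *: H_ i.
Proof.
have two0 : 2%:R != 0 :> C by rewrite natf_eq0.
have hH : h (H_ i) := @h_H C n l m S i.
have aH : alpha i (H_ i) = 2%:R := @alpha_H C n l m S i.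
have e0 : e ^+ n = 0 := X_nilpotent charC eP.
have f0 : (- f) ^+ n = 0.
  by rewrite -scaleN1r expmxZ (X_nilpotent charC fP) scaler0.
pose E1 := mxexp e; pose E2 := mxexp (- f).
have E1A A : h A -> E1 *m A = (A - alpha i A *: e) *m E1.
  move=> hA; rewrite (mxexp_mul charC (d := 2) e0).
    by rewrite big_ord_recl big_ord1 /= invr1 scale1r (bracket_e_h hA) scaleNr.
  by rewrite /= invr1 scale1r (bracket_e_h hA) bracketZr bracketxx !scaler0.
have E2A A : h A -> E2 *m A = (A - alpha i A *: f) *m E2.
  move=> hA; rewrite (mxexp_mul charC (d := 2) f0).
    by rewrite big_ord_recl big_ord1 /= invr1 scale1r bracketNl (bracket_f_h hA).
  rewrite /= invr1 scale1r !bracketNl (bracket_f_h hA) bracketNr bracketZr bracketxx.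
  by rewrite scaler0 !oppr0 scaler0.
(* Here [ad(-f)] sends [e] to [H_i] and [H_i] to [-2 f], which the coefficient 1/2 turns into [-f];
   the next bracket is zero, hence three terms. *)
have E2e : E2 *m e = (e + H_ i - f) *m E2.
  have a1 : bracket (- f) e = H_ i by rewrite bracketNl bracket_anti opprK simple_bracket.
  have a2 : 2%:R^-1 *: bracket (- f) (H_ i) = - f.
    by rewrite bracketNl bracket_f_h // aH scalerN scalerA mulVf // scale1r.
  rewrite (mxexp_mul charC (d := 3) f0).
    by rewrite !big_ord_recl big_ord0 addr0 /= invr1 scale1r a1 a2 addrA.
  by rewrite /= invr1 scale1r a1 a2 bracketxx scaler0.
pose v := E1 *m E2 *m E1.
have E1U : E1 \in unitmx by apply: mxexp_unit.
have E2U : E2 \in unitmx by apply: mxexp_unit.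
have vU : v \in unitmx by rewrite !unitmx_mul E1U E2U.
have vE A : h A -> v *m A *m invmx v = A - alpha i A *: H_ i.
  move=> hA; suff -> : v *m A = (A - alpha i A *: H_ i) *m v by rewrite mulmxK.
  rewrite /v -[E1 *m E2 *m E1 *m A]mulmxA (E1A A hA) [E1 *m E2 *m (_ *m _)]mulmxA.
  rewrite -[E1 *m E2 *m (A - _)]mulmxA mulmxBr -scalemxAr E2A // E2e.
  rewrite scalemxAl -mulmxBl.
  have -> : A - alpha i A *: f - alpha i A *: (e + H_ i - f) = A - alpha i A *: H_ i - alpha i A *: e.
    by move: f (H_ i) => f' H'; apply/matrixP => a b; rewrite !mxE; ring.
  rewrite !mulmxA; do 2! congr (_ *m _).
  rewrite !mulmxBr -!scalemxAr (E1A A hA) (E1A _ hH) aH.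
  have -> : E1 *m e = e *m E1.
    rewrite (mxexp_mul charC (d := 1) e0) ?big_ord1 //.
    by rewrite /= bracketxx scaler0.
  rewrite !scalemxAl -!mulmxBl; congr (_ *m _).
  by move: e (H_ i) => e' H'; apply/matrixP => a b; rewrite !mxE; ring.
have sh A : h A -> h (A - alpha i A *: H_ i).
  by move=> hA; apply: lieD => //; rewrite -scaleNr; apply: lieZ.
exists v; split=> //; split=> [|A hA|A hA].
- have aG := grp_alg S; have [_ _ GM _] := grp_subgroup S.
  have GE : G E1 by rewrite /E1 -[e]scale1r; apply: exp_in_group => //; apply: g_X.
  apply: (GM) => //; apply: GM => //.
  by rewrite /E2 -scaleN1r; apply: exp_in_group; rewrite ?X_nilpotent //; apply: g_X.
- by rewrite vE //; apply: sh.
- have hs := sh A hA; have := vE _ hs.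
  have -> : alpha i (A - alpha i A *: H_ i) = - alpha i A.
    by rewrite -scaleNr addrC alphaP // aH; ring.
  rewrite scaleNr opprK subrK => e1; suff -> : invmx v *m A *m v = A - alpha i A *: H_ i by [].
  exact: conj_invmx.
Qed.
End SimpleReflection.

End WeylGroup.

(** * Words in the simple reflections and the longest element *)

Section LongestElement.
Variables (C : closedFieldType) (charC : [pchar C] =i pred0).
Variables (n l m : nat) (S : group_data C n l m).

Local Notation G := (grp S).
Local Notation T := (max_torus S).
Local Notation g := (lie idfun G).
Local Notation h := (lie idfun T).
Local Notation alpha := (simple_root S).
Local Notation Phi := (Defs.roots S).
Local Notation H_ := (chev_H S).
Local Notation X_ := (chev_X S).
Local Notation wt := (root_of alpha).
Local Notation wact := (word_act alpha H_).

Lemma wtP k a A B : k \in Phi -> h A -> h B -> wt k (a *: A + B) = a * wt k A + wt k B.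
Proof.
move=> kP hA hB; have hS : h (a *: A + B) by apply: lieD => //; apply: lieZ.
apply/eqP; rewrite -subr_eq0; have := X_neq0 kP.
have : (wt k (a *: A + B) - (a * wt k A + wt k B)) *: X_ k = 0.
  by rewrite scalerBl scalerDl -scalerA -!bracket_hX // bracketDl bracketZl subrr.
by move/eqP; rewrite scaler_eq0 => /orP[//|/eqP ->]; rewrite eqxx.
Qed.

Lemma wtZ (c : int) k A : wt (c *: k) A = c%:~R * wt k A.
Proof.
by rewrite /root_of mulr_sumr; apply: eq_bigr => i _; rewrite mxE rmorphM mulrA.
Qed.

(** Realizing a word by conjugation inside G yields at once that it acts linearly and bijectively on
    h and permutes the roots. *)
Lemma word_repr w : exists v, norm_h S v /\ forall A, h A -> v *m A *m invmx v = wact w A.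
Proof.
elim: w => [|i w [v [nv Ev]]].
  by exists 1%:M; split=> [|A _]; [apply: norm_h_1|rewrite invmx1 mul1mx mulmx1].
have [u [nu Eu]] := simple_repr charC S i.
exists (u *m v); split=> [|A hA]; first exact: norm_h_mul.
have [_ v1 _] := nv; rewrite invmx_mul ?(norm_h_unit nu) ?(norm_h_unit nv) //.
have -> : u *m v *m A *m (invmx v *m invmx u) = u *m (v *m A *m invmx v) *m invmx u.
  by rewrite !mulmxA.
by rewrite Eu ?Ev //; have := v1 _ hA; rewrite Ev.
Qed.

Lemma wact_h w A : h A -> h (wact w A).
Proof. by move=> hA; have [v [[_ v1 _] <-]] := word_repr w; last by []; apply: v1. Qed.

Lemma wact_surj w A : h A -> exists2 B, h B & wact w B = A.
Proof.
move=> hA; have [v [nv Ev]] := word_repr w; have [_ _ v2] := nv.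
exists (invmx v *m A *m v); first exact: v2.
rewrite -Ev; last exact: v2.
by rewrite !mulmxA mulmxV ?(norm_h_unit nv) // mul1mx mulmxK // (norm_h_unit nv).
Qed.

Lemma wact_cat w1 w2 A : wact (w1 ++ w2) A = wact w1 (wact w2 A).
Proof. by rewrite /word_act foldr_cat. Qed.

Lemma wactP w a A B : h A -> h B -> wact w (a *: A + B) = a *: wact w A + wact w B.
Proof.
move=> hA hB; have [v [nv Ev]] := word_repr w.
rewrite -!Ev //; last by apply: lieD => //; apply: lieZ.
by rewrite mulmxDr mulmxDl -scalemxAr -scalemxAl.
Qed.

Lemma wact_root w k : k \in Phi ->
  exists2 k', k' \in Phi & forall A, h A -> wt k' (wact w A) = wt k A.
Proof.
move=> kP; have [v [nv Ev]] := word_repr w.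
by have [k' k'P [e _]] := conj_root charC nv kP; exists k' => // A hA; rewrite -Ev // e.
Qed.

Lemma wact_root_inv w k : k \in Phi ->
  exists2 k', k' \in Phi & forall A, h A -> wt k (wact w A) = wt k' A.
Proof.
move=> kP; have [v [nv Ev]] := word_repr w; have [_ v1 _] := nv.
have [k' k'P [e _]] := conj_root charC (norm_h_inv nv) kP; exists k' => // A hA.
rewrite -Ev // -e ?invmxK; last exact: v1.
by rewrite !mulmxA mulVmx ?(norm_h_unit nv) // mul1mx mulmxKV // (norm_h_unit nv).
Qed.

(** Conjugation by a representative sends the root vectors of [alpha_i] and its negative to
    multiples of those of [alpha_j] and its negative, hence [H_i] to a multiple of [H_j]. The
    multiple is 1 because [alpha_j] takes the value 2 on both. *)
Lemma coroot_wact w i j : (forall A, h A -> alpha j (wact w A) = alpha i A) ->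
  wact w (H_ i) = H_ j.
Proof.
move=> e; have [v [nv Ev]] := word_repr w; have vU := norm_h_unit nv.
have iP := simple_root_in S i; have niP := opp_simple_root_in charC S i.
have [k1 k1P [e1 [c1 E1]]] := conj_root charC nv iP.
have [k2 k2P [e2 [c2 E2]]] := conj_root charC nv niP.
have k1E : k1 = delta_mx 0 j.
  apply: (wt_inj charC (S := S)) => A /(wact_surj w) [B hB <-].
  by rewrite -{1}Ev // e1 // !wt_delta e.
have k2E : k2 = - delta_mx 0 j.
  apply: (wt_inj charC (S := S)) => A /(wact_surj w) [B hB <-].
  by rewrite -{1}Ev // e2 // !wtN !wt_delta e.
have HE : wact w (H_ i) = (c1 * c2) *: H_ j.
  rewrite -Ev; last exact: h_H.
  have [_ _ _ HE _] := chevalleyP S; rewrite HE -bracket_conj // E1 E2 k1E k2E.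
  by rewrite bracketZl bracketZr scalerA -HE.
have := e _ (@h_H _ _ _ _ S i); rewrite alpha_H {1}HE.
have two0 : 2%:R != 0 :> C by rewrite natf_eq0.
rewrite -[_ *: _]addr0 -wt_delta wtP ?simple_root_in //; last first.
- by rewrite -(scale0r (H_ j)); apply/lieZ/h_H.
- exact: h_H.
rewrite wt_delta alpha_H (_ : wt _ 0 = 0); last first.
  have := @wtP (delta_mx 0 j) 0 (H_ j) (H_ j) (simple_root_in S j) (@h_H _ _ _ _ S j) (@h_H _ _ _ _ S j).
  have := @wtP (delta_mx 0 j) (-1) (H_ j) (H_ j) (simple_root_in S j) (@h_H _ _ _ _ S j) (@h_H _ _ _ _ S j).
  by rewrite scaleN1r addNr mulN1r addNr.
rewrite addr0 -[RHS]mul1r => /(mulIf two0) ec.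
by rewrite HE ec scale1r.
Qed.

Lemma simple_reflK i A : h A -> wact [:: i; i] A = A.
Proof.
move=> hA; rewrite /= -!wt_delta.
have -> : A - wt (delta_mx 0 i) A *: H_ i = - wt (delta_mx 0 i) A *: H_ i + A.
  by rewrite scaleNr addrC.
rewrite wtP ?simple_root_in //; last exact: h_H.
rewrite !wt_delta alpha_H; apply/matrixP => a b; rewrite !mxE; ring.
Qed.

Lemma nonneg_coordsP (k : 'rV[int]_l) : reflect (forall i, 0 <= k 0 i) (nonneg_coords k).
Proof. exact: forallP. Qed.

Lemma nonneg_opp (k : 'rV[int]_l) : k \in Phi -> nonneg_coords k -> ~~ nonneg_coords (- k).
Proof.
move=> kP /nonneg_coordsP k0; apply/negP => /nonneg_coordsP nk0.
case/eqP: (root_neq0 kP); apply/rowP => i; rewrite mxE; apply: le_anti.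
by rewrite k0 -oppr_ge0; have := nk0 i; rewrite mxE => ->.
Qed.

(** Reading the word from the right, [alpha_i] starts positive and ends non-positive, so some letter
    [j] reverses the sign of the current root. As [s_j] alters only the [j]-th coordinate, that root
    is a multiple of [alpha_j], and in fact [alpha_j] itself. *)
Lemma exchange_walk v i k' : k' \in Phi ->
  (forall A, h A -> wt k' (wact v A) = alpha i A) -> ~~ nonneg_coords k' ->
  exists v1 j v2, v = v1 ++ j :: v2 /\
    forall A, h A -> alpha j (wact v2 A) = alpha i A.
Proof.
elim: v k' => [|j v IH] k' k'P e nk'.
  case/negP: nk'; have -> : k' = delta_mx 0 i.
    by apply: (wt_inj charC (S := S)) => A hA; rewrite e // wt_delta.
  by apply/nonneg_coordsP => a; rewrite mxE; case: (_ && _).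
have [k1 k1P e1] := wact_root v (simple_root_in S i).
case: (boolP (nonneg_coords k1)) => [k1_ge0|nk1]; last first.
  have [|v1 [j' [v2 [-> H]]]] := IH k1 k1P _ nk1.
    by move=> A hA; rewrite e1 // wt_delta.
  by exists (j :: v1), j', v2.
(* [k1] and [k'] differ by [wt k' (H_ j)] times [alpha_j]; the simple roots being independent, all
   other coordinates agree. *)
have off a : a != j -> k' 0 a = k1 0 a.
  move=> aj; apply/eqP; rewrite -subr_eq0 -(intr_eq0_char0 charC); apply/eqP.
  have [indep _ _ _ _] := Defs.rootsP S.
  have := indep (fun b => (k' 0 b - k1 0 b)%:~R - (b == j)%:R * wt k' (H_ j)).
  move=> /(_ _ a); rewrite (negPf aj) mul0r subr0; apply.
  move=> A /(wact_surj v) [B hB <-]; have hv := wact_h v hB.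
  transitivity (wt k' (wact v B) - wt k1 (wact v B) - alpha j (wact v B) * wt k' (H_ j)).
    under eq_bigr => b _ do rewrite mulrBl rmorphB mulrBl.
    rewrite !sumrB; congr (_ - _ - _).
    rewrite (bigD1 j) //= eqxx mul1r big1 => [|b /negPf ->]; last by rewrite !mul0r.
    by rewrite addr0 mulrC.
  rewrite e1 // wt_delta -e //= -[wact v B - _]addrC -scaleNr wtP //; last exact: h_H.
  by ring.
have nk'_ge0 : nonneg_coords (- k').
  by have := root_sign charC k'P; rewrite (negPf nk').
have k1E : k1 = k1 0 j *: delta_mx 0 j.
  apply/rowP => a; rewrite !mxE /=; case: (eqVneq a j) => [->|aj]; first by rewrite mulr1.
  rewrite mulr0; apply: le_anti; rewrite (nonneg_coordsP _ k1_ge0) -off //.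
  by have := nonneg_coordsP _ nk'_ge0 a; rewrite mxE oppr_ge0 => ->.
(* Pulling [alpha_j] back along [v] gives a root [k2] with [k1_j k2 = alpha_i]. Its coordinates are
   integers, so [k1_j] divides 1. *)
have [k2 k2P e2] := wact_root_inv v (simple_root_in S j).
have ck2 : k1 0 j *: k2 = delta_mx 0 i.
  apply: (wt_inj charC (S := S)) => A hA.
  by rewrite wtZ -e2 // -wtZ -k1E e1.
have /rowP/(_ i) := ck2; rewrite !mxE !eqxx /= => c1.
have k1j : k1 0 j = 1.
  have := nonneg_coordsP _ k1_ge0 j; move: c1; case: (k1 0 j) => [c|c] // c1 _.
  move: c1 => /(congr1 (fun z : int => `|z|%N)); rewrite abszM /= => /eqP.
  by rewrite muln_eq1 => /andP[/eqP -> _].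
exists [::], j, v; split=> // A hA.
by rewrite -wt_delta -[delta_mx 0 j]scale1r -k1j -k1E e1 // wt_delta.
Qed.

Lemma reduced_word_exists w : exists2 w', reduced_word h alpha H_ w' &
  forall A, h A -> wact w' A = wact w A.
Proof.
pose P k := `[< exists w', size w' = k /\ forall A, h A -> wact w' A = wact w A >].
have exP : exists k, P k by exists (size w); apply/asboolP; exists w.
case: (ex_minnP exP) => k /asboolP [w' [sw' e]] kmin; exists w' => // w'' e''.
by rewrite sw'; apply: kmin; apply/asboolP; exists w''; split=> // A hA; rewrite e'' // e.
Qed.

(* The exchange argument: if w alpha_i were positive, a reduced word for w s_i,
   not longer than w, would contain a letter that can be struck out to give a
   shorter word for w. *)
Lemma longest_neg w i k' : longest_word h alpha H_ w -> k' \in Phi ->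
  (forall A, h A -> wt k' (wact w A) = alpha i A) -> ~~ nonneg_coords k'.
Proof.
move=> [redw longw] k'P e; apply/negP => k'_ge0.
have [w' redw' Ew'] := reduced_word_exists (w ++ [:: i]).
have iP := simple_root_in S i.
have hs A : h A -> h (wact [:: i] A) by apply: wact_h.
have as_ A : h A -> alpha i (wact [:: i] A) = - alpha i A.
  move=> hA; rewrite /= -scaleNr addrC -!wt_delta wtP //; last exact: h_H.
  by rewrite !wt_delta alpha_H; ring.
have [k3 k3P e3] := wact_root w' iP.
have k3E : k3 = - k'.
  apply: (wt_inj charC (S := S)) => A /(wact_surj w') [B hB <-].
  rewrite e3 // wtN Ew' // wact_cat e; last exact: hs.
  by rewrite as_ // opprK wt_delta.
have nk3 : ~~ nonneg_coords k3 by rewrite k3E nonneg_opp.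
have e3' A : h A -> wt k3 (wact w' A) = alpha i A by move=> hA; rewrite e3 // wt_delta.
have [v1 [j [v2 [w'E ej]]]] := exchange_walk k3P e3' nk3.
have HE := coroot_wact ej.
(* [alpha_j v2 = alpha_i] and [v2 H_i = H_j] give [s_j v2 = v2 s_i]. Hence [v1 v2 = v1 s_j v2 s_i =
   w' s_i = w s_i s_i = w], by a word shorter than [w']. *)
have short A : h A -> wact (v1 ++ v2) A = wact w A.
  move=> hA; have hsA := hs A hA.
  have v2E B : h B -> wact (j :: v2) B = wact v2 (wact [:: i] B).
    move=> hB; have -> : wact [:: i] B = - alpha i B *: H_ i + B.
      by rewrite /= scaleNr addrC.
    by rewrite wactP //; [rewrite HE addrC scaleNr /= ej|apply: h_H].
  rewrite -[in LHS](simple_reflK i hA) -[wact [:: i; i] A]/(wact [:: i] (wact [:: i] A)).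
  rewrite wact_cat -v2E // -wact_cat -w'E Ew' // wact_cat.
  by rewrite -[wact [:: i] (wact [:: i] A)]/(wact [:: i; i] A) simple_reflK.
have := redw _ short; have := longw _ redw'.
by rewrite w'E !size_cat /= addnS => /leq_trans /[apply]; rewrite ltnn.
Qed.

(** The images of the simple roots are non-positive by [longest_neg], and a combination of them with
    non-positive coefficients is non-negative. *)
Lemma weyl_root_neg k k' : k \in Phi -> k' \in Phi ->
  (forall A, h A -> wt k' (weyl_repr S *m A *m invmx (weyl_repr S)) = wt k A) ->
  nonneg_coords (- k) -> nonneg_coords k'.
Proof.
move=> kP k'P e nk; have [_ _ [w lw Ew]] := weyl_reprP S.
have {}e A : h A -> wt k' (wact w A) = wt k A by move=> hA; rewrite -Ew // e.
have /choice [f Hf] : forall i, exists ki, ki \in Phi /\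
    forall A, h A -> wt ki (wact w A) = alpha i A.
  move=> i; have [ki kiP ei] := wact_root w (simple_root_in S i).
  by exists ki; split=> // A hA; rewrite ei // wt_delta.
have k'E : k' = \sum_i k 0 i *: f i.
  apply: (wt_inj charC (S := S)) => A /(wact_surj w) [B hB <-]; rewrite e //.
  transitivity (\sum_i wt (k 0 i *: f i) (wact w B)).
    by apply: eq_bigr => i _; rewrite wtZ; have [_ ->] := Hf i.
  elim/big_rec2: _ => [|i y1 y2 _ IH]; first by rewrite wt0.
  by rewrite wtD -IH.
apply/nonneg_coordsP => a; rewrite k'E summxE; apply: sumr_ge0 => i _.
have [fP fE] := Hf i; have := longest_neg lw fP fE => nf.
have := root_sign charC fP; rewrite (negPf nf) /= => /nonneg_coordsP/(_ a).
have := nonneg_coordsP _ nk i; rewrite !mxE !oppr_ge0 => h1 h2.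
exact: mulr_le0.
Qed.

Lemma weyl_conj_neg k j : k \in Phi -> nonneg_coords (- k) -> j \in Phi ->
  nonneg_coords (- j) ->
  coordX S j (weyl_repr S *m X_ k *m invmx (weyl_repr S)) = 0.
Proof.
move=> kP nk jP nj.
have [k' k'P [e [c ->]]] := conj_root charC (norm_h_weyl S) kP.
rewrite coordXZ coordXX //; case: eqP => [jk|_]; last by rewrite mulr0.
have := weyl_root_neg kP k'P e nk; rewrite -jk => /(nonneg_opp jP).
by rewrite nj.
Qed.

End LongestElement.

(** * Unipotent elements over E *)

Section LiftFunctional.
Variables (C E : fieldType) (iota : {rmorphism C -> E}) (n : nat).

(** The [E]-linear extension of [f]. Being a combination of the matrix entries with constant
    coefficients, it takes values in any subfield that contains the constants and the entries, even
    on matrices outside the span of the Lie algebra. *)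
Definition lift_fun (f : 'M[C]_n -> C) (A : 'M[E]_n) : E :=
  \sum_i \sum_j iota (f (delta_mx i j)) * A i j.

Lemma lift_funD f A B : lift_fun f (A + B) = lift_fun f A + lift_fun f B.
Proof.
rewrite /lift_fun -big_split; apply: eq_bigr => i _; rewrite -big_split.
by apply: eq_bigr => j _; rewrite mxE mulrDr.
Qed.

Lemma lift_funZ f a A : lift_fun f (a *: A) = a * lift_fun f A.
Proof.
rewrite /lift_fun mulr_sumr; apply: eq_bigr => i _; rewrite mulr_sumr.
by apply: eq_bigr => j _; rewrite mxE mulrCA.
Qed.

Lemma lift_fun0 f : lift_fun f 0 = 0.
Proof. by rewrite -(scale0r 0) lift_funZ mul0r. Qed.

Lemma lift_funB f A B : lift_fun f (A - B) = lift_fun f A - lift_fun f B.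
Proof. by rewrite lift_funD -scaleN1r lift_funZ mulN1r. Qed.

Lemma lift_fun_sum f I (r : seq I) (P : pred I) F :
  lift_fun f (\sum_(i <- r | P i) F i) = \sum_(i <- r | P i) lift_fun f (F i).
Proof. by elim/big_rec2: _ => [|i y1 y2 _ <-]; rewrite ?lift_fun0 ?lift_funD. Qed.

Lemma lift_fun_iota (f : {linear 'M[C]_n -> C^o}) A :
  lift_fun f (map_mx iota A) = iota (f A).
Proof.
rewrite {2}(matrix_sum_delta A) linear_sum rmorph_sum; apply: eq_bigr => i _.
rewrite linear_sum rmorph_sum; apply: eq_bigr => j _.
by rewrite linearZ mxE rmorphM mulrC.
Qed.

End LiftFunctional.

Section NegativeSpan.
Variables (C : closedFieldType) (charC : [pchar C] =i pred0).
Variables (n l m : nat) (S : group_data C n l m).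
Variables (E : fieldType) (iota : {rmorphism C -> E}).

Local Notation h := (lie idfun (max_torus S)).
Local Notation alpha := (simple_root S).
Local Notation Phi := (Defs.roots S).
Local Notation H_ := (chev_H S).
Local Notation X_ := (chev_X S).
Local Notation wt := (root_of alpha).
Local Notation beta := (neg_root S).
Local Notation "A ^E" := (map_mx iota A) (at level 2, format "A ^E").

Let charE : [pchar E] =i pred0.
Proof. by move=> i; rewrite (fmorph_pchar iota). Qed.

Lemma neg_root_mem k : (k \in codom beta) = (k \in Phi) && nonneg_coords (- k).
Proof. by rewrite (perm_mem (neg_rootP S)) mem_filter andbC. Qed.

Lemma neg_root_in i : beta i \in Phi.
Proof. by have := codom_f beta i; rewrite neg_root_mem => /andP[]. Qed.

Lemma neg_root_nonneg i : nonneg_coords (- beta i).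
Proof. by have := codom_f beta i; rewrite neg_root_mem => /andP[]. Qed.

Lemma neg_root_inj : injective beta.
Proof.
apply/injectiveP; change (uniq (codom beta)).
by rewrite (perm_uniq (neg_rootP S)) filter_uniq // uniq_roots_seq.
Qed.

Lemma ht_neg_root i : ht (beta i) < 0.
Proof.
have b0 := root_neq0 (neg_root_in i); have /nonneg_coordsP nb := neg_root_nonneg i.
have le0 a : beta i 0 a <= 0 by have := nb a; rewrite mxE oppr_ge0.
rewrite lt_neqAle sumr_le0 // andbT; apply: contraNneq b0 => ht0.
apply/eqP/rowP => a; rewrite mxE; apply/eqP.
have /eqP : - ht (beta i) = 0 by rewrite ht0 oppr0.
rewrite /ht -sumrN psumr_eq0 => [|b _]; last by rewrite oppr_ge0.
by move/allP/(_ a (mem_index_enum a)); rewrite oppr_eq0.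
Qed.

Definition NE i : 'M[E]_n := (X_ (beta i))^E.
Definition coordN i : 'M[E]_n -> E := lift_fun iota (coordX S (beta i)).

Lemma coordND i Z W : coordN i (Z + W) = coordN i Z + coordN i W.
Proof. exact: lift_funD. Qed.

Lemma coordN_combination i (J : finType) (a : J -> E) Z :
  coordN i (\sum_j a j *: Z j) = \sum_j a j * coordN i (Z j).
Proof. by rewrite /coordN lift_fun_sum; apply: eq_bigr => j _; rewrite lift_funZ. Qed.

Lemma coordN_iota i A : coordN i A^E = iota (coordX S (beta i) A).
Proof. exact: (lift_fun_iota iota (dual_coord (chev_seq S) (X_ (beta i)))). Qed.

Lemma coordN_NE i j : coordN i (NE j) = (i == j)%:R.
Proof.
by rewrite coordN_iota coordXX ?neg_root_in // (inj_eq neg_root_inj) rmorph_nat.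
Qed.

Lemma bracketE (A B : 'M[C]_n) : bracket A^E B^E = (bracket A B)^E.
Proof. by rewrite /bracket map_mxB !map_mxM. Qed.

(** The span of the negative root vectors from index [k] on: all of u^- at [k = 0], zero at [k = m].
    This filtration carries the triangularity arguments below. *)
Definition negspan k (Z : 'M[E]_n) : Prop :=
  exists c : 'I_m -> E, (forall i : 'I_m, (i < k)%N -> c i = 0) /\ Z = \sum_i c i *: NE i.

Lemma negspan0 k : negspan k 0.
Proof. by exists (fun=> 0); split=> //; rewrite big1 // => i _; rewrite scale0r. Qed.

Lemma negspanD k Z W : negspan k Z -> negspan k W -> negspan k (Z + W).
Proof.
move=> [c [c0 ->]] [d [d0 ->]]; exists (fun i => c i + d i); split=> [i ik|].
  by rewrite c0 // d0 // addr0.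
by rewrite -big_split; apply: eq_bigr => i _; rewrite scalerDl.
Qed.

Lemma negspanZ k a Z : negspan k Z -> negspan k (a *: Z).
Proof.
move=> [c [c0 ->]]; exists (fun i => a * c i); split=> [i ik|].
  by rewrite c0 // mulr0.
by rewrite scaler_sumr; apply: eq_bigr => i _; rewrite scalerA.
Qed.

Lemma negspanB k Z W : negspan k Z -> negspan k W -> negspan k (Z - W).
Proof. by move=> hZ hW; apply: negspanD => //; rewrite -scaleN1r; apply: negspanZ. Qed.

Lemma negspan_sum k I (r : seq I) (P : pred I) F :
  (forall i, P i -> negspan k (F i)) -> negspan k (\sum_(i <- r | P i) F i).
Proof.
by move=> H; elim/big_ind: _ => //; [apply: negspan0|move=> *; apply: negspanD].
Qed.

Lemma negspan_le k k' Z : (k <= k')%N -> negspan k' Z -> negspan k Z.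
Proof.
by move=> kk' [c [c0 ->]]; exists c; split=> // i ik; apply/c0/(leq_trans ik).
Qed.

Lemma negspan_NE (i : 'I_m) : negspan i (NE i).
Proof.
exists (fun j => (j == i)%:R); split=> [j|].
  by case: eqP => // ->; rewrite ltnn.
by rewrite (bigD1 i) //= eqxx scale1r big1 ?addr0 // => j /negPf ->; rewrite scale0r.
Qed.

Lemma negspan_coord k Z : negspan k Z -> Z = \sum_i coordN i Z *: NE i.
Proof.
move=> [c [_ ->]]; apply: eq_bigr => i _; congr (_ *: _).
rewrite /coordN lift_fun_sum (bigD1 i) //= lift_funZ -/(coordN _ _) coordN_NE eqxx mulr1.
rewrite big1 ?addr0 // => j /negPf ji.
by rewrite lift_funZ -/(coordN _ _) coordN_NE eq_sym ji mulr0.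
Qed.

Lemma negspan_coord0 k Z (i : 'I_m) : negspan k Z -> (i < k)%N -> coordN i Z = 0.
Proof.
move=> [c [c0 ->]] ik; rewrite /coordN lift_fun_sum big1 // => j _.
rewrite lift_funZ -/(coordN _ _) coordN_NE; case: eqP => [<-|]; last by rewrite mulr0.
by rewrite c0 // mul0r.
Qed.

Lemma negspan_m Z : negspan m Z -> Z = 0.
Proof. by move=> [c [c0 ->]]; rewrite big1 // => i _; rewrite c0 ?scale0r. Qed.

(** If [beta_j + beta_i] is a root, its height is strictly below that of [beta_i], so the numbering
    places it after [i]. *)
Lemma negspan_bracket_NE (i j : 'I_m) : negspan i.+1 (bracket (NE j) (NE i)).
Proof.
have jP := neg_root_in j; have iP := neg_root_in i.
have nji : nonneg_coords (- (beta j + beta i)).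
  apply/nonneg_coordsP => a; rewrite mxE mxE opprD addr_ge0 //.
    by have /nonneg_coordsP/(_ a) := neg_root_nonneg j; rewrite mxE.
  by have /nonneg_coordsP/(_ a) := neg_root_nonneg i; rewrite mxE.
have ji0 : beta j + beta i != 0.
  apply/eqP => e; have : ht (beta j + beta i) = ht (beta j) + ht (beta i).
    by rewrite /ht -big_split; apply: eq_bigr => a _; rewrite mxE.
  rewrite e {1}/ht big1 => [|a _]; last by rewrite mxE.
  by move=> e'; have := ltrD (ht_neg_root j) (ht_neg_root i); rewrite -e' addr0 ltxx.
rewrite bracketE bracket_roots //; case: ifP => [jiP|_]; last first.
  by rewrite map_mx0; apply: negspan0.
have : beta j + beta i \in codom beta by rewrite neg_root_mem jiP.
case/codomP => t e; rewrite map_mxZ e; apply: negspanZ.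
apply: negspan_le (negspan_NE t); rewrite ltnNge; apply/negP => ti.
have := neg_root_ht S ti; rewrite -e.
have -> : ht (beta j + beta i) = ht (beta j) + ht (beta i).
  by rewrite /ht -big_split; apply: eq_bigr => a _; rewrite mxE.
by rewrite leNgt -ltrBrDr subrr ht_neg_root.
Qed.

Lemma negspan_bracket k j Z : negspan k Z -> negspan k.+1 (bracket (NE j) Z).
Proof.
move=> [c [c0 ->]]; rewrite bracket_sumr; apply: negspan_sum => i _; rewrite bracketZr.
case: (ltnP i k) => ik; first by rewrite c0 // scale0r; apply: negspan0.
by apply/negspanZ/negspan_le/negspan_bracket_NE.
Qed.

Lemma NE_nilpotent i a : (a *: NE i) ^+ n = 0.
Proof.
by rewrite expmxZ /NE -rmorphXn /= (X_nilpotent charC (neg_root_in i)) map_mx0 scaler0.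
Qed.

Definition expN a i : 'M[E]_n := mxexp (a *: NE i).

Lemma expN_unit a i : expN a i \in unitmx.
Proof. exact/mxexp_unit/NE_nilpotent. Qed.

Lemma expN_comm a i : expN a i *m NE i = NE i *m expN a i.
Proof.
rewrite /expN (mxexp_mul charE (d := 1) (NE_nilpotent i a)) ?big_ord1 //.
by rewrite /= bracketZl bracketxx !scaler0.
Qed.

Lemma negspan_ad_term a j k Z r : negspan k Z -> negspan (k + r) (ad_term (a *: NE j) Z r).
Proof.
move=> hZ; elim: r => [|r IH] /=; first by rewrite addn0.
by rewrite bracketZl addnS; do 2! apply: negspanZ; apply: negspan_bracket.
Qed.

(** Conjugation by [v] preserves the filtration and is the identity on its successive quotients. *)
Definition unitri (v : 'M[E]_n) : Prop := v \in unitmx /\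
  forall k Z, negspan k Z -> negspan k.+1 (v *m Z *m invmx v - Z).

Lemma unitri_conj v k Z : unitri v -> negspan k Z -> negspan k (v *m Z *m invmx v).
Proof.
move=> [_ tv] hZ; rewrite -[v *m Z *m _](subrK Z); apply: negspanD => //.
exact: negspan_le (leqnSn k) (tv _ _ hZ).
Qed.

Lemma unitri_expN a i : unitri (expN a i).
Proof.
split=> [|k Z hZ]; first exact: expN_unit.
have Zm : ad_term (a *: NE i) Z m.+1 = 0.
  have := negspan_ad_term a i m.+1 hZ; rewrite addnC => /negspan_le h'.
  exact/negspan_m/h'/leqW/leq_addr.
rewrite /expN (mxexp_mul charE (NE_nilpotent i a) Zm) mulmxK ?expN_unit //.
rewrite big_ord_recl addrC addKr; apply: negspan_sum => r _.
by apply: negspan_le (negspan_ad_term _ _ _ hZ); rewrite /= addnS ltnS leq_addr.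
Qed.

Lemma unitri_mul v w : unitri v -> unitri w -> unitri (v *m w).
Proof.
move=> tv tw; have [vU hv] := tv; have [wU hw] := tw.
split=> [|k Z hZ]; first by rewrite unitmx_mul vU.
have -> : v *m w *m Z *m invmx (v *m w) - Z =
    v *m (w *m Z *m invmx w - Z) *m invmx v + (v *m Z *m invmx v - Z).
  by rewrite invmx_mul // mulmxBr mulmxBl !mulmxA addrA subrK.
by apply: negspanD; [apply: unitri_conj => //; apply: hw|apply: hv].
Qed.

Lemma unitri_1 : unitri 1%:M.
Proof.
split=> [|k Z _]; first exact: unitmx1.
by rewrite mul1mx invmx1 mulmx1 subrr; apply: negspan0.
Qed.

(** Descending induction on [k]: for [W = v Z v^-1 - Z], which lies one step deeper, [v^-1 Z v - Z]
    is minus the conjugate of [W] by [v^-1]. *)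
Lemma unitri_inv v : unitri v -> unitri (invmx v).
Proof.
move=> tv; have [vU hv] := tv; split=> [|k Z]; first by rewrite unitmx_inv.
rewrite invmxK; have [d] := ubnP (m - k); elim: d k Z => // d IH k Z dk hZ.
case: (leqP m k) => mk.
  by rewrite (negspan_m (negspan_le mk hZ)) mulmx0 mul0mx subr0; apply: negspan0.
pose W := v *m Z *m invmx v - Z; have hW : negspan k.+1 W := hv _ _ hZ.
have -> : invmx v *m Z *m v - Z = - (invmx v *m W *m v).
  by rewrite /W mulmxBr mulmxBl !mulmxA mulVmx // mul1mx mulmxKV // opprB.
rewrite -scaleN1r; apply: negspanZ; rewrite -[X in negspan _ X](subrK W).
apply: negspanD => //; apply: negspan_le (IH k.+1 W _ hW) => //.
by rewrite subnS; case: (m - k)%N dk (subn_gt0 k m) => //; rewrite mk.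
Qed.

Lemma expN_h a i A : h A ->
  expN a i *m A^E = (A^E - (a * iota (wt (beta i) A)) *: NE i) *m expN a i.
Proof.
move=> hA; have br : bracket (NE i) A^E = - iota (wt (beta i) A) *: NE i.
  rewrite bracket_anti bracketE bracket_hX ?neg_root_in // map_mxZ scaleNr //.
rewrite /expN (mxexp_mul charE (d := 2) (NE_nilpotent i a)).
  by rewrite big_ord_recl big_ord1 /= invr1 scale1r bracketZl br scalerA mulrN scaleNr.
by rewrite /= invr1 scale1r !bracketZl br !bracketZr bracketxx !scaler0.
Qed.

(** What remains of [u(x)] once its first [k] factors are stripped off: [u(x)] itself at [k = 0],
    the identity at [k = m]. *)
Definition expN_suf (x : m.-tuple E) k : 'M[E]_n :=
  \prod_(i <- drop k (enum 'I_m)) expN (tnth x i) i.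

Lemma expN_suf0 x : expN_suf x 0 = unip_prod iota S x.
Proof. by rewrite /expN_suf drop0 enumT /unip_prod [index_enum _]unlock. Qed.

Lemma expN_suf_ge x k : (m <= k)%N -> expN_suf x k = 1%:M.
Proof. by move=> mk; rewrite /expN_suf drop_oversize ?big_nil // size_enum_ord. Qed.

Lemma expN_sufS x (i : 'I_m) : expN_suf x i = expN (tnth x i) i *m expN_suf x i.+1.
Proof. by rewrite /expN_suf (drop_nth i) ?size_enum_ord // nth_ord_enum big_cons. Qed.

Lemma unitri_expN_suf x k : unitri (expN_suf x k).
Proof.
rewrite /expN_suf; elim: (drop k _) => [|i s IH]; first by rewrite big_nil; apply: unitri_1.
by rewrite big_cons; apply: unitri_mul; [apply: unitri_expN|].
Qed.

Lemma expN_suf_h x k A : h A ->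
  negspan k (expN_suf x k *m A^E *m invmx (expN_suf x k) - A^E).
Proof.
move=> hA; have [d] := ubnP (m - k); elim: d k => // d IH k dk.
case: (leqP m k) => [mk|km].
  rewrite expN_suf_ge // invmx1 mul1mx mulmx1 subrr.
  exact: negspan0.
have {}IH := IH k.+1; pose i := Ordinal km; rewrite -[k]/(nat_of_ord i) expN_sufS.
have [PU _] := unitri_expN_suf x i.+1; rewrite invmx_mul ?expN_unit //.
set P := expN_suf x i.+1; set e := expN _ _.
have -> : e *m P *m A^E *m (invmx P *m invmx e) - A^E =
  e *m (P *m A^E *m invmx P - A^E) *m invmx e + (e *m A^E *m invmx e - A^E).
  by rewrite mulmxBr mulmxBl !mulmxA addrA subrK.
apply: negspanD.
  apply: unitri_conj; first exact: unitri_expN.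
  apply: (negspan_le (leqnSn _)); apply: IH.
  by rewrite subnS; case: (m - k)%N dk (subn_gt0 k m) => //; rewrite km.
rewrite expN_h // mulmxK ?expN_unit // addrC addKr -scaleNr; apply/negspanZ/negspan_NE.
Qed.

(* Compare the coefficients of N_k in u H u^-1 after stripping the first
   factors off u. *)
Lemma expN_suf_inj x x' : (forall A, h A ->
    expN_suf x 0 *m A^E *m invmx (expN_suf x 0) =
    expN_suf x' 0 *m A^E *m invmx (expN_suf x' 0)) -> x = x'.
Proof.
move=> e0.
have e k : (k <= m)%N -> (forall A, h A ->
    expN_suf x k *m A^E *m invmx (expN_suf x k) =
    expN_suf x' k *m A^E *m invmx (expN_suf x' k))
    /\ forall i : 'I_m, (i < k)%N -> tnth x i = tnth x' i.
  elim: k => [|k IH] km; first by split.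
  have {IH} [IH IHx] := IH (ltnW km); pose i := Ordinal km.
  have step z B : h B -> expN_suf z k *m B^E *m invmx (expN_suf z k) =
      expN (tnth z i) i *m (expN_suf z k.+1 *m B^E *m invmx (expN_suf z k.+1))
        *m invmx (expN (tnth z i) i).
    move=> hB; rewrite -[k]/(nat_of_ord i) expN_sufS invmx_mul ?expN_unit //; last first.
      by have [] := unitri_expN_suf z i.+1.
    by rewrite !mulmxA.
  (* The later factors change [B] only from index [k.+1] on, so the coefficient at [k] comes from
     the leading factor alone. It determines [tnth z i] as soon as [beta_i] is nonzero at [B]. *)
  have cN z B : h B -> coordN i (expN_suf z k *m B^E *m invmx (expN_suf z k)) =
      - (tnth z i * iota (wt (beta i) B)).
    move=> hB; rewrite step //.
    rewrite -[expN_suf z k.+1 *m _ *m _](subrK B^E) mulmxDr mulmxDl /coordN lift_funD.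
    rewrite -!/(coordN _ _) (negspan_coord0 (k := k.+1) (i := i)) //; last first.
      by apply: unitri_conj; [apply: unitri_expN|apply: expN_suf_h].
    rewrite add0r expN_h // mulmxK ?expN_unit // /coordN lift_funB lift_funZ -!/(coordN _ _).
    by rewrite coordN_iota h_coordX ?neg_root_in // rmorph0 sub0r coordN_NE eqxx mulr1.
  have xi : tnth x i = tnth x' i.
    have [B hB nz] := wt_neq0 charC S (root_neq0 (neg_root_in i)).
    have := cN x B hB; rewrite IH // cN // => /oppr_inj /esym.
    by apply: mulIf; rewrite fmorph_eq0.
  split; last first.
    move=> j; rewrite ltnS leq_eqVlt => /orP[/eqP jk|jk]; last exact: IHx.
    by have -> : j = i by apply: val_inj.
  move=> A hA; have := IH A hA; rewrite !step // xi.
  move/(congr1 (fun M => invmx (expN (tnth x' i) i) *m M *m expN (tnth x' i) i)).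
  by rewrite !mulmxA !mulVmx ?expN_unit // !mul1mx !mulmxKV ?expN_unit.
apply: eq_from_tnth => i.
exact: (e m (leqnn m)).2.
Qed.

End NegativeSpan.

(** * The Borel subgroup over E *)

Section InverseDense.
Variables (C : closedFieldType) (E : fieldType) (iota : {rmorphism C -> E}) (n : nat).

Lemma polyfun_inv (f : 'M[E]_n -> E) : polyfun f ->
  exists d g, polyfun g /\ forall A, A \in unitmx -> g A = \det A ^+ d * f (invmx A).
Proof.
have polydet d : polyfun (fun A : 'M[E]_n => \det A ^+ d).
  elim: d => [|d IH]; first exact: polyfun_const.
  rewrite (_ : (fun _ => _) = fun A : 'M[E]_n => \det A * \det A ^+ d).
    by apply: polyfun_mul => //; apply: polyfun_det; apply: polymx_id.
  by apply: funext => A; rewrite exprS.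
elim=> [c|i j|f1 f2 _ [d1 [g1 [p1 e1]]] _ [d2 [g2 [p2 e2]]]
           |f1 f2 _ [d1 [g1 [p1 e1]]] _ [d2 [g2 [p2 e2]]]].
- by exists 0%N, (fun=> c); split=> [|A _]; [apply: polyfun_const|rewrite mul1r].
- exists 1%N, (fun A => \adj A i j); split=> [|A AU]; first exact: polymx_adj.
  by rewrite /invmx AU [X in _ = _ * X]mxE expr1 mulrA divff ?mul1r // -unitfE -unitmxE.
- exists (d1 + d2)%N, (fun A => \det A ^+ d2 * g1 A + \det A ^+ d1 * g2 A); split.
    by apply: polyfun_add; apply: polyfun_mul.
  by move=> A AU; rewrite e1 // e2 // exprD; ring.
- exists (d1 + d2)%N, (fun A => g1 A * g2 A); split; first exact: polyfun_mul.
  by move=> A AU; rewrite e1 // e2 // exprD; ring.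
Qed.

Lemma dense_point_inv (H : 'M[C]_n -> Prop) b : subgroup H -> b \in unitmx ->
  dense_point iota H b -> dense_point iota H (invmx b).
Proof.
move=> [HU _ _ HV] bU Hb f pf f0; have [d [g [pg eg]]] := polyfun_inv pf.
have /eqP : g b = 0.
  apply: Hb => // A HA; rewrite eg ?map_unitmx ?HU // -map_invmx f0 ?mulr0 //.
  exact: HV.
by rewrite eg // mulf_eq0 expf_eq0 -[_ == 0]negbK -unitfE -unitmxE bU andbF => /eqP.
Qed.

Lemma polyfun_lift (f : 'M[C]_n -> C) (phi : 'M[E]_n -> 'M[E]_n) :
  polymx phi -> polyfun (fun A => lift_fun iota f (phi A)).
Proof.
move=> Hphi; rewrite /lift_fun; apply: polyfun_sum => i; apply: polyfun_sum => j.
by apply: polyfun_mul; [apply: polyfun_const|].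
Qed.

End InverseDense.

Lemma log_derivM (E : fieldType) (D : {additive E -> E}) n (A B : 'M[E]_n) :
  derivation D -> A \in unitmx -> B \in unitmx ->
  log_deriv D (A *m B) = log_deriv D A + A *m log_deriv D B *m invmx A.
Proof.
move=> derD AU BU; rewrite /log_deriv.
have -> : map_mx D (A *m B) = map_mx D A *m B + A *m map_mx D B.
  apply/matrixP => i j; rewrite !mxE raddf_sum -big_split; apply: eq_bigr => k _.
  by rewrite !mxE derD.
by rewrite invmx_mul // mulmxDl !mulmxA mulmxK.
Qed.

Section TorusAction.
Variables (C : closedFieldType) (charC : [pchar C] =i pred0).
Variables (n l m : nat) (S : group_data C n l m).
Variables (E : fieldType) (iota : {rmorphism C -> E}).

Local Notation G := (grp S).
Local Notation T := (max_torus S).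
Local Notation h := (lie idfun (max_torus S)).
Local Notation alpha := (simple_root S).
Local Notation Phi := (Defs.roots S).
Local Notation H_ := (chev_H S).
Local Notation X_ := (chev_X S).
Local Notation wt := (root_of alpha).
Local Notation beta := (neg_root S).
Local Notation "A ^E" := (map_mx iota A) (at level 2, format "A ^E").
Local Notation NE := (NE S iota).
Local Notation negspan := (negspan S iota).
Local Notation coordN := (coordN S iota).

Definition torusE i z : 'M[E]_n := laurent_eval iota (torus1_param S i) z.

Lemma torus1_alg i : alg_subgroup (torus1 S i).
Proof. by have [] := torus1P S i. Qed.

Lemma torus1_iso i : alg_isom (@diag_group C 1) (torus1 S i)
  (fun A => laurent_eval idfun (torus1_param S i) (A 0 0)).
Proof. by have [] := torus1P S i. Qed.

(** The scalar depends on the chosen isomorphism of G_m with [T_i]; that it is nonzero suffices to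
    recover the logarithmic derivative of [z_i]. *)
Lemma torus_ode i : exists2 c, c != 0 & laurent_ode (torus1_param S i) (c *: H_ i).
Proof.
have [X [ode lX X0]] := torus1_gen charC (torus1_alg i) (torus1_iso i).
have [_ _ lE _] := torus1P S i; have /lE [c Xc] := lX.
exists c; last by rewrite -Xc.
by apply: contraNneq X0 => c0; rewrite Xc c0 scale0r.
Qed.

Lemma torusE_dense i z : z != 0 -> dense_point iota T (torusE i z).
Proof.
move=> z0; apply: dense_point_laurent => // c c0.
by have [_ sub _ _] := torus1P S i; apply/sub/(torus1_mem (torus1_iso i)).
Qed.

(** The properties of [E]-points of T that are used: they centralize h and rescale each negative
    root vector. The character values [c] are left unspecified. *)
Definition tstab (v : 'M[E]_n) : Prop :=
  [/\ v \in unitmx, forall A, h A -> v *m A^E = A^E *m v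
    & forall j, exists2 c, c != 0 & v *m NE j = c *: (NE j *m v)].

Lemma tstab_1 : tstab 1%:M.
Proof.
split=> [|A _|j]; first exact: unitmx1; first by rewrite mul1mx mulmx1.
by exists 1; rewrite ?oner_neq0 // scale1r mul1mx mulmx1.
Qed.

Lemma tstab_mul v w : tstab v -> tstab w -> tstab (v *m w).
Proof.
move=> [vU vh vN] [wU wh wN]; split=> [|A hA|j]; first by rewrite unitmx_mul vU.
  by rewrite -mulmxA wh // mulmxA vh // mulmxA.
have [c c0 ec] := vN j; have [d d0 ed] := wN j.
exists (d * c); rewrite ?mulf_neq0 // -mulmxA ed -scalemxAr [v *m (NE j *m w)]mulmxA ec.
by rewrite -scalemxAl scalerA mulmxA.
Qed.

Lemma tstab_inv v : tstab v -> tstab (invmx v).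
Proof.
move=> [vU vh vN]; split=> [|A hA|j]; first by rewrite unitmx_inv.
  by apply: (can_inj (mulKmx vU)); rewrite mulmxA mulmxV // mul1mx mulmxA vh // mulmxK.
have [c c0 ec] := vN j; exists c^-1; rewrite ?invr_neq0 //.
apply: (can_inj (mulKmx vU)); rewrite mulmxA mulmxV // mul1mx -scalemxAr mulmxA ec.
by rewrite -scalemxAl scalerA mulVf // scale1r mulmxK.
Qed.

Lemma tstab_torusE i z : z != 0 -> torusE i z \in unitmx -> tstab (torusE i z).
Proof.
move=> z0 tU; have dt := torusE_dense i z0; split=> // [A hA|j].
  apply/eqP; rewrite -subr_eq0; apply/eqP.
  rewrite -mulNmx; apply: (dense_point_mx dt (phi := fun v => v *m A^E + (- A^E) *m v)) => [|B TB].
    apply: polymxD; apply: polymxM; try exact: polymx_id; exact: polymx_const.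
  by rewrite mulNmx -!map_mxM (torus_lie_comm TB hA) subrr.
(* The adjugate stands in for the inverse, which is not polynomial: [phi v] is [\det v] times the
   conjugate of [NE j]. That it is a multiple of [NE j] is a polynomial identity on T and extends to
   the [E]-point by density. *)
pose phi v := v *m NE j *m \adj v.
pose f := coordX S (beta j).
have pphi : polymx phi.
  apply: polymxM; last exact: polymx_adj.
  by apply: polymxM; [apply: polymx_id|apply: polymx_const].
have e : phi (torusE i z) - lift_fun iota f (phi (torusE i z)) *: NE j = 0.
  apply: (dense_point_mx dt (phi := fun v => phi v - lift_fun iota f (phi v) *: NE j)).
    move=> a b; rewrite (_ : (fun _ => _) =
      fun v => phi v a b + (-1) * (lift_fun iota f (phi v) * NE j a b)).
      apply: polyfun_add => //; apply: polyfun_mul; first exact: polyfun_const.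
      by apply: polyfun_mul; [apply: polyfun_lift|apply: polyfun_const].
    by apply: funext => v; rewrite !mxE mulN1r.
  move=> B TB; have BU := torus_unit TB.
  have -> : phi B^E = (\det B *: (B *m X_ (beta j) *m invmx B))^E.
    rewrite /phi /NE -map_mx_adj -!map_mxM; congr map_mx.
    rewrite /invmx BU -!scalemxAr scalerA divff ?scale1r // -unitfE -unitmxE //.
  have jP := neg_root_in S j.
  have -> : B *m X_ (beta j) *m invmx B = coordX S (beta j) (B *m X_ (beta j) *m invmx B) *: X_ (beta j).
    apply: root_space_line => //; split.
      by apply: lie_conj; [apply: grp_subgroup|apply: torus_sub|apply: g_X].
    move=> A hA; have {1}-> : A = B *m A *m invmx B by rewrite (torus_lie_comm TB hA) mulmxK.
    by rewrite bracket_conj // bracket_hX // -scalemxAr -scalemxAl.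
  rewrite scalerA map_mxZ lift_funZ -/(NE j) -/(coordN j _) coordN_NE eqxx mulr1.
  by rewrite subrr.
have {}e : phi (torusE i z) = lift_fun iota f (phi (torusE i z)) *: NE j.
  by apply/eqP; rewrite -subr_eq0 e.
have dU : \det (torusE i z) != 0 by rewrite -unitfE -unitmxE.
have e2 : \det (torusE i z) *: (torusE i z *m NE j) =
    lift_fun iota f (phi (torusE i z)) *: (NE j *m torusE i z).
  by rewrite scalemxAl -e /phi -mulmxA mul_adj_mx mul_mx_scalar.
exists (lift_fun iota f (phi (torusE i z)) / \det (torusE i z)); last first.
  by rewrite mulrC -scalerA -e2 scalerA mulVf // scale1r.
rewrite mulf_neq0 ?invr_neq0 //; apply/eqP => f0; move: e2; rewrite f0 scale0r.
move/eqP; rewrite scaler_eq0 (negPf dU) /= => /eqP tN0.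
have : NE j = 0 by apply: (can_inj (mulKmx tU)); rewrite tN0 mulmx0.
move/(congr1 (coordN j)); rewrite coordN_NE eqxx [RHS]lift_fun0 => /eqP.
by rewrite oner_eq0.
Qed.

Lemma tstab_prod (r : seq 'I_l) (z : 'I_l -> E) : (forall i, z i != 0) ->
  \prod_(i <- r) torusE i (z i) \in unitmx -> tstab (\prod_(i <- r) torusE i (z i)).
Proof.
move=> z0; elim: r => [|i r IH]; first by rewrite big_nil => _; apply: tstab_1.
rewrite big_cons unitmx_mul => /andP[tU /IH]; apply: tstab_mul.
exact: tstab_torusE.
Qed.

Lemma tstab_negspan v Z : tstab v -> negspan 0 Z -> negspan 0 (v *m Z *m invmx v).
Proof.
move=> [vU _ vN] [c [_ ->]]; rewrite mulmx_sumr mulmx_suml; apply: negspan_sum => j _.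
have [d _ e] := vN j; rewrite -scalemxAr e -!scalemxAl mulmxK //.
by do 2! apply: negspanZ; apply: (negspan_le (leq0n j)); apply: negspan_NE.
Qed.

(* The E-span of the Lie algebra of the Borel subgroup. *)
Definition bspan (Z : 'M[E]_n) : Prop :=
  exists a : 'I_l -> E, negspan 0 (Z - \sum_i a i *: (H_ i)^E).

Lemma bspan_h A : h A -> bspan A^E.
Proof.
move=> hA; exists (fun i => iota (coordH S i A)).
rewrite {1}(h_decomp charC hA) raddf_sum /=.
under eq_bigr do rewrite map_mxZ.
by rewrite subrr; apply: negspan0.
Qed.

Lemma bspan_neg Z : negspan 0 Z -> bspan Z.
Proof.
by move=> hZ; exists (fun=> 0); rewrite big1 ?subr0 // => i _; rewrite scale0r.
Qed.

Lemma bspanD Z W : bspan Z -> bspan W -> bspan (Z + W).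
Proof.
move=> [a ha] [b hb]; exists (fun i => a i + b i).
under eq_bigr do rewrite scalerDl.
by rewrite big_split /= opprD addrACA; apply: negspanD.
Qed.

Lemma bspanZ c Z : bspan Z -> bspan (c *: Z).
Proof.
move=> [a ha]; exists (fun i => c * a i).
under eq_bigr do rewrite -scalerA.
by rewrite -scaler_sumr -scalerBr; apply: negspanZ.
Qed.

Lemma bspan_sum I (r : seq I) (P : pred I) F :
  (forall i, P i -> bspan (F i)) -> bspan (\sum_(i <- r | P i) F i).
Proof.
move=> H; elim/big_ind: _ => //; first by apply/bspan_neg/negspan0.
by move=> *; apply: bspanD.
Qed.

Definition bstab (v : 'M[E]_n) : Prop := forall Z, bspan Z -> bspan (v *m Z *m invmx v).

Lemma bstabP v : (forall i, bspan (v *m (H_ i)^E *m invmx v)) ->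
  (forall j, bspan (v *m NE j *m invmx v)) -> bstab v.
Proof.
move=> vH vN Z [a [c [_ e]]].
have -> : Z = \sum_i a i *: (H_ i)^E + \sum_i c i *: NE i by rewrite -e addrC subrK.
rewrite mulmxDr mulmxDl !mulmx_sumr !mulmx_suml; apply: bspanD; apply: bspan_sum => i _.
  by rewrite -scalemxAr -scalemxAl; apply: bspanZ.
by rewrite -scalemxAr -scalemxAl; apply: bspanZ.
Qed.

Lemma bstab_mul v w : v \in unitmx -> w \in unitmx -> bstab v -> bstab w -> bstab (v *m w).
Proof.
move=> vU wU hv hw Z /hw /hv; rewrite invmx_mul // !mulmxA.
by [].
Qed.

Lemma bstab_tstab v : tstab v -> bstab v.
Proof.
move=> tv; have [vU vh _] := tv; apply: bstabP => [i|j].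
  by rewrite vh ?mulmxK //; [apply: bspan_h|]; apply: h_H.
by apply/bspan_neg/tstab_negspan => //; apply: (negspan_le (leq0n j)); apply: negspan_NE.
Qed.

Lemma bstab_expN_suf x : bstab (expN_suf S iota x 0).
Proof.
have tu := unitri_expN_suf charC S iota x 0; apply: bstabP => [i|j].
  have hi : h (H_ i) by apply: h_H.
  rewrite -[X in bspan X](subrK (H_ i)^E); apply: bspanD; last exact: bspan_h.
  exact/bspan_neg/expN_suf_h.
by apply/bspan_neg/unitri_conj => //; apply: (negspan_le (leq0n j)); apply: negspan_NE.
Qed.

Lemma bstab_expN_suf_inv x : bstab (invmx (expN_suf S iota x 0)).
Proof.
have tu := unitri_expN_suf charC S iota x 0; have [uU _] := tu.
have ti := unitri_inv tu; apply: bstabP => [i|j].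
  have hi : h (H_ i) by apply: h_H.
  rewrite invmxK -[X in bspan X](subrK (H_ i)^E); apply: bspanD; last exact: bspan_h.
  apply: bspan_neg.
  set u := expN_suf _ _ _ _ in uU ti tu *; set A := (H_ i)^E.
  have -> : invmx u *m A *m u - A = (-1) *: (invmx u *m (u *m A *m invmx u - A) *m u).
    by rewrite mulmxBr mulmxBl !mulmxA mulVmx // mul1mx mulmxKV // scaleN1r opprB.
  apply: negspanZ; rewrite -[X in _ *m X](invmxK u); apply: unitri_conj => //.
  exact: expN_suf_h.
by apply/bspan_neg/unitri_conj => //; apply: (negspan_le (leq0n j)); apply: negspan_NE.
Qed.

Lemma lie0 (K : 'M[C]_n -> Prop) : lie idfun K 0.
Proof. by move=> p _; rewrite big1 // => k _; rewrite linear0 mxE mulr0. Qed.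

Lemma root_space0 a : root_space (lie idfun G) h a 0.
Proof.
split=> [|A _]; first exact: lie0.
by rewrite /bracket mulmx0 mul0mx subrr scaler0.
Qed.

Lemma lie_borel_H i : lie idfun (borel_neg S) (H_ i).
Proof.
apply/lie_borel_neg; exists (H_ i), (fun=> 0); split; first exact: h_H.
  by move=> j; apply: root_space0.
by rewrite big1 // addr0.
Qed.

Lemma lie_borel_N j : lie idfun (borel_neg S) (X_ (beta j)).
Proof.
apply/lie_borel_neg; exists 0, (fun i => if i == j then X_ (beta j) else 0); split.
- exact: lie0.
- move=> i; case: eqP => [->|_]; last exact: root_space0.
  exact/root_space_X/neg_root_in.
- by rewrite add0r (bigD1 j) //= eqxx big1 ?addr0 // => i /negPf ->.
Qed.

(** A group normalizes its own Lie algebra, and the [E]-span of that of B^- is [bspan]. *)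
Lemma bstab_borel A : borel_neg S A -> bstab A^E.
Proof.
move=> BA; have [[[sB _] _ _] _ _] := borel_negP S.
have [BU _ _ _] := sB; have AU := BU _ BA.
have lB Z : lie idfun (borel_neg S) Z -> bspan Z^E.
  move/(lie_borel_neg S) => [A0 [N [hA0 hN ->]]].
  rewrite map_mxD; apply: bspanD; first exact: bspan_h.
  rewrite raddf_sum /=; apply: bspan_sum => j _.
  rewrite (root_space_line charC (neg_root_in S j) (hN j)) map_mxZ.
  by apply/bspanZ/bspan_neg/(negspan_le (leq0n j))/negspan_NE.
have conjB Z : lie idfun (borel_neg S) Z -> bspan (A^E *m Z^E *m invmx A^E).
  by move=> lZ; rewrite -map_invmx -!map_mxM; apply/lB/lie_conj.
by apply: bstabP => [i|j]; apply: conjB; [apply: lie_borel_H|apply: lie_borel_N].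
Qed.

End TorusAction.

(** * Logarithmic derivatives *)

Section Derivations.
Variables (C : closedFieldType) (charC : [pchar C] =i pred0).
Variables (n l m : nat) (S : group_data C n l m).
Variables (E : fieldType) (iota : {rmorphism C -> E}).
Variables (D : {additive E -> E}) (derD : derivation D).
Hypothesis Diota : forall c, D (iota c) = 0.

Local Notation H_ := (chev_H S).
Local Notation X_ := (chev_X S).
Local Notation beta := (neg_root S).
Local Notation "A ^E" := (map_mx iota A) (at level 2, format "A ^E").
Local Notation NE := (NE S iota).
Local Notation negspan := (negspan S iota).
Local Notation expN := (expN S iota).
Local Notation expN_suf := (expN_suf S iota).
Local Notation torusE := (torusE S iota).

Lemma deriv_horner (p : {poly C}) z :
  D (map_poly iota p).[z] = D z * (map_poly iota p^`()).[z].
Proof.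
elim/poly_ind: p => [|p c IH]; first by rewrite deriv0 !rmorph0 horner0 raddf0 mulr0.
rewrite derivMXaddC !rmorphD !rmorphM /= map_polyX map_polyC /= !hornerE.
by rewrite raddfD /= derD IH Diota /=; ring.
Qed.

Lemma deriv_pow z k : z * D (z ^+ k) = k%:R * z ^+ k * D z.
Proof.
elim: k => [|k IH].
  by rewrite !expr0 -(rmorph1 iota) Diota mulr0 !mul0r.
by rewrite exprS derD mulrDr mulrCA IH -[k.+1]addn1 natrD; ring.
Qed.

Lemma log_deriv_iota (A : 'M[C]_n) : log_deriv D A^E = 0.
Proof.
rewrite /log_deriv (_ : map_mx D A^E = 0) ?mul0mx //.
by apply/matrixP => i j; rewrite !mxE Diota.
Qed.

Lemma log_deriv_expN a i : log_deriv D (expN a i) = D a *: NE i.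
Proof.
have XN := X_nilpotent charC (neg_root_in S i).
have eE : expN a i = laurent_eval iota (exp_laurent (X_ (beta i))) a.
  by rewrite exp_laurentE.
suff e : map_mx D (expN a i) = D a *: (NE i *m expN a i).
  by rewrite /log_deriv e -scalemxAl mulmxK // expN_unit.
apply/matrixP => j k; rewrite -expN_comm // eE /laurent_eval expr0 invr1 scale1r.
rewrite 2!mxE deriv_horner exp_laurent_deriv // 2!mxE; congr (_ * _).
rewrite rmorph_sum horner_sum; apply: eq_bigr => b _ /=.
by rewrite map_polyZ hornerZ !mxE mulrC.
Qed.

(** The chain rule turns [z t'(z) = t(z) c H_i] into [D t = (D z / z) t c H_i], and [t] commutes
    with [H_i]. *)
Lemma log_deriv_torusE i : exists2 c, c != 0 & forall z, z != 0 -> torusE i z \in unitmx ->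
  log_deriv D (torusE i z) = (iota c * (D z / z)) *: (H_ i)^E.
Proof.
have [c c0 ode] := torus_ode charC S i; exists c => // z z0 tU.
have [_ tH _] := tstab_torusE charC z0 tU.
suff e : map_mx D (torusE i z) = (iota c * (D z / z)) *: ((H_ i)^E *m torusE i z).
  by rewrite /log_deriv e -scalemxAl mulmxK.
rewrite -tH; last exact: h_H.
apply/matrixP => j k; rewrite [LHS]mxE [RHS]mxE.
set Q := torus1_param S i in ode *.
have tE b : torusE i z j b = z ^- Q.2 * (map_poly iota (Q.1 j b)).[z] by rewrite !mxE.
have Dt : D (torusE i z j k) * z ^+ Q.2 + torusE i z j k * D (z ^+ Q.2) =
    D z * (map_poly iota (Q.1 j k)^`()).[z].
  rewrite -derD -deriv_horner tE; congr (D _).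
  by rewrite mulrC mulrA divff ?mul1r // expf_neq0.
have := congr1 (fun q => (map_poly iota q).[z]) (ode j k).
rewrite rmorphB rmorphM /= map_polyX map_polyZ /= rmorph_nat hornerD hornerN hornerM hornerX hornerZ.
rewrite rmorph_sum horner_sum => odez.
have zk : z ^+ Q.2 != 0 by rewrite expf_neq0.
apply: (mulIf zk); apply: (mulfI z0).
have -> : z * (D (torusE i z j k) * z ^+ Q.2) =
    D z * (z * (map_poly iota (Q.1 j k)^`()).[z] - Q.2%:R * (map_poly iota (Q.1 j k)).[z]).
  move/(congr1 (fun u => z * u)): Dt; rewrite mulrDr [z * (_ * D _)]mulrCA deriv_pow tE.
  move/eqP; rewrite -subr_eq0 => /eqP e; apply/eqP; rewrite -subr_eq0 -e; apply/eqP.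
  by field.
rewrite odez [(_ *m _) j k]mxE.
transitivity (D z * \sum_b iota c * (torusE i z j b * (H_ i)^E b k) * z ^+ Q.2).
  congr (_ * _); rewrite [RHS](eq_bigr (fun b => (map_poly iota ((c *: H_ i) b k *: Q.1 j b)).[z])) //.
  move=> b _; rewrite map_polyZ hornerZ tE !mxE rmorphM /=; field.
  by [].
rewrite -mulr_suml -mulr_sumr; field.
by [].
Qed.

Lemma negspan_log_deriv y k : negspan k (log_deriv D (expN_suf y k)).
Proof.
have [d] := ubnP (m - k); elim: d k => // d IH k dk.
case: (leqP m k) => [mk|km].
  by rewrite expN_suf_ge // -(map_mx1 iota) log_deriv_iota; apply: negspan0.
have {}IH := IH k.+1; pose i := Ordinal km; rewrite -[k]/(nat_of_ord i) expN_sufS.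
have [PU _] := unitri_expN_suf charC S iota y i.+1.
rewrite log_derivM ?expN_unit // log_deriv_expN; apply: negspanD.
  exact/negspanZ/negspan_NE.
apply: unitri_conj; first exact: unitri_expN.
apply: (negspan_le (leqnSn _)); apply: IH.
by rewrite subnS; case: (m - k)%N dk (subn_gt0 k m) => //; rewrite km.
Qed.

End Derivations.

(** * Normal-form factors as points of the Borel subgroup *)

Section BorelPoints.
Variables (C : closedFieldType) (charC : [pchar C] =i pred0).
Variables (n l m : nat) (S : group_data C n l m).
Variables (E : fieldType) (iota : {rmorphism C -> E}).

Lemma borel_alg : alg_subgroup (borel_neg S).
Proof. by have [[aB _ _] _ _] := borel_negP S. Qed.

Lemma dense_point_prod (K : 'M[C]_n -> Prop) I (r : seq I) (F : I -> 'M[E]_n) : subgroup K ->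
  (forall i, dense_point iota K (F i)) -> dense_point iota K (\prod_(i <- r) F i).
Proof.
move=> [_ K1 KM _] KF; elim: r => [|i r IH]; last by rewrite big_cons; apply: dense_point_mul.
by rewrite big_nil -[1]/(1%:M) -(map_mx1 iota); apply: dense_point_iota.
Qed.

(** Each factor is the value at an element of [E] of a curve that is tangent to the Lie algebra of
    B^-, hence lies in B^- at constant parameters. Density passes to its value over [E] and to
    products. *)
Lemma borel_dense z y : (forall i, tnth z i != 0) ->
  dense_point iota (borel_neg S) (torus_prod iota S z *m unip_prod iota S y).
Proof.
move=> z0; have aB := borel_alg; have [sB _] := aB; have [_ B1 BM _] := sB.
apply: dense_point_mul => //; apply: dense_point_prod => // i.
  apply: dense_point_laurent => // c c0.
  have [d _ ode] := torus_ode charC S i; have iso := torus1_iso S i.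
  apply: (laurent_in_group charC aB _ ode) => //.
  - exact/lieZ/lie_borel_H.
  - by rewrite (torus1_1 (torus1_alg S i) iso).
  - by move=> b b0; apply: (torus1_unit (torus1_alg S i) iso).
have eB c : borel_neg S (mxexp (c *: chev_X S (neg_root S i))).
  apply: exp_in_group => //; first exact: lie_borel_N.
  exact/X_nilpotent/neg_root_in.
(* [dense_point_laurent] demands a nonzero parameter; at 0 the exponential is a constant point. *)
rewrite -exp_laurentE; case: (eqVneq (tnth y i) 0) => [->|yi0].
  by rewrite -(rmorph0 iota) laurent_eval_iota exp_laurentE map_mx_id //; apply: dense_point_iota.
apply: dense_point_laurent => // c _.
by rewrite exp_laurentE map_mx_id.
Qed.

End BorelPoints.

(** * Differential subfields *)

Section Subfields.
Variable (E : fieldType).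

Section Closed.
Variables (K : {pred E}) (closedK : divring_closed K).

Lemma subfield1 : 1 \in K. Proof. by have [] := closedK. Qed.
Lemma subfieldB a b : a \in K -> b \in K -> a - b \in K.
Proof. by have [_ H _] := closedK; apply: H. Qed.
Lemma subfield_div a b : a \in K -> b \in K -> a / b \in K.
Proof. by have [_ _ H] := closedK; apply: H. Qed.
Lemma subfield0 : 0 \in K. Proof. by rewrite -(subrr 1); apply: subfieldB; apply: subfield1. Qed.
Lemma subfieldN a : a \in K -> - a \in K.
Proof. by rewrite -[- a]sub0r; apply: subfieldB; apply: subfield0. Qed.
Lemma subfieldD a b : a \in K -> b \in K -> a + b \in K.
Proof. by move=> Ka Kb; rewrite -[b]opprK; apply/subfieldB/subfieldN. Qed.
Lemma subfieldV a : a \in K -> a^-1 \in K.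
Proof. by rewrite -[a^-1]mul1r; apply/subfield_div/subfield1. Qed.
Lemma subfieldM a b : a \in K -> b \in K -> a * b \in K.
Proof. by move=> Ka Kb; rewrite -[b]invrK; apply/subfield_div/subfieldV. Qed.
Lemma subfieldX a k : a \in K -> a ^+ k \in K.
Proof. by move=> Ka; elim: k => [|k IH]; rewrite ?subfield1 // exprS; apply: subfieldM. Qed.
Lemma subfield_sum I (r : seq I) (P : pred I) F :
  (forall i, P i -> F i \in K) -> \sum_(i <- r | P i) F i \in K.
Proof. by move=> H; elim/big_ind: _ => //; [apply: subfield0|apply: subfieldD]. Qed.
Lemma subfield_prod I (r : seq I) (P : pred I) F :
  (forall i, P i -> F i \in K) -> \prod_(i <- r | P i) F i \in K.
Proof. by move=> H; elim/big_ind: _ => //; [apply: subfield1|apply: subfieldM]. Qed.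

Definition mx_over r s (A : 'M[E]_(r, s)) : Prop := forall i j, A i j \in K.

Lemma mx_overB r s (A B : 'M[E]_(r, s)) : mx_over A -> mx_over B -> mx_over (A - B).
Proof. by move=> KA KB i j; rewrite !mxE; apply: subfieldB. Qed.

Lemma mx_overZ r s a (A : 'M[E]_(r, s)) : a \in K -> mx_over A -> mx_over (a *: A).
Proof. by move=> Ka KA i j; rewrite mxE; apply: subfieldM. Qed.

Lemma mx_overM r s t (A : 'M[E]_(r, s)) (B : 'M[E]_(s, t)) :
  mx_over A -> mx_over B -> mx_over (A *m B).
Proof. by move=> KA KB i j; rewrite mxE; apply: subfield_sum => k _; apply: subfieldM. Qed.

Lemma mx_over1 r : mx_over (1%:M : 'M[E]_r).
Proof. by move=> i j; rewrite mxE; case: eqP => _; rewrite ?subfield1 ?subfield0. Qed.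

Lemma mx_over_sum r s I (q : seq I) (P : pred I) (F : I -> 'M[E]_(r, s)) :
  (forall i, P i -> mx_over (F i)) -> mx_over (\sum_(i <- q | P i) F i).
Proof. by move=> KF i j; rewrite summxE; apply: subfield_sum => k /KF; apply. Qed.

Lemma mx_over_prod r I (q : seq I) (F : I -> 'M[E]_r) :
  (forall i, mx_over (F i)) -> mx_over (\prod_(i <- q) F i).
Proof.
move=> KF; elim: q => [|i q IH]; first by rewrite big_nil; apply: mx_over1.
by rewrite big_cons; apply: mx_overM.
Qed.

Lemma subfield_det r (A : 'M[E]_r) : mx_over A -> \det A \in K.
Proof.
move=> KA; apply: subfield_sum => s _; apply: subfieldM; last by apply: subfield_prod.
exact/subfieldX/subfieldN/subfield1.
Qed.

Lemma mx_overV r (A : 'M[E]_r) : mx_over A -> mx_over (invmx A).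
Proof.
move=> KA; rewrite /invmx; case: ifP => // _; apply: mx_overZ; first exact/subfieldV/subfield_det.
move=> i j; rewrite mxE /cofactor; apply: subfieldM; first exact/subfieldX/subfieldN/subfield1.
by apply: subfield_det => a b; rewrite !mxE.
Qed.

Lemma mx_over_mxexp r (N : 'M[E]_r) : mx_over N -> mx_over (mxexp N).
Proof.
move=> KN; apply: mx_over_sum => k _; apply: mx_overZ.
  apply: subfieldV; elim: (k`!) => [|d IH]; first exact: subfield0.
  by rewrite -[d.+1]addn1 natrD; apply/subfieldD/subfield1.
elim: (nat_of_ord k) => [|d IH]; first by rewrite expr0; apply: mx_over1.
by rewrite exprS; apply: mx_overM.
Qed.

Lemma mx_over_laurent (C : closedFieldType) (iota : {rmorphism C -> E}) r
    (P : laurent_mx C r) z : (forall c, iota c \in K) -> z \in K ->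
  mx_over (laurent_eval iota P z).
Proof.
move=> Kiota Kz; apply: mx_overZ; first exact/subfieldV/subfieldX.
move=> i j; rewrite mxE horner_coef; apply: subfield_sum => k _; apply: subfieldM; last exact: subfieldX.
by rewrite coef_map; apply: Kiota.
Qed.

End Closed.

Lemma adjoin_closed (K : {pred E}) s : divring_closed (adjoin K s).
Proof.
split=> [|a b /asboolP Ha /asboolP Hb|a b /asboolP Ha /asboolP Hb];
  apply/asboolP => K' cK' KK' sK'; first exact: subfield1.
  by apply: (subfieldB cK'); [apply: Ha|apply: Hb].
by apply: (subfield_div cK'); [apply: Ha|apply: Hb].
Qed.

Lemma adjoin_sub (K : {pred E}) s : {subset K <= adjoin K s}.
Proof. by move=> a Ka; apply/asboolP => K' _ KK' _; apply: KK'. Qed.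

Lemma adjoin_mem (K : {pred E}) s : {subset s <= adjoin K s}.
Proof. by move=> a sa; apply/asboolP => K' _ _; apply. Qed.

Lemma adjoin_min (K K' : {pred E}) s : divring_closed K' -> {subset K <= K'} ->
  {subset s <= K'} -> {subset adjoin K s <= K'}.
Proof. by move=> cK' KK' sK' a /asboolP; apply. Qed.

Lemma adjoin_cat (K : {pred E}) s1 s2 : adjoin K (s1 ++ s2) =i adjoin (adjoin K s1) s2.
Proof.
move=> a; apply/idP/idP; apply: adjoin_min; try exact: adjoin_closed.
- by move=> b Kb; do 2! apply: adjoin_sub.
- by move=> b; rewrite mem_cat => /orP[bs|bs]; [apply/adjoin_sub/adjoin_mem|apply: adjoin_mem].
- apply: adjoin_min; first exact: adjoin_closed; first exact: adjoin_sub.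
  by move=> b bs; apply: adjoin_mem; rewrite mem_cat bs.
- by move=> b bs; apply: adjoin_mem; rewrite mem_cat bs orbT.
Qed.

Lemma adjoin_deriv (D : {additive E -> E}) (K : {pred E}) s : derivation D ->
  {in K, forall a, D a \in K} -> {in s, forall a, D a \in adjoin K s} ->
  diff_subfield D (adjoin K s).
Proof.
move=> derD DK Ds; have cA := adjoin_closed K s; split=> // a.
(* By the quotient rule, the elements of the adjunction whose derivative stays in it form a
   subfield, and this subfield contains the generators. *)
pose K' : {pred E} := fun a => (a \in adjoin K s) && (D a \in adjoin K s).
suff : {subset adjoin K s <= K'} by move=> H /H /andP[].
have D1 : D 1 = 0.
  by apply: (addrI (D 1)); rewrite addr0 -{3}[1]mulr1 derD mulr1 mul1r.
apply: adjoin_min => [|b Kb|b bs]; first split.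
- by apply/andP; rewrite D1; split; [apply: subfield1|apply: subfield0].
- move=> b c /andP[b1 b2] /andP[c1 c2]; apply/andP; rewrite raddfB /=.
  by split; apply: subfieldB.
- move=> b c /andP[b1 b2] /andP[c1 c2]; apply/andP; split; first exact: subfield_div.
  case: (eqVneq c 0) => [->|c0]; first by rewrite invr0 mulr0 raddf0; apply: subfield0.
  have -> : D (b / c) = (D b - b / c * D c) / c.
    by have e := derD (b / c) c; rewrite divfK // in e; rewrite e addrK mulfK.
  by apply: subfield_div => //; apply: subfieldB => //; apply: subfieldM => //; apply: subfield_div.
- by apply/andP; split; apply: adjoin_sub => //; apply: DK.
- by apply/andP; split; [apply: adjoin_mem|apply: Ds].
Qed.

End Subfields.

(** * The normal form *)

Section Peeling.
Variables (C : closedFieldType) (charC : [pchar C] =i pred0).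
Variables (n l m : nat) (S : group_data C n l m).
Variables (E : fieldType) (iota : {rmorphism C -> E}).
Variables (D : {additive E -> E}) (derD : derivation D).
Hypothesis Diota : forall c, D (iota c) = 0.

Local Notation h := (lie idfun (max_torus S)).
Local Notation H_ := (chev_H S).
Local Notation X_ := (chev_X S).
Local Notation beta := (neg_root S).
Local Notation "A ^E" := (map_mx iota A) (at level 2, format "A ^E").
Local Notation NE := (NE S iota).
Local Notation negspan := (negspan S iota).
Local Notation coordN := (coordN S iota).
Local Notation expN := (expN S iota).
Local Notation expN_suf := (expN_suf S iota).
Local Notation torusE := (torusE S iota).

Lemma log_deriv_sufS y (i : 'I_m) : log_deriv D (expN_suf y i) =
  D (tnth y i) *: NE i +
  expN (tnth y i) i *m log_deriv D (expN_suf y i.+1) *m invmx (expN (tnth y i) i).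
Proof.
have [PU _] := unitri_expN_suf charC S iota y i.+1.
by rewrite expN_sufS log_derivM ?expN_unit // log_deriv_expN.
Qed.

Lemma lift_fun_over (K : {pred E}) (f : 'M[C]_n -> C) (A : 'M[E]_n) : divring_closed K ->
  (forall c, iota c \in K) -> mx_over K A -> lift_fun iota f A \in K.
Proof.
move=> cK Kiota KA; apply: (subfield_sum cK) => i _; apply: (subfield_sum cK) => j _.
exact: (subfieldM cK).
Qed.

Lemma iota_over (K : {pred E}) (A : 'M[C]_n) : (forall c, iota c \in K) -> mx_over K A^E.
Proof. by move=> Kiota i j; rewrite mxE. Qed.

Lemma expN_over (K : {pred E}) a i : divring_closed K -> (forall c, iota c \in K) ->
  a \in K -> mx_over K (expN a i).
Proof.
by move=> cK Kiota Ka; apply/mx_over_mxexp/mx_overZ => //; apply: iota_over.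
Qed.

Lemma unip_prod_over (K : {pred E}) y : divring_closed K -> (forall c, iota c \in K) ->
  (forall i, tnth y i \in K) -> mx_over K (unip_prod iota S y).
Proof. by move=> cK Kiota Ky; apply: mx_over_prod => // i; apply: expN_over. Qed.

Lemma torus_prod_over (K : {pred E}) z : divring_closed K -> (forall c, iota c \in K) ->
  (forall i, tnth z i \in K) -> mx_over K (torus_prod iota S z).
Proof. by move=> cK Kiota Kz; apply: mx_over_prod => // i; apply: mx_over_laurent. Qed.

(** A family of fields covers both uses: the constant family [L] for [x], where the coefficients are
    already in [L], and the tower over [L(z)] for [y], where stripping the [k]-th factor costs the
    adjunction of its coefficient. *)
Lemma peel (K : nat -> {pred E}) y : (forall k, divring_closed (K k)) ->
  (forall k, {subset K k <= K k.+1}) -> (forall k c, iota c \in K k) ->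
  (forall i : 'I_m, tnth y i \in K i.+1) ->
  mx_over (K 0%N) (log_deriv D (unip_prod iota S y)) ->
  forall i : 'I_m, D (tnth y i) \in K i.
Proof.
move=> cK KK Kiota Ky; rewrite -expN_suf0 => K0.
have Dy (i : 'I_m) : mx_over (K i) (log_deriv D (expN_suf y i)) -> D (tnth y i) \in K i.
  (* Behind the leading factor everything starts at index [i.+1], so the coordinate at [i] is
     exactly the derivative of the parameter. *)
  move=> Ki; suff <- : coordN i (log_deriv D (expN_suf y i)) = D (tnth y i).
    exact: lift_fun_over.
  have hQ : negspan i.+1 (expN (tnth y i) i *m log_deriv D (expN_suf y i.+1)
      *m invmx (expN (tnth y i) i)).
    by apply: unitri_conj; [apply: unitri_expN|apply: negspan_log_deriv].
  rewrite log_deriv_sufS; transitivity (D (tnth y i) * coordN i (NE i)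
    + coordN i (expN (tnth y i) i *m log_deriv D (expN_suf y i.+1)
      *m invmx (expN (tnth y i) i))); first by rewrite -lift_funZ -lift_funD.
  by rewrite (negspan_coord0 hQ) // coordN_NE eqxx mulr1 addr0.
suff Kk k : (k <= m)%N -> mx_over (K k) (log_deriv D (expN_suf y k)).
  by move=> i; apply/Dy/Kk/ltnW.
elim: k => // k IH km; have {}IH := IH (ltnW km); pose i := Ordinal km.
have Ei : mx_over (K k.+1) (expN (tnth y i) i) by apply: expN_over => //; apply: Ky i.
have -> : log_deriv D (expN_suf y k.+1) = invmx (expN (tnth y i) i) *m
    (log_deriv D (expN_suf y k) - D (tnth y i) *: NE i) *m expN (tnth y i) i.
  rewrite -[k in X in X - _]/(nat_of_ord i) log_deriv_sufS addrAC subrr add0r.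
  by rewrite !mulmxA mulVmx ?expN_unit // mul1mx mulmxKV // expN_unit.
apply: mx_overM => //; apply: mx_overM => //; first exact: mx_overV.
apply: mx_overB => //; first by move=> a b; apply/KK/IH.
by apply: mx_overZ; [|apply/KK/(Dy i)|apply: iota_over].
Qed.

Lemma log_deriv_torus_prod : exists2 c : 'I_l -> C, forall i, c i != 0 &
  forall z : l.-tuple E, (forall i, tnth z i != 0) -> torus_prod iota S z \in unitmx ->
  log_deriv D (torus_prod iota S z) =
    \sum_i (iota (c i) * (D (tnth z i) / tnth z i)) *: (H_ i)^E.
Proof.
have /choice [c Hc] : forall i, exists c, c != 0 /\ forall z, z != 0 ->
    torusE i z \in unitmx -> log_deriv D (torusE i z) = (iota c * (D z / z)) *: (H_ i)^E.
  by move=> i; have [c c0 H] := log_deriv_torusE charC S derD Diota i; exists c.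
exists c => [i|z z0]; first by have [] := Hc i.
have -> : torus_prod iota S z = \prod_i torusE i (tnth z i) by [].
elim: (index_enum _) => [|i r IH]; first by rewrite !big_nil => _; have := log_deriv_iota Diota (1%:M : 'M[C]_n); rewrite map_mx1.
rewrite !big_cons unitmx_mul => /andP[tU rU].
have [_ th _] := tstab_torusE charC (z0 i) tU.
rewrite log_derivM // IH // (Hc i).2 //; congr (_ + _).
rewrite mulmx_sumr mulmx_suml; apply: eq_bigr => j _.
by rewrite -scalemxAr -scalemxAl th ?mulmxK //; apply: h_H.
Qed.

(* Conjugation by the longest element turns b^- into b^+. *)
Lemma coordN_weyl_conj Z j : bspan S iota Z ->
  coordN j ((weyl_repr S)^E *m Z *m invmx (weyl_repr S)^E) = 0.
Proof.
move=> [a [c [_ e]]].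
have -> : Z = \sum_i a i *: (H_ i)^E + \sum_i c i *: NE i by rewrite -e addrC subrK.
have [_ wh _] := norm_h_weyl S; set w := (weyl_repr S)^E.
have conjE (A : 'M[C]_n) : w *m A^E *m invmx w = (weyl_repr S *m A *m invmx (weyl_repr S))^E.
  by rewrite -map_invmx -!map_mxM.
have conj_sum (J : finType) (d : J -> E) F :
    w *m (\sum_i d i *: F i) *m invmx w = \sum_i d i *: (w *m F i *m invmx w).
  rewrite mulmx_sumr mulmx_suml; apply: eq_bigr => i _.
  by rewrite -scalemxAr -scalemxAl.
rewrite mulmxDr mulmxDl !conj_sum coordND !coordN_combination.
rewrite !big1 ?addr0 // => i _; rewrite conjE coordN_iota.
  by rewrite weyl_conj_neg ?rmorph0 ?mulr0 ?neg_root_in ?neg_root_nonneg.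
by rewrite h_coordX ?rmorph0 ?mulr0 ?neg_root_in //; apply/wh/h_H.
Qed.

Lemma lift_coordH (a : 'I_l -> E) Q i : negspan 0 Q ->
  lift_fun iota (coordH S i) (\sum_j a j *: (H_ j)^E + Q) = a i.
Proof.
move=> [c [_ ->]].
have li A : lift_fun iota (coordH S i) A^E = iota (coordH S i A).
  exact: (lift_fun_iota iota (dual_coord (chev_seq S) (H_ i))).
rewrite lift_funD !lift_fun_sum [X in _ + X]big1 => [|j _]; last first.
  by rewrite lift_funZ li coordHX ?rmorph0 ?mulr0 // neg_root_in.
rewrite addr0 (bigD1 i) //= lift_funZ li coordHH eqxx rmorph1 mulr1 big1 ?addr0 // => j /negPf ji.
by rewrite lift_funZ li coordHH eq_sym ji rmorph0 mulr0.
Qed.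

End Peeling.

Section Semilinear.
Variables (C : closedFieldType) (E : fieldType) (iota : {rmorphism C -> E}).
Variables (s : {rmorphism E -> E}) (siota : forall c, s (iota c) = iota c).

Lemma map_mx_iota_fix r (A : 'M[C]_r) : map_mx s (map_mx iota A) = map_mx iota A.
Proof. by apply/matrixP => i j; rewrite !mxE siota. Qed.

Lemma map_mxexp r (N : 'M[E]_r) : map_mx s (mxexp N) = mxexp (map_mx s N).
Proof.
rewrite /mxexp raddf_sum; apply: eq_bigr => k _ /=.
by rewrite map_mxZ fmorphV rmorph_nat rmorphXn.
Qed.

Lemma map_laurent_eval r (P : laurent_mx C r) z :
  map_mx s (laurent_eval iota P z) = laurent_eval iota P (s z).
Proof.
apply/matrixP => i j; rewrite !mxE rmorphM fmorphV rmorphXn; congr (_ * _).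
rewrite -horner_map -map_poly_comp; congr _.[_].
by apply: eq_map_poly => c /=; rewrite siota.
Qed.

Variables (n l m : nat) (S : group_data C n l m).

Lemma map_unip_prod x : map_mx s (unip_prod iota S x) = unip_prod iota S (map_tuple s x).
Proof.
rewrite /unip_prod rmorph_prod; apply: eq_bigr => i _ /=.
by rewrite map_mxexp map_mxZ map_mx_iota_fix tnth_map.
Qed.

Lemma map_torus_prod z : map_mx s (torus_prod iota S z) = torus_prod iota S (map_tuple s z).
Proof.
rewrite /torus_prod rmorph_prod; apply: eq_bigr => i _ /=.
by rewrite map_laurent_eval tnth_map.
Qed.

End Semilinear.

Section NormalForm.
Variables (C : closedFieldType) (charC : [pchar C] =i pred0).
Variables (n l m : nat) (S : group_data C n l m).
Variables (E : fieldType) (iota : {rmorphism C -> E}).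
Variables (D : {additive E -> E}) (derD : derivation D).
Variables (F : {pred E}) (diffF : diff_subfield D F) (constF : constants iota D F).
Variables (Y : 'M[E]_n) (YU : Y \in unitmx).
Hypothesis LDY : forall i j, log_deriv D Y i j \in F.
Variables (x : m.-tuple E) (z : l.-tuple E) (y : m.-tuple E).
Hypothesis z0 : forall i, tnth z i != 0.
Let u := unip_prod iota S x.
Let w := map_mx iota (weyl_repr S).
Let t := torus_prod iota S z.
Let v := unip_prod iota S y.
Hypothesis YE : Y = u *m w *m t *m v.

Local Notation h := (lie idfun (max_torus S)).
Local Notation H_ := (chev_H S).
Local Notation "A ^E" := (map_mx iota A) (at level 2, format "A ^E").
Local Notation NE := (NE S iota).
Local Notation negspan := (negspan S iota).
Local Notation coordN := (coordN S iota).
Local Notation L := (adjoin F x).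

Lemma constants_iota c : iota c \in F /\ D (iota c) = 0.
Proof. by apply/constF; exists c. Qed.

Let Diota c : D (iota c) = 0. Proof. by have [] := constants_iota c. Qed.

Lemma L_iota c : iota c \in L.
Proof. by apply: adjoin_sub; have [] := constants_iota c. Qed.

Let cL : divring_closed L. Proof. exact: adjoin_closed. Qed.

Let uU : u \in unitmx. Proof. by have := YU; rewrite YE !unitmx_mul => /andP[/andP[/andP[]]]. Qed.
Let wU : w \in unitmx. Proof. by have := YU; rewrite YE !unitmx_mul => /andP[/andP[/andP[]]]. Qed.
Let tU : t \in unitmx. Proof. by have := YU; rewrite YE !unitmx_mul => /andP[/andP[]]. Qed.
Let vU : v \in unitmx. Proof. by have := YU; rewrite YE !unitmx_mul => /andP[]. Qed.

Lemma unip_prod_unitri q : unitri S iota (unip_prod iota S q).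
Proof. by rewrite -expN_suf0; apply: unitri_expN_suf. Qed.

Let t_stab : tstab S iota t.
Proof. by apply: (tstab_prod charC (z := tnth z)). Qed.

Let U0 := invmx u *m log_deriv D u *m u.
Let B := log_deriv D (t *m v).

Lemma log_deriv_split : invmx u *m log_deriv D Y *m u = U0 + w *m B *m invmx w.
Proof.
have tvU : t *m v \in unitmx by rewrite unitmx_mul tU.
have wtvU : w *m (t *m v) \in unitmx by rewrite unitmx_mul wU.
have -> : Y = u *m (w *m (t *m v)) by rewrite YE !mulmxA.
rewrite (log_derivM derD uU wtvU) (log_derivM derD wU tvU) log_deriv_iota // add0r mulmxDr mulmxDl; congr (_ + _).
by rewrite !mulmxA mulVmx // mul1mx mulmxKV.
Qed.

Lemma negspan_U0 : negspan 0 U0.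
Proof.
rewrite /U0 -[X in _ *m X](invmxK u); apply: unitri_conj; first exact/unitri_inv/unip_prod_unitri.
by rewrite /u -expN_suf0; apply: negspan_log_deriv.
Qed.

Let LDt_v := t *m log_deriv D v *m invmx t.

Lemma negspan_LDt_v : negspan 0 LDt_v.
Proof. by apply: tstab_negspan => //; rewrite /v -expN_suf0; apply: negspan_log_deriv. Qed.

Lemma log_deriv_B : exists2 c : 'I_l -> C, forall i, c i != 0 &
  B = \sum_i (iota (c i) * (D (tnth z i) / tnth z i)) *: (H_ i)^E + LDt_v.
Proof.
have [c c0 Ht] := log_deriv_torus_prod charC S derD Diota.
by exists c => //; rewrite /B log_derivM // Ht.
Qed.

Lemma bspan_B : bspan S iota B.
Proof.
have [c _ ->] := log_deriv_B; exists (fun i => iota (c i) * (D (tnth z i) / tnth z i)).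
rewrite addrC addKr.
exact: negspan_LDt_v.
Qed.

Lemma u_over : mx_over L u.
Proof.
apply: unip_prod_over => // [|i]; first exact: L_iota.
by apply: adjoin_mem; apply: mem_tnth.
Qed.

Lemma U0_over : mx_over L U0.
Proof.
rewrite (negspan_coord negspan_U0); apply: mx_over_sum => // i _.
apply: mx_overZ => //; last exact/iota_over/L_iota.
have -> : coordN i U0 = coordN i (invmx u *m log_deriv D Y *m u).
  by rewrite log_deriv_split coordND coordN_weyl_conj ?addr0 //; apply: bspan_B.
apply: lift_fun_over => //; first exact: L_iota.
apply: mx_overM => //; last exact: u_over.
apply: mx_overM => //; first by apply: mx_overV => //; apply: u_over.
by move=> a b; apply: adjoin_sub.
Qed.

Lemma Dx_L i : D (tnth x i) \in L.
Proof.
apply: (peel charC (S := S) derD Diota (K := fun=> L)) => // [k a //|k c|j|]; first exact: L_iota.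
  by apply: adjoin_mem; apply: mem_tnth.
have -> : log_deriv D (unip_prod iota S x) = u *m U0 *m invmx u.
  by rewrite /U0 !mulmxA mulmxV // mul1mx mulmxK.
apply: mx_overM => //; last by apply: mx_overV => //; apply: u_over.
by apply: mx_overM => //; [apply: u_over|apply: U0_over].
Qed.

Lemma diff_L : diff_subfield D L.
Proof.
apply: adjoin_deriv => //; first by have [] := diffF.
by move=> a /tnthP [i ->]; apply: Dx_L.
Qed.

Lemma B_over : mx_over L B.
Proof.
have -> : B = invmx w *m (invmx u *m log_deriv D Y *m u - U0) *m w.
  by rewrite log_deriv_split addrC addKr !mulmxA mulVmx // mul1mx mulmxKV.
have wL : mx_over L w by apply/iota_over/L_iota.
apply: mx_overM => //; apply: mx_overM => //; first exact: mx_overV.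
apply: mx_overB => //; last exact: U0_over.
apply: mx_overM => //; last exact: u_over.
apply: mx_overM => //; first by apply: mx_overV => //; apply: u_over.
by move=> a b; apply: adjoin_sub.
Qed.

Lemma Dz_L i : D (tnth z i) / tnth z i \in L.
Proof.
have [c c0 BE] := log_deriv_B.
have e : lift_fun iota (coordH S i) B = iota (c i) * (D (tnth z i) / tnth z i).
  by rewrite BE lift_coordH //; apply: negspan_LDt_v.
have -> : D (tnth z i) / tnth z i = lift_fun iota (coordH S i) B / iota (c i).
  by rewrite e [RHS]mulrC mulKf // fmorph_eq0.
apply: (subfield_div cL); last exact: L_iota.
by apply: lift_fun_over => //; [apply: L_iota|apply: B_over].
Qed.

Lemma Dy_tower (i : 'I_m) : D (tnth y i) \in adjoin L (z ++ take i y).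
Proof.
have iotaK s c : iota c \in adjoin L s by apply/adjoin_sub/L_iota.
apply: (peel charC (S := S) derD Diota (K := fun k => adjoin L (z ++ take k y))) => // [k|k|j|].
- exact: adjoin_closed.
- apply: adjoin_min; [exact: adjoin_closed|exact: adjoin_sub|].
  move=> a; rewrite mem_cat => /orP[az|ay]; apply: adjoin_mem; rewrite mem_cat ?az //.
  suff -> : a \in take k.+1 y by rewrite orbT.
  by apply: mem_subseq ay; rewrite -(take_takel _ (leqnSn k)); apply: take_subseq.
- apply: adjoin_mem; rewrite mem_cat (take_nth (tnth y j)) ?size_tuple //.
  by rewrite mem_rcons -tnth_nth mem_head orbT.
have cK : divring_closed (adjoin L (z ++ take 0 y)) by apply: adjoin_closed.
have tK : mx_over (adjoin L (z ++ take 0 y)) t.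
  apply: torus_prod_over => // j; apply: adjoin_mem.
  by rewrite mem_cat mem_tnth.
(* Removing the torus part from [B] shows that the logarithmic derivative of [u(y)] has entries in
   [L(z)], the base of the tower for [y]. *)
have -> : log_deriv D (unip_prod iota S y) = invmx t *m (B - log_deriv D t) *m t.
  rewrite /B log_derivM // addrC addKr !mulmxA mulVmx // mul1mx mulmxKV //.
apply: mx_overM => //; apply: mx_overM => //; first exact: mx_overV.
apply: mx_overB => //; first by move=> a b; apply/adjoin_sub/B_over.
have [c _ ->] := log_deriv_torus_prod charC S derD Diota => //.
apply: mx_over_sum => // j _; apply: mx_overZ => //; last exact: iota_over.
by apply: (subfieldM cK) => //; apply/adjoin_sub/Dz_L.
Qed.

(** One list for both kinds of generators, so that a single index runs through the tower:
    exponentials below [l], integrals from [l] on. *)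
Let zy : seq E := z ++ y.

Lemma size_zy : size zy = (l + m)%N.
Proof. by rewrite size_cat !size_tuple. Qed.

Lemma take_z i : (i <= l)%N -> take i zy = take i z.
Proof. by move=> il; rewrite take_cat size_tuple; case: ltngtP il => // -> _; rewrite subnn take0 cats0 take_oversize ?size_tuple. Qed.

Lemma take_y j : take (l + j) zy = z ++ take j y.
Proof. by rewrite take_cat size_tuple ltnNge leq_addr /= addKn. Qed.

Lemma nth_z (i : 'I_l) : nth 0 zy i = tnth z i.
Proof. by rewrite nth_cat size_tuple ltn_ord -tnth_nth. Qed.

Lemma nth_y (j : 'I_m) : nth 0 zy (l + j) = tnth y j.
Proof. by rewrite nth_cat size_tuple ltnNge leq_addr /= addKn -tnth_nth. Qed.

Let K i : {pred E} := adjoin L (take i zy).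

Lemma K_step i : (i < l + m)%N -> K i.+1 =i adjoin (K i) [:: nth 0 zy i].
Proof.
move=> ilm a; rewrite /K (take_nth 0) ?size_zy // -cats1.
exact: adjoin_cat.
Qed.

Lemma K_gen (i : nat) : (i < l + m)%N ->
  exponential D (K i) (nth 0 zy i) \/ integral D (K i) (nth 0 zy i).
Proof.
case: (ltnP i l) => il ilm.
  left; rewrite -[i]/(nat_of_ord (Ordinal il)) nth_z; split; first exact: z0.
  exact/adjoin_sub/Dz_L.
have jm : (i - l < m)%N by rewrite ltn_subLR.
right; have -> : i = (l + Ordinal jm)%N by rewrite /= subnKC.
by rewrite nth_y /integral /K take_y; apply: Dy_tower.
Qed.

Lemma K_le i j : (i <= j)%N -> {subset K i <= K j}.
Proof.
move=> ij; apply: adjoin_min; [exact: adjoin_closed|exact: adjoin_sub|].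
move=> a ai; apply: adjoin_mem; apply: mem_subseq ai.
by rewrite -(take_takel _ ij); apply: take_subseq.
Qed.

Lemma K_diff i : diff_subfield D (K i).
Proof.
apply: adjoin_deriv => //; first by have [] := diff_L.
move=> a /(nthP 0) [k]; rewrite size_take_min size_zy leq_min => /andP[ki klm] <-.
rewrite nth_take //; have cK : divring_closed (K i) := adjoin_closed _ _.
have aK : nth 0 zy k \in K i.
  by apply: adjoin_mem; rewrite -(nth_take 0 ki) mem_nth // size_take_min size_zy leq_min ki.
case: (K_gen klm) => [[n0]|] /(K_le (ltnW ki)) // H.
by rewrite -(divfK n0 (D _)); apply: (subfieldM cK).
Qed.

Lemma K_last a : a \in adjoin F (mx_entries Y) -> a \in K (l + m).
Proof.
have cK : divring_closed (K (l + m)) := adjoin_closed _ _.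
have iK c : iota c \in K (l + m) by apply/adjoin_sub/L_iota.
have zyK b : b \in zy -> b \in K (l + m).
  by move=> bs; apply: adjoin_mem; rewrite take_oversize // size_zy.
apply: adjoin_min => // [b Fb|b /mapP[[i j] _ ->]]; first by do 2! apply: adjoin_sub.
suff : mx_over (K (l + m)) Y by apply.
rewrite YE; apply: mx_overM => //; last first.
  by apply: unip_prod_over => // k; apply: zyK; rewrite mem_cat mem_tnth orbT.
apply: mx_overM => //; last first.
  by apply: torus_prod_over => // k; apply: zyK; rewrite mem_cat mem_tnth.
apply: mx_overM => //; last exact: iota_over.
by move=> a' b'; apply/adjoin_sub/u_over.
Qed.

(** * The differential Galois group over L *)

Section GaloisGroup.
Hypothesis galY : diff_gal_is iota D F Y (grp S).

Let tv_unit : t *m v \in unitmx. Proof. by rewrite unitmx_mul tU. Qed.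

Lemma gal_iota s : diff_gal D F s -> forall c, s (iota c) = iota c.
Proof. by move=> [_ _ sF] c; apply: sF; have [] := constants_iota c. Qed.

Lemma gal_sub_borel s : diff_gal D L s ->
  exists2 A, borel_neg S A & map_mx s Y = Y *m A^E.
Proof.
move=> [sb sD sL].
have sG : diff_gal D F s by split=> // a Fa; apply/sL/adjoin_sub.
have [A GA sY] := galY.1 s sG; exists A => //.
have si := gal_iota sG; have AU : A \in unitmx by have [GU _ _ _] := grp_subgroup S; apply: GU.
have sx : map_tuple s x = x.
  by apply: eq_from_tnth => i; rewrite tnth_map sL //; apply: adjoin_mem; apply: mem_tnth.
pose b := t *m v; pose b' := torus_prod iota S (map_tuple s z) *m unip_prod iota S (map_tuple s y).
have sYE : map_mx s Y = u *m w *m b'.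
  rewrite YE !map_mxM map_unip_prod // sx map_mx_iota_fix // map_torus_prod //.
  by rewrite map_unip_prod // mulmxA.
have uwU : u *m w \in unitmx by rewrite unitmx_mul uU.
have bA : b *m A^E = b'.
  by apply: (can_inj (mulKmx uwU)); rewrite -sYE sY YE /b !mulmxA.
have AE : A^E = invmx b *m b' by rewrite -bA mulKmx.
have [sB zB] := borel_alg S; have [_ _ BM _] := sB.
(* [A] has constant entries and B^- is closed, so membership may be tested over [E], where [A]
   factors as [b^-1 s(b)]. *)
apply: (dense_point_closed (iota := iota)) => //.
rewrite AE; apply: dense_point_mul => //.
  by apply: dense_point_inv => //; apply: borel_dense.
by apply: borel_dense => // i; rewrite tnth_map fmorph_eq0.
Qed.

Lemma borel_sub_gal A : borel_neg S A ->
  exists2 s, diff_gal D L s & map_mx s Y = Y *m A^E.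
Proof.
move=> BA; have [_ BG _] := borel_negP S.
have [s sG sY] := galY.2 A (BG _ BA); exists s => //.
have si := gal_iota sG; have [sb sD sF] := sG.
have [[sB _] _] := (borel_alg S, t_stab); have [BU _ _ _] := sB; have AU := BU _ BA.
pose x' := map_tuple s x; pose u' := unip_prod iota S x'.
pose b := t *m v.
pose t' := torus_prod iota S (map_tuple s z); pose v' := unip_prod iota S (map_tuple s y).
have tE' : t' = map_mx s t by rewrite /t' map_torus_prod.
have vE' : v' = map_mx s v by rewrite /v' map_unip_prod.
have tU' : t' \in unitmx by rewrite tE' map_unitmx.
have vU' : v' \in unitmx by rewrite vE' map_unitmx.
have uU' : u' \in unitmx by have [] := unip_prod_unitri x'.
have tt' : tstab S iota t'.
  by apply: (tstab_prod charC (z := tnth (map_tuple s z))) => // i; rewrite tnth_map fmorph_eq0.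
have sYE : map_mx s Y = u' *m w *m (t' *m v').
  rewrite YE !map_mxM map_unip_prod // map_mx_iota_fix // map_torus_prod //.
  by rewrite map_unip_prod // mulmxA.
(* Comparing [s(Y) = u' w s(b)] with [Y A = u w b A] identifies the conjugate of [q] by [w] with
   [u^-1 u']. Every factor of [q] normalizes [bspan]. *)
pose q := b *m A^E *m invmx (t' *m v').
have AEU : A^E \in unitmx by rewrite map_unitmx.
have qU : q \in unitmx by rewrite !unitmx_mul unitmx_inv unitmx_mul tU vU AEU tU'.
have qE : w *m q *m invmx w = invmx u *m u'.
  apply: (can_inj (mulKmx uU)); rewrite [RHS]mulKVmx //.
  have tvU' : t' *m v' \in unitmx by rewrite unitmx_mul tU'.
  apply: (can_inj (mulmxK wU)); apply: (can_inj (mulmxK tvU')).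
  rewrite -sYE sY YE -!mulmxA (mulmxA (invmx w)) mulVmx // mul1mx; do 2! congr (_ *m _).
  by rewrite mulVmx // mulmx1.
have bq : bstab S iota q.
  have bv : bstab S iota v by rewrite /v -expN_suf0; apply: bstab_expN_suf.
  have bv' : bstab S iota (invmx v') by rewrite /v' -expN_suf0; apply: bstab_expN_suf_inv.
  have bt := bstab_tstab charC t_stab; have bt' := bstab_tstab charC (tstab_inv tt').
  have bA := bstab_borel charC (iota := iota) BA.
  have tUi : invmx t' \in unitmx by rewrite unitmx_inv.
  have vUi : invmx v' \in unitmx by rewrite unitmx_inv.
  have btv := bstab_mul tU vU bt bv.
  have bi := bstab_mul vUi tUi bv' bt'.
  rewrite /q invmx_mul //; apply: bstab_mul => //.
  - by rewrite unitmx_mul tv_unit.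
  - by rewrite unitmx_mul vUi.
  - exact: bstab_mul.
clearbody q.
have fixH M : h M -> u' *m M^E *m invmx u' = u *m M^E *m invmx u.
  move=> hM; pose N := invmx u *m u'.
  (* [N M N^-1 - M] lies in the span of u^-, as [u] and [u'] are unipotent. But [N M N^-1] lies in
     [w b^- w^-1], which has no negative root coordinates, and neither has [M]; hence the difference
     is zero. *)
  have NM : N *m M^E *m invmx N = M^E.
    have [_ _ wh] := norm_h_weyl S; have hM' := wh M hM.
    have e1 : N *m M^E *m invmx N = w *m (q *m (invmx (weyl_repr S) *m M *m weyl_repr S)^E *m invmx q) *m invmx w.
      rewrite /N -qE invmx_mul ?unitmx_mul ?wU ?unitmx_inv // invmx_mul // invmxK.
      by rewrite !map_mxM map_invmx !mulmxA.
    have c0 j : coordN j (N *m M^E *m invmx N) = 0.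
      by rewrite e1 coordN_weyl_conj //; apply/bq/bspan_h.
    have nN : negspan 0 (N *m M^E *m invmx N - M^E).
      have hu := expN_suf_h charC iota x 0 hM; have hu' := expN_suf_h charC iota x' 0 hM.
      rewrite expN_suf0 in hu; rewrite expN_suf0 in hu'.
      have ti := unitri_inv (unip_prod_unitri x).
      have -> : N *m M^E *m invmx N - M^E =
          invmx u *m (u' *m M^E *m invmx u' - M^E) *m invmx (invmx u)
          - invmx u *m (u *m M^E *m invmx u - M^E) *m invmx (invmx u).
        rewrite /N invmx_mul ?unitmx_inv // invmxK -mulmxBl -mulmxBr opprB addrA subrK.
        by rewrite mulmxBr mulmxBl !mulmxA mulVmx // mul1mx mulmxKV.
      by apply: negspanB; apply: unitri_conj.
    apply/eqP; rewrite -subr_eq0 (negspan_coord nN) big1 // => j _.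
    rewrite coordND c0 add0r -raddfN coordN_iota.
    rewrite (_ : coordX S _ _ = 0) ?rmorph0 ?scale0r //.
    rewrite h_coordX ?neg_root_in //.
    by rewrite -scaleN1r; apply: lieZ.
  rewrite -{2}NM /N invmx_mul ?unitmx_inv // invmxK.
  by rewrite !mulmxA mulmxV // mul1mx mulmxK.
have sx : x' = x.
  by apply: (expN_suf_inj charC (S := S) (iota := iota)) => M hM; rewrite !expN_suf0; apply: fixH.
split=> // a.
pose K0 : {pred E} := fun a => s a == a.
suff : {subset L <= K0} by move=> H /H /eqP.
apply: adjoin_min => [|b' Fb|b' /tnthP[i ->]].
- split=> [|a1 a2 /eqP e1 /eqP e2|a1 a2 /eqP e1 /eqP e2]; apply/eqP.
  + exact: rmorph1.
  + by rewrite rmorphB /= e1 e2.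
  + by rewrite fmorph_div /= e1 e2.
- exact/eqP/sF.
- by apply/eqP; rewrite -{2}sx tnth_map.
Qed.

End GaloisGroup.
End NormalForm.

(** A vanishing coordinate would be a root of the variable ['X_i]. Applied to [z], this puts the
    torus parameters in G_m. *)
Lemma alg_independent_neq0 (E : fieldType) (K : {pred E}) k (s : k.-tuple E) i :
  divring_closed K -> alg_independent K s -> tnth s i != 0.
Proof.
move=> cK indep; apply/eqP => si0.
have XK : 'X_i \is a mpolyOver k K.
  by rewrite qualifE /= msuppX /= mcoeffX eqxx andbT; apply: subfield1.
have := indep 'X_i XK; rewrite mevalXU si0 => /(_ erefl)/(congr1 (mcoeff U_(i))).
by rewrite mcoeffX eqxx mcoeff0 => /eqP; rewrite oner_eq0.
Qed.

Theorem proposition4p7 (C : closedFieldType) (charC : [pchar C] =i pred0)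
    (n l m : nat) (S : group_data C n l m)
    (E : fieldType) (iota : {rmorphism C -> E})
    (D : {additive E -> E}) (derD : derivation D)
    (F : {pred E}) (diffF : diff_subfield D F) (constF : constants iota D F)
    (Y : 'M[E]_n) (primY : full_primitive iota D F (grp S) Y)
    (x : m.-tuple E) (z : l.-tuple E) (y : m.-tuple E)
    (nfY : normal_form_coeffs iota F S Y x z y) :
  let L := adjoin F x in
  [/\ diff_subfield D L /\ constants iota D L,
      [/\ picard_vessiot D L, fundamental D L Y
        & diff_gal_is iota D L Y (borel_neg S)],
      forall a, a \in adjoin L (z ++ y),
      liouvillian D L
    & (forall i : 'I_l,
         let K := adjoin L (take i z) in
         [/\ diff_subfield D K,
             adjoin L (take i.+1 z) =i adjoin K [:: tnth z i]
           & exponential D K (tnth z i)]) /\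
      (forall j : 'I_m,
         let K := adjoin L (z ++ take j y) in
         [/\ diff_subfield D K,
             adjoin L (z ++ take j.+1 y) =i adjoin K [:: tnth y j]
           & integral D K (tnth y j)])].
Proof.
move=> L; have [[_ constE _] [YU _] gen [_ LDY] gal] := primY; have [indep YE] := nfY.
have [cF DF] := diffF.
have z0 i : tnth z i != 0.
  have := alg_independent_neq0 (rshift m (lshift m i)) cF indep.
  by rewrite tnth_rshift tnth_lshift.
have dL : diff_subfield D L by apply: (diff_L charC derD diffF constF YU LDY z0 YE).
have LF a : a \in F -> a \in L by apply: adjoin_sub.
have LDL i j : log_deriv D Y i j \in L by apply: LF.
(* The matrix [Y] stays fundamental after enlarging the base field, since [F] is contained in
   [L]. *)
have genL a : a \in adjoin L (mx_entries Y).
  have /asboolP H := gen a; apply: H.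
  - exact: adjoin_closed.
  - by move=> b /LF Lb; apply: adjoin_sub.
  - exact: adjoin_mem.
have fund : fundamental D L Y by [].
have zy_gen a : a \in adjoin L (z ++ y).
  have := K_last constF YE (gen a).
  by rewrite take_oversize // size_zy.
have Kd := K_diff charC derD diffF constF YU LDY z0 YE.
have Kg := K_gen charC derD constF YU LDY z0 YE.
have Ks i : (i < l + m)%N -> adjoin L (take i.+1 (z ++ y)) =i
    adjoin (adjoin L (take i (z ++ y))) [:: nth 0 (z ++ y) i] by apply: K_step.
split=> //.
(* A constant of [L] is a constant of [E], hence lies in [F] because [E] over [F] is
   Picard-Vessiot. *)
- split=> // a; split=> [[La Da]|[c ->]]; first by apply/constF; split; [apply: constE|].
  have [Fc Dc] : iota c \in F /\ D (iota c) = 0 by apply/constF; exists c.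
  by split=> //; apply: LF.
- split=> //; first by split=> // [a Da|]; [apply/LF/constE|exists n, Y].
  split=> [s|A]; first exact: (gal_sub_borel charC constF YU z0 YE gal).
  exact: (borel_sub_gal charC constF YU z0 YE gal).
- exists (l + m)%N, (fun i => adjoin L (take i (z ++ y))), (fun i => nth 0 (z ++ y) i).
  split=> [a|a|i _|i ilm].
  + rewrite take0; apply/idP/idP; last exact: adjoin_sub.
    by apply: adjoin_min => //; apply: adjoin_closed.
  + by rewrite take_oversize ?size_zy // zy_gen.
  + exact: Kd.
  + split; first exact: Ks.
    by case: (Kg i ilm) => H; [apply: Or32|apply: Or33].
- split=> [i|j].
  + have il := ltn_ord i; have ilm : (i < l + m)%N by rewrite ltn_addr.
    split.
    * by have := Kd i; rewrite take_z // ltnW.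
    * by have := Ks i ilm; rewrite !take_z ?nth_z // ltnW.
    * have zi := Dz_L charC derD constF YU LDY z0 YE i.
      by split; [apply: z0|apply: adjoin_sub].
  + have jlm : (l + j < l + m)%N by rewrite ltn_add2l.
    split.
    * by have := Kd (l + j)%N; rewrite take_y.
    * by have := Ks (l + j)%N jlm; rewrite -addnS !take_y nth_y.
    * exact: (Dy_tower charC derD constF YU LDY z0 YE j).
Qed.
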